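(* There exist an absolute constant $C\ge1$, for each $(\boldsymbol{\Sigma}_{\mathbf{x}},\boldsymbol{\sigma}_{\mathbf{x},y})$ and $s$ a constant $\widetilde{C}_s\ge1$ depending only on $(\boldsymbol{\Sigma}_{\mathbf{x}},\boldsymbol{\sigma}_{\mathbf{x},y})$ and $s$, and for each $(\boldsymbol{\Sigma}_{\mathbf{q}},\boldsymbol{\sigma}_{\mathbf{q},y})$ a constant $C_{r_{\mathbf{q}}}\ge1$ depending only on $(\boldsymbol{\Sigma}_{\mathbf{q}},\boldsymbol{\sigma}_{\mathbf{q},y})$, such that, with $\widetilde{M}_s$ and $K_{\widetilde{\mathcal{B}}_s}$ defined in the context from these constants, the following holds. Let $(\mathbf{x},y)\in\mathbb{R}^p\times\mathbb{R}$ be a centered random pair with finite second moments, $\boldsymbol{\sigma}_{\mathbf{x},y}\ne\mathbf{0}_p$, $\sigma_y^2=\mathbb{E}(y^2)>0$, $1\le r_{\mathbf{x}}=\operatorname{rk}(\boldsymbol{\Sigma}_{\mathbf{x}})\le p$, and finite moment-ratios $L_y$ and $L_{\mathcal{B}}$ for every linear subspace $\mathcal{B}\subseteq\mathcal{R}(\boldsymbol{\Sigma}_{\mathbf{x}})$, following the extended latent factor model (see context) with latent features $\mathbf{q}$ of rank $r_{\mathbf{q}}$, where $r_{\mathbf{q}}+1\le m_y$, and noise parameter $\sigma\ge0$ satisfying, for some $\tau\ge8$, $\sigma^2<\lambda_{r_{\mathbf{q}}}(\boldsymbol{\Sigma}_{\mathbf{q}})/(\tau\{C_{r_{\mathbf{q}}}+1\})$.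 Let $(\mathbf{X},\mathbf{y})\in\mathbb{R}^{n\times p}\times\mathbb{R}^n$ be a dataset of $n$ i.i.d. realizations of $(\mathbf{x},y)$. Assume: (i) $\dim(\widehat{\mathcal{K}}_p(\mathbf{x},y))\ge\dim(\mathcal{K}_p(\mathbf{x},y))$; (ii) for all $1\le s\le r_{\mathbf{q}}+1$, $\delta_{\widetilde{\mathcal{B}}_s,n}\to0$ as $n\to\infty$ and $\nu_{\widetilde{\mathcal{B}}_s,n}:=\widetilde{M}_sK_{\widetilde{\mathcal{B}}_s}\delta_{\widetilde{\mathcal{B}}_s,n}<\frac12$. For $1\le s\le p$ let $\widehat{\mathbf{U}}_s$ be the orthogonal projection of $\mathbb{R}^p$ onto the sample Krylov space $\widehat{\mathcal{K}}_s(\mathbf{x},y)=\mathcal{K}_s(\widehat{\boldsymbol{\Sigma}}_{\mathbf{x}},\widehat{\boldsymbol{\sigma}}_{\mathbf{x},y})$. Then, for any $\nu_{\widetilde{\mathcal{B}}_{r_{\mathbf{q}}+1},n}<\nu_{r_{\mathbf{q}}+1,n}<\frac12$ such that $$K_{\widetilde{\mathcal{B}}_{r_{\mathbf{q}}+1}}\,\nu_{r_{\mathbf{q}}+1,n}^{-1}\,\delta_{\widetilde{\mathcal{B}}_{r_{\mathbf{q}}+1},n}<\frac{\lambda_{r_{\mathbf{q}}}(\boldsymbol{\Sigma}_{\mathbf{q}})}{6\tau\{\|\boldsymbol{\Sigma}_{\mathbf{x}}\|_{op}\vee\|\boldsymbol{\sigma}_{\mathbf{x},y}\|_2\}},$$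 with probability at least $1-2\nu_{r_{\mathbf{q}}+1,n}$ the sample early-stopped dimension $$\widehat{m}_{\mathbf{q}}:=\min\left\{1\le s\le p-1:\ \frac{\kappa_2(\widehat{\mathbf{U}}_{s+1}\widehat{\boldsymbol{\Sigma}}_{\mathbf{x}}\widehat{\mathbf{U}}_{s+1})}{\kappa_2(\widehat{\mathbf{U}}_s\widehat{\boldsymbol{\Sigma}}_{\mathbf{x}}\widehat{\mathbf{U}}_s)}>\frac{2\tau-5}{4}\right\}$$ satisfies $\widehat{m}_{\mathbf{q}}\le r_{\mathbf{q}}$.
   Context: Notation: $\boldsymbol{\Sigma}_{\mathbf{u}}=\mathbb{E}(\mathbf{u}\mathbf{u}^t)$, $\boldsymbol{\sigma}_{\mathbf{u},y}=\mathbb{E}(\mathbf{u}y)$; $\mathcal{R}(\cdot)$ range; $\lambda_1(\cdot)\ge\lambda_2(\cdot)\ge\cdots$ sorted eigenvalues; $\|\cdot\|_{op}$ operator norm; $\kappa_2(\mathbf{A})$ is the ratio of the largest to the smallest nonzero eigenvalue of a positive semidefinite $\mathbf{A}$; $a\vee b=\max(a,b)$; $\mathcal{K}_s(\mathbf{A},\mathbf{b})=\operatorname{span}\{\mathbf{b},\dots,\mathbf{A}^{s-1}\mathbf{b}\}$. Relevant features. For $\mathcal{B}\subseteq\mathcal{R}(\boldsymbol{\Sigma}_{\mathbf{x}})$, $\mathbf{x}_{\mathcal{B}}$ is the orthogonal projection of $\mathbf{x}$ onto $\mathcal{B}$. The relevant subspace $\mathcal{B}_y$ is the (unique) subspace $\mathcal{B}\subseteq\mathcal{R}(\boldsymbol{\Sigma}_{\mathbf{x}})$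 of smallest dimension such that, with $\mathcal{B}^\perp$ its orthogonal complement in $\mathcal{R}(\boldsymbol{\Sigma}_{\mathbf{x}})$, $\mathbb{E}(\mathbf{x}_{\mathcal{B}^\perp}y)=\mathbf{0}_p$ and $\mathbb{E}(\mathbf{x}_{\mathcal{B}^\perp}\mathbf{x}_{\mathcal{B}}^t)=\mathbf{0}_{p\times p}$. Then $\mathbf{x}=\mathbf{x}_y+\mathbf{x}_{y^\perp}$ with $\mathbf{x}_y,\mathbf{x}_{y^\perp}$ the projections of $\mathbf{x}$ onto $\mathcal{B}_y$ and onto its complement $\mathcal{B}_y^\perp$ in $\mathcal{R}(\boldsymbol{\Sigma}_{\mathbf{x}})$; $r_y=\operatorname{rk}(\boldsymbol{\Sigma}_{\mathbf{x}_y})=\dim\mathcal{B}_y$. Extended latent factor model: $y=\mathbf{q}^t\boldsymbol{\alpha}+\varepsilon$ and $\mathbf{x}=\mathbf{x}_y+\mathbf{x}_{y^\perp}=\mathbf{q}+\sigma\mathbf{e}+\mathbf{x}_{y^\perp}$ (so $\mathbf{x}_y=\mathbf{q}+\sigma\mathbf{e}$), where $\mathbf{q}\in\mathbb{R}^p$ is a centered random vector with $1\le r_{\mathbf{q}}=\operatorname{rk}(\boldsymbol{\Sigma}_{\mathbf{q}})\le r_y$ and $\mathcal{R}(\boldsymbol{\Sigma}_{\mathbf{q}})\subseteq\mathcal{B}_y$, $\boldsymbol{\alpha}\in\mathbb{R}^p$ is deterministic, $\varepsilon\in\mathbb{R}$ is an independent centered random variable, $\sigma\ge0$, and $\mathbf{e}\in\mathbb{R}^p$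 is an independent centered random vector with $\mathcal{R}(\boldsymbol{\Sigma}_{\mathbf{e}})=\mathcal{B}_y$ and $\lambda_1(\boldsymbol{\Sigma}_{\mathbf{e}})=1$. Hence $\boldsymbol{\sigma}_{\mathbf{x},y}=\boldsymbol{\sigma}_{\mathbf{q},y}$ and $\boldsymbol{\Sigma}_{\mathbf{x}}=\boldsymbol{\Sigma}_{\mathbf{q}}+\sigma^2\boldsymbol{\Sigma}_{\mathbf{e}}+\boldsymbol{\Sigma}_{\mathbf{x}_{y^\perp}}$. Standing convention: $\mathcal{R}(\boldsymbol{\Sigma}_{\mathbf{q}})=\mathcal{K}_{r_{\mathbf{q}}}(\boldsymbol{\Sigma}_{\mathbf{q}},\boldsymbol{\sigma}_{\mathbf{q},y})$. Parsimonious reductions. For $1\le s\le r_y$: $\mathcal{B}_s=\mathcal{K}_s(\boldsymbol{\Sigma}_{\mathbf{x}_y},\boldsymbol{\sigma}_{\mathbf{x}_y,y})$, $\mathbf{x}_s$ is the orthogonal projection of $\mathbf{x}_y$ onto $\mathcal{B}_s$, and $\mathcal{B}_s^\perp$ is the orthogonal complement of $\mathcal{B}_s$ in $\mathcal{B}_y$; $m_y=\dim(\mathcal{B}_{r_y})$. Sample quantities. $\widehat{\boldsymbol{\Sigma}}_{\mathbf{x}}=n^{-1}\mathbf{X}^t\mathbf{X}$, $\widehat{\boldsymbol{\sigma}}_{\mathbf{x},y}=n^{-1}\mathbf{X}^t\mathbf{y}$, $\mathcal{K}_s(\mathbf{x},y)=\mathcal{K}_s(\boldsymbol{\Sigma}_{\mathbf{x}},\boldsymbol{\sigma}_{\mathbf{x},y})$.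 Moment ratios and geometry. $L_y=\mathbb{E}(y^4)^{1/4}/\mathbb{E}(y^2)^{1/2}$, $L_{\mathcal{B}}=\mathbb{E}(\|\mathbf{x}_{\mathcal{B}}\|_2^4)^{1/4}/\mathbb{E}(\|\mathbf{x}_{\mathcal{B}}\|_2^2)^{1/2}$ ($L_{\mathcal{B}}=1$ if the denominator is zero). $\rho_{\mathcal{B},n}=\mathbb{E}(\max_{1\le i\le n}\|\mathbf{x}_{\mathcal{B},i}\|_2^2)/\|\boldsymbol{\Sigma}_{\mathbf{x}_{\mathcal{B}}}\|_{op}$, where $\mathbf{x}_{\mathcal{B},i}$ is the projection of the $i$-th observation. $\widetilde{\mathcal{B}}_s$ is a maximizer of $L_{\mathcal{B}}\|\boldsymbol{\Sigma}_{\mathbf{x}_{\mathcal{B}}}\|_{op}\,\rho_{\mathcal{B},n}$ over $\mathcal{B}\in\{\mathcal{B}_s,\mathcal{B}_s^\perp,\mathcal{B}_y^\perp\}$ (the product is read as $0$ if $\boldsymbol{\Sigma}_{\mathbf{x}_{\mathcal{B}}}=0$), and $\delta_{\widetilde{\mathcal{B}}_s,n}=\sqrt{\rho_{\widetilde{\mathcal{B}}_s,n}\log(r_{\mathbf{x}})/n}$. Constants. For $1\le s\le m_y$, $$\widetilde{M}_s=2\,\kappa_2(\boldsymbol{\Sigma}_{\mathbf{x}_s})\{4\widetilde{C}_s+1\}\left\{\frac{\|\boldsymbol{\Sigma}_{\mathbf{x}}\|_{op}}{\|\boldsymbol{\Sigma}_{\mathbf{x}_s}\|_{op}}\vee\frac{\|\boldsymbol{\sigma}_{\mathbf{x},y}\|_2}{\|\boldsymbol{\sigma}_{\mathbf{x}_s,y}\|_2}\right\},\qquad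 K_{\widetilde{\mathcal{B}}_s}=99\,C\,L_yL_{\widetilde{\mathcal{B}}_s}\left\{\frac{\sigma_y\|\boldsymbol{\Sigma}_{\mathbf{x}_{\widetilde{\mathcal{B}}_s}}\|_{op}^{1/2}}{\|\boldsymbol{\sigma}_{\mathbf{x},y}\|_2}\vee\frac{\|\boldsymbol{\Sigma}_{\mathbf{x}_{\widetilde{\mathcal{B}}_s}}\|_{op}}{\|\boldsymbol{\Sigma}_{\mathbf{x}}\|_{op}}\right\}.$$ Condition (i) is understood to hold almost surely for the sample. *)

(* Defs.v *)
From HB Require Import structures.
From mathcomp Require Import all_boot all_order all_algebra.
From mathcomp Require Import all_classical all_reals all_analysis.

Set Implicit Arguments.
Unset Strict Implicit.
Unset Printing Implicit Defensive.

Import Order.TTheory GRing.Theory Num.Theory.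
Import numFieldNormedType.Exports.

Local Open Scope classical_set_scope.
Local Open Scope ring_scope.

(* Vectors of R^p are columns 'cV[R]_p.  The library norm on matrices is the
   sup norm, hence the explicit Euclidean norm. *)

Definition dot (R : realType) p (u v : 'cV[R]_p) : R := \sum_i u i 0 * v i 0.

Definition enorm (R : realType) p (u : 'cV[R]_p) : R := Num.sqrt (dot u u).

Definition opnorm (R : realType) m p (A : 'M[R]_(m, p)) : R :=
  sup [set enorm (A *m u) | u in [set u : 'cV[R]_p | enorm u <= 1]].

(* Eigenvalues with multiplicity, in nonincreasing order, for A whose
   characteristic polynomial splits over R (in particular A symmetric). *)
Definition eigvals (R : realType) p (A : 'M[R]_p) : seq R :=
  sort >=%R (xget [::] [set s | char_poly A = \prod_(a <- s) ('X - a%:P)]).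

(* k counts from 1: eigval 1 A is the largest eigenvalue. *)
Definition eigval (R : realType) p (k : nat) (A : 'M[R]_p) : R :=
  nth 0 (eigvals A) k.-1.

Definition kappa2 (R : realType) p (A : 'M[R]_p) : R :=
  eigval 1 A / last 0 [seq a <- eigvals A | a != 0].

Definition range_mx (R : realType) p (A : 'M[R]_p) : {vspace 'cV[R]_p} :=
  limg (linfun (mulmx A : 'cV[R]_p -> 'cV[R]_p)).

Definition krylov (R : realType) p (s : nat) (A : 'M[R]_p) (b : 'cV[R]_p) :
    {vspace 'cV[R]_p} :=
  <<[seq (A ^+ j) *m b | j <- iota 0 s]>>%VS.

Definition is_orthoproj (R : realType) p (V : {vspace 'cV[R]_p})
    (Q : 'M[R]_p) : Prop :=
  forall u, Q *m u \in V /\ forall v, v \in V -> dot v (u - Q *m u) = 0.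

Definition orthoproj (R : realType) p (V : {vspace 'cV[R]_p}) : 'M[R]_p :=
  xget 0 [set Q | is_orthoproj V Q].

(* Orthogonal complement of V inside W. *)
Definition orthoc (R : realType) p (W V : {vspace 'cV[R]_p}) :
    {vspace 'cV[R]_p} :=
  (W :&: lker (linfun (mulmx (orthoproj V) : 'cV[R]_p -> 'cV[R]_p)))%VS.

(* Borel sets of R^k, i.e. the sigma-algebra generated by the coordinates. *)
Definition borel_cv (R : realType) k : set (set 'cV[R]_k) :=
  g_sigma_preimage (fun (i : 'I_k) (v : 'cV[R]_k) => v i 0).

Definition random_vector d (T : measurableType d) (R : realType) k
    (u : T -> 'cV[R]_k) : Prop :=
  forall i, measurable_fun [set: T] (fun w => u w i 0).

Section Probability.
Context d (T : measurableType d) (R : realType) (P : probability T R).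

Definition esp (X : T -> R) : R := fine ('E_P[X])%E.

(* E(u v^t); the covariance matrix is obtained for u = v (centered vectors). *)
Definition cross_mx k l (u : T -> 'cV[R]_k) (v : T -> 'cV[R]_l) :
    'M[R]_(k, l) :=
  \matrix_(i, j) esp (fun w => u w i 0 * v w j 0).

Definition cov_mx k (u : T -> 'cV[R]_k) : 'M[R]_k := cross_mx u u.

Definition cov_vec k (u : T -> 'cV[R]_k) (y : T -> R) : 'cV[R]_k :=
  \col_i esp (fun w => u w i 0 * y w).

Definition square_integrable (X : T -> R) : Prop :=
  P.-integrable [set: T] (fun w => (X w ^+ 2)%:E).

Definition centered (X : T -> R) : Prop :=
  P.-integrable [set: T] (EFin \o X) /\ ('E_P[X] = 0)%E.

Definition centered_vec k (u : T -> 'cV[R]_k) : Prop :=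
  forall i, centered (fun w => u w i 0).

Definition square_integrable_vec k (u : T -> 'cV[R]_k) : Prop :=
  forall i, square_integrable (fun w => u w i 0).

Definition independent_vec k l (u : T -> 'cV[R]_k) (v : T -> 'cV[R]_l) : Prop :=
  forall A B, borel_cv A -> borel_cv B ->
    P (u @^-1` A `&` v @^-1` B) = (P (u @^-1` A) * P (v @^-1` B))%E.

Definition mutually_independent k (z : nat -> T -> 'cV[R]_k) : Prop :=
  forall (J : seq nat) (A : nat -> set 'cV[R]_k),
    uniq J -> (forall i, borel_cv (A i)) ->
    P (\bigcap_(i in [set` J]) z i @^-1` A i)
      = (\prod_(i <- J) P (z i @^-1` A i))%E.

Definition same_law k (u v : T -> 'cV[R]_k) : Prop :=
  forall A, borel_cv A -> P (u @^-1` A) = P (v @^-1` A).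

Definition pair_vec p (x : T -> 'cV[R]_p) (y : T -> R) : T -> 'cV[R]_(p + 1) :=
  fun w => col_mx (x w) (y w)%:M.

Definition iid_sample p (x : T -> 'cV[R]_p) (y : T -> R)
    (xs : nat -> T -> 'cV[R]_p) (ys : nat -> T -> R) : Prop :=
  [/\ forall i, random_vector (xs i) /\ measurable_fun [set: T] (ys i),
      mutually_independent (fun i => pair_vec (xs i) (ys i)) &
      forall i, same_law (pair_vec (xs i) (ys i)) (pair_vec x y)].

(* E(Z^4)^(1/4) / E(Z^2)^(1/2), in the extended reals. *)
Definition moment_ratio (Z : T -> R) : \bar R :=
  (if 'E_P[fun w => (Z w ^+ 2)%R] == 0 then 1
  else poweR 'E_P[fun w => (Z w ^+ 4)%R] (4^-1)%R
       * ((Num.sqrt (esp (fun w => Z w ^+ 2)))^-1)%:E)%E.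

(* "With probability at least c the event A occurs", without presupposing that
   A is measurable. *)
Definition with_prob_ge (c : R) (A : set T) : Prop :=
  exists E, [/\ measurable E, E `<=` A & (c%:E <= P E)%E].

Section Features.
Context p (x : T -> 'cV[R]_p) (y : T -> R).

Definition project (B : {vspace 'cV[R]_p}) (u : T -> 'cV[R]_p) :
    T -> 'cV[R]_p :=
  fun w => orthoproj B *m u w.

Definition complement (B : {vspace 'cV[R]_p}) : {vspace 'cV[R]_p} :=
  orthoc (range_mx (cov_mx x)) B.

Definition splits_features (B : {vspace 'cV[R]_p}) : Prop :=
  [/\ (B <= range_mx (cov_mx x))%VS,
      cov_vec (project (complement B) x) y = 0 &
      cross_mx (project (complement B) x) (project B x) = 0].

Definition relevant_subspace (B : {vspace 'cV[R]_p}) : Prop :=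
  splits_features B /\ forall B', splits_features B' -> (\dim B <= \dim B')%N.

Definition norm_ratio (B : {vspace 'cV[R]_p}) : \bar R :=
  moment_ratio (fun w => enorm (project B x w)).

Definition regular_pair : Prop :=
  [/\ [/\ random_vector x, measurable_fun [set: T] y,
          square_integrable_vec x & square_integrable y],
      centered_vec x /\ centered y,
      cov_vec x y != 0 /\ 0 < esp (fun w => y w ^+ 2),
      (1 <= \rank (cov_mx x) <= p)%N &
      (moment_ratio y < +oo)%E /\
      forall B : {vspace 'cV[R]_p}, (B <= range_mx (cov_mx x))%VS ->
        (norm_ratio B < +oo)%E].

(* lfm_indep: (q, e) independent and eps independent of the pair (q, e), that
   is, q, e and eps are mutually independent. *)
Record latent_factor_model (By : {vspace 'cV[R]_p}) (q : T -> 'cV[R]_p)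
    (alpha : 'cV[R]_p) (eps : T -> R) (sigma : R) (e : T -> 'cV[R]_p) : Prop :=
  LatentFactorModel {
    lfm_y : {ae P, forall w, y w = dot (q w) alpha + eps w} ;
    lfm_x : {ae P, forall w,
      x w = q w + sigma *: e w + project (complement By) x w} ;
    lfm_q : [/\ random_vector q, square_integrable_vec q & centered_vec q] ;
    lfm_q_rank : (1 <= \rank (cov_mx q) <= \dim By)%N ;
    lfm_q_range : (range_mx (cov_mx q) <= By)%VS ;
    lfm_q_krylov : range_mx (cov_mx q)
      = krylov (\rank (cov_mx q)) (cov_mx q) (cov_vec q y) ;
    lfm_eps : measurable_fun [set: T] eps /\ centered eps ;
    lfm_sigma : 0 <= sigma ;
    lfm_e : [/\ random_vector e, square_integrable_vec e & centered_vec e] ;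
    lfm_e_range : range_mx (cov_mx e) = By ;
    lfm_e_norm : eigval 1 (cov_mx e) = 1 ;
    lfm_indep : independent_vec q e /\
      independent_vec (fun w => (eps w)%:M : 'cV[R]_1)
                      (fun w => col_mx (q w) (e w)) }.

Section Reductions.
Context (By : {vspace 'cV[R]_p}).

(* Krylov space B_s of the relevant pair (x_y, y). *)
Definition reduction (s : nat) : {vspace 'cV[R]_p} :=
  krylov s (cov_mx (project By x)) (cov_vec (project By x) y).

Definition reduced_features (s : nat) : T -> 'cV[R]_p :=
  project (reduction s) (project By x).

Definition relevant_dim : nat := \dim (reduction (\dim By)).

Definition Mtilde (Cs : R) (s : nat) : R :=
  2 * kappa2 (cov_mx (reduced_features s)) * (4 * Cs + 1) *
  Num.max (opnorm (cov_mx x) / opnorm (cov_mx (reduced_features s)))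
          (enorm (cov_vec x y) / enorm (cov_vec (reduced_features s) y)).

End Reductions.

Definition Kconst (C : R) (B : {vspace 'cV[R]_p}) : R :=
  99 * C * fine (moment_ratio y) * fine (norm_ratio B) *
  Num.max (Num.sqrt (esp (fun w => y w ^+ 2))
             * Num.sqrt (opnorm (cov_mx (project B x))) / enorm (cov_vec x y))
          (opnorm (cov_mx (project B x)) / opnorm (cov_mx x)).

Section Sample.
Context (xs : nat -> T -> 'cV[R]_p) (ys : nat -> T -> R).

(* When cov_mx (project B x) = 0 the denominator is 0 and so, by convention, is
   the quotient; so complexity vanishes in that case. *)
Definition rho (B : {vspace 'cV[R]_p}) (n : nat) : R :=
  esp (fun w => \big[Num.max/0]_(i < n) enorm (project B (xs i) w) ^+ 2)
  / opnorm (cov_mx (project B x)).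

Definition delta (B : {vspace 'cV[R]_p}) (n : nat) : R :=
  Num.sqrt (rho B n * ln (\rank (cov_mx x))%:R / n%:R).

Definition complexity (n : nat) (B : {vspace 'cV[R]_p}) : R :=
  fine (norm_ratio B) * opnorm (cov_mx (project B x)) * rho B n.

Definition maximizer (By : {vspace 'cV[R]_p}) (s n : nat)
    (B : {vspace 'cV[R]_p}) : Prop :=
  let candidates :=
    [:: reduction By s; orthoc By (reduction By s); complement By] in
  B \in candidates /\
  forall B', B' \in candidates -> complexity n B' <= complexity n B.

Definition design (n : nat) (w : T) : 'M[R]_(n, p) :=
  \matrix_(i < n, j < p) xs i w j 0.

Definition response (n : nat) (w : T) : 'cV[R]_n := \col_(i < n) ys i w.

Definition sample_cov (n : nat) (w : T) : 'M[R]_p :=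
  n%:R^-1 *: ((design n w)^T *m design n w).

Definition sample_cov_vec (n : nat) (w : T) : 'cV[R]_p :=
  n%:R^-1 *: ((design n w)^T *m response n w).

End Sample.
End Features.
End Probability.

Definition krylov_cond (R : realType) p (S : 'M[R]_p) (b : 'cV[R]_p)
    (s : nat) : R :=
  let U := orthoproj (krylov s S b) in kappa2 (U *m S *m U).

(* An infimum of positive integers, hence a minimum; +oo if none qualifies. *)
Definition early_stop (R : realType) p (tau : R) (S : 'M[R]_p)
    (b : 'cV[R]_p) : \bar R :=
  ereal_inf [set (s%:R)%:E | s in [set s : nat | (1 <= s <= p - 1)%N /\
    krylov_cond S b s.+1 / krylov_cond S b s > (2 * tau - 5) / 4]].

(* Main.v *)
Require Import Defs.
From HB Require Import structures.
From mathcomp Require Import all_boot all_order all_algebra.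
From mathcomp Require Import all_classical all_reals all_analysis.
From mathcomp Require Import measurable_realfun sesquilinear spectral complex.
From mathcomp Require Import ring lra.

Import Order.TTheory GRing.Theory Num.Theory.
Import numFieldNormedType.Exports.

Local Open Scope classical_set_scope.
Local Open Scope ring_scope.

Set Implicit Arguments.
Unset Strict Implicit.
Unset Printing Implicit Defensive.

(** Two of the three constants of the theorem may be chosen as functions of the
    population moments, and this reduces the theorem to statements about limits.

    The early-stopped dimension is at most r = rk(Sq) as soon as the ratio of
    condition numbers at step r is large. The largest eigenvalue of a
    compression grows with the subspace, so this ratio is at least that of the
    smallest nonzero eigenvalues at orders r and r + 1 ([kappa_ratio_ge]). In
    the population, the Krylov space of order r + 1 contains, for reasons of
    dimension, a direction killed by Sq; since x_y = q + sigma e with e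
    independent of q, the covariance along it is at most sigma^2. The Krylov
    space of order r is a perturbation of the range of Sq: when sigma^2 is below
    a threshold that depends on (Sq, sqy) only, hence for a large constant
    C_(r_q), the covariance on it is at least 9/11 of the smallest nonzero
    eigenvalue of Sq ([range_lower_stable]). The assumption on sigma^2 then
    makes the population ratio larger than tau.

    The sample inherits this, because at an order where the Krylov space has
    full dimension, norms and quadratic forms of its vectors are stable, in
    relative error, in a neighbourhood of the population moments
    ([krylov_forms_stable], [early_stop_stable]). The radius eta of this
    neighbourhood depends on (Sx, sxy) and r only. As M~_s contains the factor
    C~_s, the assumption M~_s K delta < nu says that K delta / nu is as small
    with respect to eta as one wishes.

    It remains to see that the sample moments are eta-close to the population
    moments with probability at least 1 - 2 nu. Truncate the observations where
    their squared norm exceeds a level t. The expected maximum of the squared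
    norms bounds the probability that the truncation acts and, because the
    maximum of independent variables sees their tails, also the bias that it
    creates; Chebyshev's inequality does the rest ([weak_law],
    [moments_concentrate]). Up to factors that depend on the population moments,
    the resulting deviations are of the order of the square root of
    (expected maximum) * E y^2 / n, and K delta dominates this quantity already
    for C = 1, since moment ratios are at least 1 ([Kconst_delta_ge],
    [sample_max_le]). The level t is fixed in [tail_budget]. *)

(** * Euclidean inner product *)

Section Dot.
Context (R : realType) (p : nat).
Implicit Types (u v w : 'cV[R]_p) (A : 'M[R]_p).

Lemma dotE u v : dot u v = (u^T *m v) 0 0.
Proof. by rewrite mxE; apply: eq_bigr => i _; rewrite mxE. Qed.

Lemma dotC u v : dot u v = dot v u.
Proof. by apply: eq_bigr => i _; rewrite mulrC. Qed.

Lemma dotDr u v w : dot u (v + w) = dot u v + dot u w.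
Proof. by rewrite !dotE mulmxDr mxE. Qed.

Lemma dotZr a u v : dot u (a *: v) = a * dot u v.
Proof. by rewrite !dotE -scalemxAr mxE. Qed.

Lemma dotBr u v w : dot u (v - w) = dot u v - dot u w.
Proof. by rewrite -scaleN1r dotDr dotZr mulN1r. Qed.

Lemma dot0r u : dot u 0 = 0.
Proof. by rewrite -(scale0r 0) dotZr mul0r. Qed.

Lemma dotDl u v w : dot (v + w) u = dot v u + dot w u.
Proof. by rewrite dotC dotDr !(dotC u). Qed.

Lemma dotZl a u v : dot (a *: u) v = a * dot u v.
Proof. by rewrite dotC dotZr dotC. Qed.

Lemma dotBl u v w : dot (v - w) u = dot v u - dot w u.
Proof. by rewrite dotC dotBr !(dotC u). Qed.

Lemma dot0l u : dot 0 u = 0.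
Proof. by rewrite dotC dot0r. Qed.

Lemma dot_ge0 u : 0 <= dot u u.
Proof. by apply: sumr_ge0 => i _; rewrite -expr2 sqr_ge0. Qed.

Lemma dot_eq0 u : (dot u u == 0) = (u == 0).
Proof.
apply/idP/eqP => [|->]; last by rewrite dot0r.
rewrite psumr_eq0; last by move=> i _; rewrite -expr2 sqr_ge0.
move=> /allP u0; apply/matrixP => i j; rewrite ord1 mxE.
by apply/eqP; have := u0 i (mem_index_enum _); rewrite /= mulf_eq0 orbb.
Qed.

Lemma dot_gt0 u : (0 < dot u u) = (u != 0).
Proof. by rewrite lt_neqAle dot_ge0 andbT eq_sym dot_eq0. Qed.

Lemma dot_delta u j : dot (delta_mx j 0) u = u j 0.
Proof.
rewrite /dot (bigD1 j) //= mxE !eqxx mul1r big1 ?addr0 // => i /negbTE ij.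
by rewrite mxE ij mul0r.
Qed.

Lemma sqr_coord_le u i : u i 0 ^+ 2 <= dot u u.
Proof.
rewrite /dot (bigD1 i) //= -expr2 lerDl.
by apply: sumr_ge0 => k _; rewrite -expr2 sqr_ge0.
Qed.

Lemma enorm_sqr u : enorm u ^+ 2 = dot u u.
Proof. by rewrite sqr_sqrtr // dot_ge0. Qed.

Lemma enorm_ge0 u : 0 <= enorm u. Proof. exact: sqrtr_ge0. Qed.

Lemma enorm_gt0 u : (0 < enorm u) = (u != 0).
Proof. by rewrite sqrtr_gt0 dot_gt0. Qed.

Lemma dot_CS u v : dot u v ^+ 2 <= dot u u * dot v v.
Proof.
have [->|v0] := eqVneq v 0; first by rewrite !dot0r expr0n mulr0.
have vv : 0 < dot v v by rewrite dot_gt0.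
have := dot_ge0 (dot v v *: u - dot u v *: v).
rewrite dotBl !dotBr !dotZl !dotZr (dotC v u) => h.
have : 0 <= dot v v * (dot u u * dot v v - dot u v ^+ 2) by lra.
by rewrite pmulr_rge0 // subr_ge0.
Qed.

End Dot.

Lemma dot_mull (R : realType) m p (A : 'M[R]_(m, p)) u v :
  dot (A *m u) v = dot u (A^T *m v).
Proof. by rewrite !dotE trmx_mul mulmxA. Qed.

Lemma dot_mulr (R : realType) m p (A : 'M[R]_(m, p)) u v :
  dot v (A *m u) = dot (A^T *m v) u.
Proof. by rewrite dotC dot_mull dotC. Qed.

(** * Spectral theory of real symmetric matrices *)

(** The rows and columns of the nonzero entries form an invertible block. *)
Lemma rank_diag_mx_ge (F : fieldType) p (D : 'rV[F]_p) :
  (#|[pred i | D ord0 i != 0%R]| <= \rank (diag_mx D))%N.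
Proof.
set S := [pred i | _]; pose g (i : 'I_#|S|) : 'I_p := enum_val i.
suff /eqP <- : row_free (rowsub g (diag_mx D)) by rewrite mxrankS // rowsub_sub.
apply/row_freeP; exists (\matrix_(i, j) ((i == g j)%:R * (D 0 i)^-1)).
apply/matrixP => i j; rewrite !mxE (bigD1 (g i)) //= !mxE eqxx mulr1n big1.
  rewrite addr0 (inj_eq enum_val_inj); case: eqP => _; last by rewrite mul0r mulr0.
  by rewrite mul1r divff //; have := enum_valP i; rewrite inE.
by move=> k /negbTE ki; rewrite !mxE eq_sym ki mulr0n mul0r.
Qed.

Lemma char_poly_conj (F : comNzRingType) p (V D P : 'M[F]_p) :
  V *m P = 1%:M -> char_poly (V *m D *m P) = char_poly D.
Proof.
move=> VP; pose c := @polyC F; pose Vp := map_mx c V; pose Pp := map_mx c P.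
have VPp : Vp *m Pp = 1%:M by rewrite -map_mxM VP map_mx1.
have E : char_poly_mx (V *m D *m P) = Vp *m char_poly_mx D *m Pp.
  rewrite /char_poly_mx mulmxBr mulmxBl !map_mxM -/c -/Vp -/Pp; congr (_ - _).
  by rewrite -mulmxA -scalar_mxC mulmxA VPp mul1mx.
rewrite /char_poly E !det_mulmx mulrAC -det_mulmx VPp det1 mul1r //.
Qed.

Section Spectral.
Context (R : realType) (p : nat).
Implicit Types (A : 'M[R]_p) (u v : 'cV[R]_p).

Let f : {rmorphism R -> complex R} := real_complex R.

(** Over the complex numbers A = P^* D P with P unitary and D real, and the
    weights of v are the squared moduli of the coordinates of P v. Stating the
    decomposition through these real weights keeps complex numbers out of the
    sequel. If v = A u, then P v = D P u vanishes where D does. *)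
Lemma spectral_weights A : A^T = A ->
  exists d : 'I_p -> R,
  [/\ char_poly A = \prod_i ('X - (d i)%:P),
      (#|[pred i | d i != 0%R]| <= \rank A)%N &
      forall v, exists om : 'I_p -> R,
        [/\ forall i, 0 <= om i, \sum_i om i = dot v v,
            dot v (A *m v) = \sum_i d i * om i &
            (exists u, v = A *m u) -> forall i, d i = 0 -> om i = 0]].
Proof.
move=> Asym; pose B := map_mx f A.
have conjf M m (N : 'M[R]_(M, m)) : map_mx Num.conj (map_mx f N) = map_mx f N.
  by apply/matrixP => i j; rewrite !mxE; exact: conjc_real.
have Bherm : B \is hermsymmx.
  apply/is_hermitianmxP; rewrite expr0 scale1r map_trmx conjf.
  by rewrite /B Asym.
have Bspec : B = invmx (spectralmx B) *m diag_mx (spectral_diag B) *m spectralmx B.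
  exact/orthomx_spectralP/hermitian_normalmx.
have Dreal := hermitian_spectral_diag_real Bherm.
have Punit := spectral_unit B.
have Puni := spectral_unitarymx B.
set P := spectralmx B in Bspec Punit Puni; set D := spectral_diag B in Bspec Dreal.
pose d i := complex.Re (D 0 i).
have dE i : D 0 i = f (d i).
  by apply: esym; apply: RRe_real; exact: (mxOverP Dreal).
exists d; split.
- apply: (map_poly_inj f); rewrite map_char_poly -/B.
  rewrite rmorph_prod /=.
  have -> : char_poly B = char_poly (diag_mx D).
    by rewrite {1}Bspec char_poly_conj // mulVmx.
  rewrite char_poly_trig ?diag_mx_is_trig //; apply: eq_bigr => i _.
  by rewrite map_polyXsubC mxE eqxx mulr1n dE.
- have -> : \rank A = \rank B by rewrite /B mxrank_map.
  rewrite Bspec mxrankMfree ?row_free_unit //.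
  rewrite -mxrank_tr trmx_mul mxrankMfree ?row_free_unit ?unitmx_tr ?unitmx_inv //.
  rewrite tr_diag_mx; apply: leq_trans (rank_diag_mx_ge D).
  by apply: eq_leq; apply: eq_card => i; rewrite !inE dE fmorph_eq0.
move=> v; pose w := P *m map_mx f v.
pose om i := complex.Re (w i 0) ^+ 2 + complex.Im (w i 0) ^+ 2.
have omE i : f (om i) = w i 0 * Num.conj (w i 0).
  by rewrite -normCK -add_Re2_Im2.
have PP : map_mx Num.conj P^T *m P = 1%:M.
  by rewrite -(invmx_unitary Puni) mulVmx.
exists om; split.
- by move=> i; rewrite addr_ge0 ?sqr_ge0.
- apply: (fmorph_inj f); rewrite rmorph_sum /=.
  rewrite (eq_bigr (fun i => w i 0 * Num.conj (w i 0))) //.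
  have -> : \sum_i w i 0 * Num.conj (w i 0) = (map_mx Num.conj w^T *m w) 0 0.
    by rewrite mxE; apply: eq_bigr => i _; rewrite !mxE mulrC.
  rewrite /w trmx_mul map_mxM mulmxA -(mulmxA _ _ P) PP mulmx1.
    by rewrite map_trmx conjf -map_mxM mxE -dotE.
  by move=> i _; rewrite -omE.
- apply: (fmorph_inj f).
  transitivity ((map_mx Num.conj w^T *m (diag_mx D *m w)) 0 0); last first.
    rewrite mxE [RHS]rmorph_sum; apply: eq_bigr => i _; rewrite mul_diag_mx !mxE dE.
    by rewrite [RHS]rmorphM (omE i) /w [X in _ = _ * (X * _)]mxE [X in _ = _ * (_ * Num.conj X)]mxE mulrCA (mulrC (_^*)).
  rewrite /w trmx_mul map_mxM map_trmx conjf.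
  have -> : map_mx f v^T *m map_mx Num.conj P^T *m (diag_mx D *m (P *m map_mx f v))
    = map_mx f v^T *m B *m map_mx f v.
    by rewrite Bspec (invmx_unitary Puni) !mulmxA.
  by rewrite -/B -!map_mxM mxE dotE mulmxA.
- move=> [u vE] i di; apply: (fmorph_inj f); rewrite omE.
  suff -> : w i 0 = 0 by rewrite mul0r rmorph0.
  rewrite /w vE map_mxM -/B Bspec !mulmxA mulmxV // mul1mx -mulmxA mul_diag_mx mxE.
  by rewrite dE di rmorph0 mul0r.
Qed.

End Spectral.

Section Eigvals.
Context (R : realType) (p : nat).
Implicit Types (A : 'M[R]_p) (u v : 'cV[R]_p) (s : seq R).

Definition psd A := A^T = A /\ forall v, 0 <= dot v (A *m v).

Lemma sorted_ge_nth s i j : sorted >=%R s -> (i <= j < size s)%N ->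
  nth 0 s j <= nth 0 s i.
Proof.
move=> ss /andP[ij js]; apply: (sorted_leq_nth ge_trans ge_refl 0 ss) => //.
by rewrite inE (leq_ltn_trans ij).
Qed.

Lemma sorted_ge_last s a : sorted >=%R s -> a \in s -> last 0 s <= a.
Proof.
move=> ss sa; have sas : (index a s < size s)%N by rewrite index_mem.
rewrite -(nth_index 0 sa) -nth_last; apply: sorted_ge_nth => //.
by case: (size s) sas => //= n; rewrite !ltnS leqnn andbT.
Qed.

Lemma eigvals_sorted A : sorted >=%R (eigvals A).
Proof. by apply: sort_sorted => x y; exact: ge_total. Qed.

(** The characteristic polynomial determines its sequence of roots up to order,
    so that the arbitrary choice made in the definition is harmless. *)
Lemma eigvals_perm A (d : 'I_p -> R) :
  char_poly A = \prod_i ('X - (d i)%:P) ->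
  perm_eq (eigvals A) [seq d i | i <- enum 'I_p].
Proof.
move=> cA; pose S := [set s | char_poly A = \prod_(a <- s) ('X - a%:P)].
have SA : S [seq d i | i <- enum 'I_p].
  by rewrite /S /= cA big_map big_enum.
have /xgetPex : exists s, S s by exists [seq d i | i <- enum 'I_p].
move=> /(_ [::]); rewrite {1}/S /= => cA'.
rewrite /eigvals perm_sort; apply: prod_XsubC_eq; rewrite -/S -cA'.
by rewrite cA big_map big_enum.
Qed.

Lemma eigvals_eigenvector A a : A^T = A -> a \in eigvals A ->
  exists v, v != 0 /\ A *m v = a *: v.
Proof.
move=> As; have [d [cA _ _]] := spectral_weights As.
rewrite (perm_mem (eigvals_perm cA)) => /mapP[i _ ->].
have : eigenvalue A (d i).
  rewrite eigenvalue_root_char cA /root horner_prod.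
  by rewrite (bigD1 i) //= hornerXsubC subrr mul0r.
move=> /eigenvalueP[w wA w0]; exists w^T; split.
  by rewrite -trmx0 (inj_eq trmx_inj).
by rewrite -{1}As -trmx_mul wA linearZ.
Qed.

Lemma rayleigh_le A v : A^T = A -> dot v (A *m v) <= eigval 1 A * dot v v.
Proof.
move=> As; have [d [cA _ /(_ v)[om [om0 omv omA _]]]] := spectral_weights As.
rewrite omA -omv mulr_sumr; apply: ler_sum => i _; apply: ler_wpM2r => //.
have ds : d i \in eigvals A.
  by rewrite (perm_mem (eigvals_perm cA)) map_f ?mem_enum.
rewrite -(nth_index 0 ds); apply: sorted_ge_nth; first exact: eigvals_sorted.
by rewrite index_mem.
Qed.

Lemma eigval1_eigenvector A : (0 < p)%N -> A^T = A ->
  exists v, v != 0 /\ A *m v = eigval 1 A *: v.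
Proof.
move=> p0 As; apply: eigvals_eigenvector => //; apply: mem_nth.
have [d [cA _ _]] := spectral_weights As.
by rewrite (perm_size (eigvals_perm cA)) size_map size_enum_ord.
Qed.

Lemma eigenvector_dot A v a : A *m v = a *: v -> dot v (A *m v) = a * dot v v.
Proof. by move=> ->; rewrite dotZr. Qed.

Lemma psd_eigvals_ge0 A a : psd A -> a \in eigvals A -> 0 <= a.
Proof.
move=> [As Ap] /(eigvals_eigenvector As)[v [v0 /eigenvector_dot vA]].
by have := Ap v; rewrite vA pmulr_lge0 // dot_gt0.
Qed.

(** The sorted sequence of a positive semidefinite matrix starts with its at
    most rank A nonzero eigenvalues, so the one of index rank A is at most each
    of them; vectors of the range put no weight on the others. *)
Lemma rayleigh_rank_ge A v : psd A -> (exists u, v = A *m u) ->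
  eigval (\rank A) A * dot v v <= dot v (A *m v).
Proof.
move=> Apsd vA; have [As _] := Apsd.
have [d [cA rA /(_ v)[om [om0 omv omA /(_ vA) omz]]]] := spectral_weights As.
rewrite omA -omv mulr_sumr; apply: ler_sum => i _.
have [/omz ->|di] := eqVneq (d i) 0; first by rewrite !mulr0.
apply: ler_wpM2r => //.
have Ps := eigvals_perm cA; set s := eigvals A in Ps.
have ds : d i \in s by rewrite (perm_mem Ps) map_f ?mem_enum.
have ss : sorted >=%R s by exact: eigvals_sorted.
have sn : (index (d i) s < size s)%N by rewrite index_mem.
have d0 : 0 < d i by rewrite lt_neqAle eq_sym di (psd_eigvals_ge0 Apsd).
(* If d i came after index rank A - 1, more than rank A eigenvalues would be at
   least d i > 0. *)
have cs : (count (fun x => x != 0%R) s <= \rank A)%N.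
  rewrite (permP Ps) count_map; apply: leq_trans rA.
  by rewrite enumT cardE /enum_mem size_filter; apply: eq_leq; apply: eq_count.
suff ir : (index (d i) s <= (\rank A).-1)%N.
  have [rs|rs] := ltnP (\rank A).-1 (size s).
    by rewrite -(nth_index 0 ds); apply: sorted_ge_nth; rewrite ?ir.
  by rewrite /eigval nth_default // ltW.
rewrite -ltnS; apply: leq_trans (_ : (index (d i) s).+1 <= \rank A)%N _; last first.
  exact: leqSpred.
apply: leq_trans cs; rewrite -[X in count _ X](cat_take_drop (index (d i) s).+1).
rewrite count_cat; apply: leq_trans (leq_addr _ _).
rewrite -[X in (X <= _)%N](size_takel sn).
apply: eq_leq; apply/esym/eqP; rewrite -all_count.
apply/(all_nthP 0) => j; rewrite size_takel // => ji; rewrite nth_take //.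
apply: lt0r_neq0; apply: lt_le_trans d0 _.
by rewrite -(nth_index 0 ds); apply: sorted_ge_nth; rewrite // -ltnS ji.
Qed.

(** The denominator of the condition number: the smallest nonzero eigenvalue if
    A is positive semidefinite. *)
Definition lastnz A := last 0 [seq a <- eigvals A | a != 0].

(** There is a nonzero eigenvalue, since otherwise the quadratic form of A would
    vanish identically. *)
Lemma lastnz_spec A : psd A -> A != 0 ->
  [/\ 0 < lastnz A, exists v, v != 0 /\ A *m v = lastnz A *: v &
      forall v, (exists u, v = A *m u) -> lastnz A * dot v v <= dot v (A *m v)].
Proof.
move=> Apsd A0; have [As _] := Apsd.
have [d [cA rA dv]] := spectral_weights As.
have Ps := eigvals_perm cA; set s := [seq a <- eigvals A | a != 0].
have ss : sorted >=%R s by rewrite sorted_filter ?eigvals_sorted //; exact: ge_trans.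
have ds i : d i != 0 -> d i \in s.
  by move=> di; rewrite mem_filter di (perm_mem Ps) map_f ?mem_enum.
have [i di] : exists i, d i != 0.
  apply: contrapT => nd; move: A0; apply/negP; rewrite negbK; apply/eqP.
  have Az v : dot v (A *m v) = 0.
    have [om [_ _ -> _]] := dv v; rewrite big1 // => i _.
    case: (eqVneq (d i) 0) => [->|di]; first by rewrite mul0r.
    by exfalso; apply: nd; exists i.
  apply/matrixP => i j; rewrite mxE.
  have := Az (delta_mx i 0 + delta_mx j 0).
  rewrite mulmxDr !dotDl !dotDr !Az add0r addr0 !dot_delta -!colE !mxE.
  by rewrite -{2}As mxE => h; lra.
have lmem : lastnz A \in s.
  rewrite /lastnz -/s; move: (ds _ di); case: (s) => // a l _.
  by rewrite /= mem_last.
have := lmem; rewrite mem_filter => /andP[l0 le]; split.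
- by rewrite lt_neqAle eq_sym l0 (psd_eigvals_ge0 Apsd).
- exact: eigvals_eigenvector.
move=> v vA; have [om [om0 omv omA /(_ vA) omz]] := dv v.
rewrite omA -omv mulr_sumr; apply: ler_sum => j _.
have [/omz ->|dj] := eqVneq (d j) 0; first by rewrite !mulr0.
by apply: ler_wpM2r => //; apply: sorted_ge_last => //; exact: ds.
Qed.

End Eigvals.

(** * Orthogonal projections *)

Lemma inj_rank (R : realType) m n (M : 'M[R]_(m, n)) :
  (forall c : 'cV_n, M *m c = 0 -> c = 0) -> \rank M = n.
Proof.
move=> Minj; rewrite -mxrank_tr; apply/eqP; rewrite -/(row_free _) -kermx_eq0.
apply/eqP/row_matrixP => i; rewrite row0.
apply: trmx_inj; rewrite trmx0; apply: Minj.
apply: trmx_inj; rewrite trmx_mul trmxK trmx0.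
by apply: sub_kermxP; exact: row_sub.
Qed.

Section Columns.
Context (R : realType) (p : nat).
Implicit Types (F : nat -> 'cV[R]_p) (V W : {vspace 'cV[R]_p}) (Q : 'M[R]_p).

Definition cols n F : 'M[R]_(p, n) := \matrix_(i, j) F j i 0.

Lemma mul_cols n F (c : 'cV[R]_n) : cols n F *m c = \sum_j c j 0 *: F j.
Proof.
apply/matrixP => i k; rewrite ord1 mxE summxE; apply: eq_bigr => j _.
by rewrite !mxE mulrC.
Qed.

Lemma mem_cols n F v :
  v \in <<[seq F j | j <- iota 0 n]>>%VS <-> exists c, v = cols n F *m c.
Proof.
have sX : size [seq F j | j <- iota 0 n] == n by rewrite size_map size_iota.
pose X : n.-tuple 'cV[R]_p := Tuple sX.
have nX (j : 'I_n) : X`_j = F j.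
  by rewrite (nth_map 0%N) ?size_iota // nth_iota.
split=> [vX|[c ->]].
  exists (\col_j coord X j v); rewrite {1}(coord_span (X := X) vX) mul_cols; apply: eq_bigr => j _.
  by rewrite mxE nX.
rewrite mul_cols; apply: memv_suml => j _; apply/memvZ/memv_span.
by apply: map_f; rewrite mem_iota /= add0n.
Qed.

Lemma free_cols n F : \dim <<[seq F j | j <- iota 0 n]>>%VS = n ->
  forall c : 'cV_n, cols n F *m c = 0 -> c = 0.
Proof.
have sX : size [seq F j | j <- iota 0 n] == n by rewrite size_map size_iota.
pose X : n.-tuple 'cV[R]_p := Tuple sX.
have nX (j : 'I_n) : X`_j = F j.
  by rewrite (nth_map 0%N) ?size_iota // nth_iota.
move=> dX c; rewrite mul_cols => c0.
have fX : free X by rewrite /free dX (eqP sX).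
apply/matrixP => i j; rewrite ord1 mxE.
move/freeP: fX => /(_ (fun i => c i 0)); apply.
by rewrite -[RHS]c0; apply: eq_bigr => k _; rewrite nX.
Qed.

Lemma vbasis_cols V : V = <<[seq (vbasis V)`_j | j <- iota 0 (\dim V)]>>%VS.
Proof.
rewrite -{1}(span_basis (vbasisP V)); congr span.
by rewrite -{1}(mkseq_nth 0 (vbasis V)) size_tuple.
Qed.

Lemma unitmx_inj n (M : 'M[R]_n) : (forall c : 'cV_n, M *m c = 0 -> c = 0) ->
  M \in unitmx.
Proof. by move=> /inj_rank rM; rewrite -row_free_unit /row_free rM. Qed.

(** The projection is F (F^T F)^-1 F^T, where the columns of F form a basis of
    V. *)
Lemma is_orthoproj_exists V : exists Q, is_orthoproj V Q.
Proof.
pose n := \dim V; pose F := cols n (fun j => (vbasis V)`_j).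
have memF v : v \in V <-> exists c, v = F *m c.
  by rewrite /F /n -(mem_cols (\dim V)) -vbasis_cols.
have Finj (c : 'cV_n) : F *m c = 0 -> c = 0.
  by apply: free_cols; rewrite -vbasis_cols.
have GU : F^T *m F \in unitmx.
  apply: unitmx_inj => c Gc; apply: Finj; apply/eqP.
  by rewrite -dot_eq0 dot_mull mulmxA Gc dot0r.
exists (F *m invmx (F^T *m F) *m F^T) => u; split.
  by apply/memF; exists (invmx (F^T *m F) *m F^T *m u); rewrite !mulmxA.
move=> v /memF[c ->]; rewrite dot_mull mulmxBr !mulmxA mulmxV // mul1mx subrr.
by rewrite dot0r.
Qed.

Lemma orthoprojP V : is_orthoproj V (orthoproj V).
Proof. by have [Q VQ] := is_orthoproj_exists V; exact: (xgetI 0 VQ). Qed.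

Lemma orthoproj_in V u : orthoproj V *m u \in V.
Proof. by have [] := orthoprojP V u. Qed.

Lemma orthoproj_orth V u v : v \in V -> dot v (orthoproj V *m u) = dot v u.
Proof.
move=> vV; have [_ /(_ v vV)] := orthoprojP V u.
by rewrite dotBr => /eqP; rewrite subr_eq0 => /eqP.
Qed.

Lemma is_orthoproj_vec V u v : v \in V ->
  (forall w, w \in V -> dot w v = dot w u) -> orthoproj V *m u = v.
Proof.
move=> vV uv; apply/eqP; rewrite -subr_eq0 -dot_eq0; apply/eqP.
have dV : orthoproj V *m u - v \in V by rewrite memvB ?orthoproj_in.
by rewrite dotBr orthoproj_orth // -(uv _ dV) subrr.
Qed.

Lemma orthoproj_id V v : v \in V -> orthoproj V *m v = v.
Proof. by move=> vV; exact: is_orthoproj_vec. Qed.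

Lemma eq_mx_dot (A B : 'M[R]_p) :
  (forall u v, dot u (A *m v) = dot u (B *m v)) -> A = B.
Proof.
move=> AB; apply/matrixP => i j.
have := AB (delta_mx i 0) (delta_mx j 0).
by rewrite !dot_delta -!colE !mxE.
Qed.

Lemma orthoproj_sym V : (orthoproj V)^T = orthoproj V.
Proof.
apply: eq_mx_dot => u v; rewrite -dot_mull.
rewrite -(orthoproj_orth v (orthoproj_in V u)).
by rewrite dotC (orthoproj_orth u (orthoproj_in V v)) dotC.
Qed.

Lemma orthoproj_idem V : orthoproj V *m orthoproj V = orthoproj V.
Proof.
by apply: eq_mx_dot => u v; rewrite -mulmxA orthoproj_id // orthoproj_in.
Qed.

Lemma orthoproj_mull V W : (V <= W)%VS -> orthoproj W *m orthoproj V = orthoproj V.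
Proof.
move=> /subvP VW; apply: eq_mx_dot => u v; rewrite -mulmxA orthoproj_id //.
by rewrite VW // orthoproj_in.
Qed.

Lemma orthoproj_mulr V W : (V <= W)%VS -> orthoproj V *m orthoproj W = orthoproj V.
Proof.
move=> VW; apply: trmx_inj; rewrite trmx_mul !orthoproj_sym.
exact: orthoproj_mull.
Qed.

Lemma mem_orthoc V W v :
  v \in orthoc W V <-> v \in W /\ orthoproj V *m v = 0.
Proof.
rewrite memv_cap memv_ker lfunE /=; split => [/andP[-> /eqP]//|[-> ->]].
by rewrite eqxx.
Qed.

(** A vector w of W is the sum of its projection onto V and of a vector w' of
    the complement, and each of the two projections kills the other part. *)
Lemma orthoproj_orthoc V W : (V <= W)%VS ->
  orthoproj W = orthoproj V + orthoproj (orthoc W V).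
Proof.
move=> VW; apply: eq_mx_dot => u v; congr dot.
apply: is_orthoproj_vec.
  have /mem_orthoc[oW _] := orthoproj_in (orthoc W V) v.
  by rewrite mulmxDl memvD // (subvP VW) // orthoproj_in.
move=> w wW; pose w' := w - orthoproj V *m w.
have w'o : w' \in orthoc W V.
  apply/mem_orthoc; split; first by rewrite memvB // (subvP VW) // orthoproj_in.
  by rewrite mulmxBr mulmxA orthoproj_idem subrr.
have wE : w = orthoproj V *m w + w' by rewrite addrC subrK.
have V0 : orthoproj V *m w' = 0 by have /mem_orthoc[] := w'o.
have o0 : orthoproj (orthoc W V) *m (orthoproj V *m w) = 0.
  apply: is_orthoproj_vec; first exact: mem0v.
  move=> z /mem_orthoc[_ Vz]; rewrite dot0r.
  by rewrite dot_mulr orthoproj_sym Vz dot0l.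
rewrite mulmxDl dotDr.
rewrite -(orthoproj_sym V) -(orthoproj_sym (orthoc W V)) -!dot_mull.
rewrite {2}wE mulmxDr o0 add0r (orthoproj_id w'o).
by rewrite -dotDl -wE.
Qed.

Lemma range_mxP (A : 'M[R]_p) v : v \in range_mx A <-> exists u, v = A *m u.
Proof.
split=> [/memv_imgP[u _ ->]|[u ->]]; first by exists u; rewrite lfunE.
by apply/memv_imgP; exists u; rewrite ?memvf // lfunE.
Qed.

End Columns.

(** * Condition numbers of compressions *)

Section Compression.
Context (R : realType) (p : nat).
Implicit Types (S : 'M[R]_p) (V W : {vspace 'cV[R]_p}) (v : 'cV[R]_p).

Definition compress S V := orthoproj V *m S *m orthoproj V.

Definition posdef_on S V := forall v, v \in V -> v != 0 -> 0 < dot v (S *m v).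

Lemma compress_dot S V u v : u \in V -> v \in V ->
  dot u (compress S V *m v) = dot u (S *m v).
Proof.
move=> uV vV; rewrite /compress -!mulmxA (orthoproj_id vV).
by rewrite orthoproj_orth.
Qed.

Lemma compress_psd S V : psd S -> psd (compress S V).
Proof.
move=> [Ss Sp]; split.
  by rewrite /compress !trmx_mul orthoproj_sym Ss mulmxA.
move=> v; rewrite /compress -!mulmxA -{1}orthoproj_sym -dot_mull; exact: Sp.
Qed.

(** The compression is injective on V because S is positive definite there,
    hence onto V by dimension. So V lies in its range, where the smallest
    nonzero eigenvalue bounds the quadratic form from below. *)
Lemma compress_surj S V v : posdef_on S V -> v \in V ->
  exists u, v = compress S V *m u.
Proof.
move=> SV vV; pose g : 'End('cV[R]_p) := linfun (mulmx (compress S V)).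
have gE u : g u = compress S V *m u by rewrite lfunE.
have gV : (g @: V <= V)%VS.
  apply/subvP => _ /memv_imgP[u _ ->]; rewrite gE /compress -!mulmxA.
  exact: orthoproj_in.
have kV : (V :&: lker g = 0)%VS.
  apply/eqP; rewrite -subv0; apply/subvP => u; rewrite memv_cap memv_ker memv0.
  move=> /andP[uV]; rewrite gE => gu; apply/negPn/negP => /(SV u uV).
  by rewrite -(compress_dot S uV uV) (eqP gu) dot0r ltxx.
have gVE : (g @: V)%VS = V by apply/eqP; rewrite eqEdim gV (limg_dim_eq kV) leqnn.
move: vV; rewrite -{1}gVE => /memv_imgP[u _ ->].
by exists u; rewrite gE.
Qed.

Lemma eigenvector_mem S V v a : a != 0 -> compress S V *m v = a *: v -> v \in V.
Proof.
move=> a0 va; have -> : v = a^-1 *: (compress S V *m v).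
  by rewrite va scalerA mulVf // scale1r.
by rewrite memvZ // /compress -!mulmxA orthoproj_in.
Qed.

Lemma vspace_neq0 V v : v \in V -> v != 0 -> V != 0%VS.
Proof. by move=> vV; apply: contraNneq => V0; move: vV; rewrite V0 memv0. Qed.

Lemma compress_neq0 S V v : posdef_on S V -> v \in V -> v != 0 ->
  compress S V != 0.
Proof.
move=> SV vV v0; apply: contraTneq (SV v vV v0) => c0.
by rewrite -(compress_dot S vV vV) c0 mul0mx dot0r ltxx.
Qed.

(** Eigenvectors for nonzero eigenvalues lie in V, and there the compression has
    the quadratic form of S. *)
Lemma compress_lastnz S V : psd S -> posdef_on S V -> V != 0%VS ->
  [/\ 0 < lastnz (compress S V),
      exists v, [/\ v \in V, v != 0 &
        dot v (S *m v) = lastnz (compress S V) * dot v v] &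
      forall v, v \in V -> lastnz (compress S V) * dot v v <= dot v (S *m v)].
Proof.
move=> Sp SV V0.
have A0 : compress S V != 0.
  by apply: (compress_neq0 SV (memv_pick V)); rewrite vpick0.
have [l0 [v [v0 vl]] lmin] := lastnz_spec (compress_psd V Sp) A0; split => //.
  have vV : v \in V by apply: eigenvector_mem vl; exact: lt0r_neq0.
  by exists v; rewrite vV -(compress_dot S vV vV) (eigenvector_dot vl).
move=> w wV; rewrite -(compress_dot _ wV wV); apply: lmin.
exact: compress_surj.
Qed.

Lemma compress_eigval1 S V : psd S -> posdef_on S V -> V != 0%VS ->
  [/\ 0 < eigval 1 (compress S V),
      exists v, [/\ v \in V, v != 0 &
        dot v (S *m v) = eigval 1 (compress S V) * dot v v] &
      forall v, v \in V -> dot v (S *m v) <= eigval 1 (compress S V) * dot v v].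
Proof.
move=> Sp SV V0; have [As Ap] := compress_psd V Sp.
have ray v : v \in V -> dot v (S *m v) <= eigval 1 (compress S V) * dot v v.
  by move=> vV; rewrite -(compress_dot _ vV vV); exact: rayleigh_le.
have pV : vpick V != 0 by rewrite vpick0.
have e0 : 0 < eigval 1 (compress S V).
  have := lt_le_trans (SV _ (memv_pick V) pV) (ray _ (memv_pick V)).
  by rewrite pmulr_lgt0 // dot_gt0.
have p0 : (0 < p)%N.
  case: (posnP p) pV => // p0 /negP[]; apply/eqP/matrixP => i.
  by have := ltn_ord i; rewrite {2}p0.
have [v [v0 va]] := eigval1_eigenvector p0 As.
have vV : v \in V by apply: eigenvector_mem va; exact: lt0r_neq0.
split => //; exists v; rewrite vV -(compress_dot S vV vV); split => //.
exact: eigenvector_dot.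
Qed.

Lemma kappa2E (A : 'M[R]_p) : kappa2 A = eigval 1 A / lastnz A.
Proof. by []. Qed.

Lemma kappa_compress_ge1 S V : psd S -> posdef_on S V -> V != 0%VS ->
  1 <= kappa2 (compress S V).
Proof.
move=> Sp SV V0; have [l0 [v [vV v0 vl]] _] := compress_lastnz Sp SV V0.
have [_ _ /(_ v vV)] := compress_eigval1 Sp SV V0.
rewrite vl ler_pM2r ?dot_gt0 // => le.
by rewrite kappa2E ler_pdivlMr // mul1r.
Qed.

Lemma ratio_of_ratios_ge (A1 A2 L1 L2 lo up : R) : 0 < A1 -> 0 < L1 -> 0 < L2 ->
  A1 <= A2 -> L2 <= up -> lo <= L1 -> 0 <= lo ->
  lo / up <= A2 / L2 / (A1 / L1).
Proof.
move=> a1 l1 l2 A12 L2up loL1 lo0.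
have up0 : 0 < up by apply: lt_le_trans L2up.
have -> : A2 / L2 / (A1 / L1) = (A2 / A1) * (L1 / L2).
  by rewrite invf_div mulf_div [RHS]mulf_div (mulrC L2).
apply: (@le_trans _ _ (L1 / L2)).
  by apply: ler_pM => //; rewrite ?invr_ge0 ?(ltW up0) // lef_pV2.
apply: ler_peMl; first by rewrite divr_ge0 // ltW.
by rewrite ler_pdivlMr // mul1r.
Qed.

(** The largest eigenvalue can only grow from V to W, so the ratio of condition
    numbers is at least the ratio of the smallest nonzero eigenvalues; the one
    on W is at most the Rayleigh quotient of any vector w of W. *)
Lemma kappa_ratio_ge S V W lo up w : psd S -> posdef_on S W ->
  (V <= W)%VS -> V != 0%VS -> w \in W -> w != 0 ->
  dot w (S *m w) <= up * dot w w ->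
  0 <= lo -> (forall v, v \in V -> lo * dot v v <= dot v (S *m v)) ->
  lo / up <= kappa2 (compress S W) / kappa2 (compress S V).
Proof.
move=> Sp SW VW V0 wW w0 wup lo0 vlo.
have SV : posdef_on S V by move=> v vV; apply: SW; exact: (subvP VW).
have W0 := vspace_neq0 wW w0.
have [l1 [v1 [v1V v10 v1E]] _] := compress_lastnz Sp SV V0.
have [l2 _ l2min] := compress_lastnz Sp SW W0.
have [a1 [u1 [u1V u10 u1E]] _] := compress_eigval1 Sp SV V0.
have [a2 _ a2max] := compress_eigval1 Sp SW W0.
rewrite (kappa2E (compress S W)) (kappa2E (compress S V)).
apply: (ratio_of_ratios_ge a1 l1 l2 _ _ _ lo0).
- by have := a2max _ (subvP VW _ u1V); rewrite u1E ler_pM2r ?dot_gt0.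
- by have := le_trans (l2min _ wW) wup; rewrite ler_pM2r ?dot_gt0.
- by have := vlo _ v1V; rewrite v1E ler_pM2r ?dot_gt0.
Qed.

End Compression.

(** * Krylov spaces *)

Section Krylov.
Context (R : realType) (p : nat).
Implicit Types (S A : 'M[R]_p) (V W : {vspace 'cV[R]_p}) (b v : 'cV[R]_p).

Definition kry s S b : 'M[R]_(p, s) := cols s (fun j => S ^+ j *m b).

Lemma mem_krylov s S b v :
  v \in krylov s S b <-> exists c, v = kry s S b *m c.
Proof. exact: mem_cols. Qed.

Lemma mem_krylov_comb s S b v : v \in krylov s S b <->
  exists c : nat -> R, v = \sum_(j < s) c j *: (S ^+ j *m b).
Proof.
split=> [/mem_krylov[c ->]|[c ->]].
  exists (fun j => oapp (fun i => c i 0) 0 (insub j)); rewrite mul_cols.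
  by apply: eq_bigr => j _; rewrite valK.
apply/mem_krylov; exists (\col_j c j); rewrite mul_cols.
by apply: eq_bigr => j _; rewrite mxE.
Qed.

Lemma krylov_pow S b j s : (j < s)%N -> S ^+ j *m b \in krylov s S b.
Proof. by move=> js; apply/memv_span/map_f; rewrite mem_iota. Qed.

Lemma krylov_base S b s : (0 < s)%N -> b \in krylov s S b.
Proof. by move=> s0; have := krylov_pow S b s0; rewrite expr0 mul1mx. Qed.

Lemma krylov_sub S b s t : (s <= t)%N -> (krylov s S b <= krylov t S b)%VS.
Proof.
move=> st; apply/span_subvP => _ /mapP[j js ->]; apply: krylov_pow.
by move: js; rewrite mem_iota /= add0n => /leq_trans; exact.
Qed.

Lemma expSm S b j : S ^+ j.+1 *m b = S *m (S ^+ j *m b).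
Proof. by rewrite exprS mulmxA. Qed.

Lemma krylov_stable V S b s : b \in V -> (forall v, v \in V -> S *m v \in V) ->
  (krylov s S b <= V)%VS.
Proof.
move=> bV SV; apply/span_subvP => _ /mapP[j _ ->].
elim: j => [|j IH]; first by rewrite expr0 mul1mx.
by rewrite expSm SV.
Qed.

Lemma krylov_eq_on V S A b s : b \in V -> (forall v, v \in V -> A *m v \in V) ->
  (forall v, v \in V -> S *m v = A *m v) -> krylov s S b = krylov s A b.
Proof.
move=> bV AV SA; congr span; apply: eq_map => j.
suff [] : S ^+ j *m b = A ^+ j *m b /\ A ^+ j *m b \in V by [].
elim: j => [|j [IH jV]]; first by rewrite !expr0 !mul1mx.
by rewrite !expSm IH SA // AV.
Qed.

Lemma krylov_add1 S b s :
  krylov s.+1 S b = (krylov s S b + <[S ^+ s *m b]>)%VS.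
Proof. by rewrite /krylov -[s.+1]addn1 iotaD map_cat span_cat span_seq1. Qed.

(** If S^j b depends on the lower powers, then the space of order j is stable
    under S. *)
Lemma krylov_stagnates S b j t : S ^+ j *m b \in krylov j S b ->
  (krylov t S b <= krylov j S b)%VS.
Proof.
case: j => [|j] jK.
  move: jK; rewrite expr0 mul1mx => bK; apply: krylov_stable => // v.
  by rewrite /krylov /= span_nil memv0 => /eqP ->; rewrite mulmx0 mem0v.
apply: krylov_stable; first exact: krylov_base.
move=> _ /mem_krylov_comb[c ->]; rewrite mulmx_sumr; apply: memv_suml => i _.
rewrite -scalemxAr -expSm memvZ //.
have [->//|ij] := eqVneq i.+1 j.+1.
by rewrite krylov_pow // ltn_neqAle ij ltn_ord.
Qed.

Lemma dim_krylov_le S b s : (\dim (krylov s S b) <= s)%N.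
Proof. by apply: leq_trans (dim_span _) _; rewrite size_map size_iota. Qed.

(** As long as the dimension stays below the order, some power depends on the
    lower ones and the spaces have stopped growing: a dimension reached at some
    order t is reached at the first possible order. *)
Lemma dim_krylov_full S b r t : (r <= \dim (krylov t S b))%N ->
  \dim (krylov r S b) = r.
Proof.
move=> rt.
have notin j : (j < r)%N -> S ^+ j *m b \notin krylov j S b.
  move=> jr; apply/negP => /(krylov_stagnates t)/dimvS tj.
  have := leq_trans rt (leq_trans tj (dim_krylov_le S b j)).
  by rewrite leqNgt jr.
suff: forall s, (s <= r)%N -> \dim (krylov s S b) = s by apply.
elim=> [|s IH] sr; first by rewrite /krylov /= span_nil dimv0.
rewrite krylov_add1 dimv_disjoint_sum.
  rewrite IH 1?ltnW // dim_vline; have := notin s sr.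
  by case: eqVneq => [->|_]; rewrite ?mem0v // addn1.
apply/eqP; rewrite -subv0; apply/subvP => v.
rewrite memv_cap memv0 => /andP[vK /vlineP[k vk]].
rewrite vk; have [->|k0] := eqVneq k 0; first by rewrite scale0r.
exfalso; move/negP: (notin s sr); apply.
by rewrite -(scale1r (S ^+ s *m b)) -(mulVf k0) -scalerA -vk memvZ.
Qed.

End Krylov.

Section Rank.
Context (R : realType).

Lemma rank_inj m n (M : 'M[R]_(m, n)) : (n <= \rank M)%N ->
  forall c : 'cV_n, M *m c = 0 -> c = 0.
Proof.
move=> rM c Mc; have : row_free M^T by rewrite /row_free mxrank_tr eqn_leq rank_leq_col.
move=> /row_freeP[B MB]; have := congr1 (mulmx B^T) Mc.
by rewrite mulmxA mulmx0 -(trmxK M) -trmx_mul MB trmx1 mul1mx.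
Qed.

Lemma range_factor p n (A : 'M[R]_p) (F : 'M[R]_(p, n)) :
  (forall c, F *m c \in range_mx A) -> exists M, F = A *m M.
Proof.
move=> FA; have /choice[u uE] : forall j : 'I_n, exists u, col j F = A *m u.
  by move=> j; apply/range_mxP; rewrite colE; exact: FA.
exists (\matrix_(i, j) u j i 0); apply/matrixP => i j.
have /matrixP/(_ i 0) := uE j; rewrite !mxE => ->.
by apply: eq_bigr => k _; rewrite mxE.
Qed.

End Rank.

(** * Stability of quadratic forms on Krylov spaces *)

Section Perturbation.
Context (R : realType).

Definition close_mx m n eta (A B : 'M[R]_(m, n)) :=
  forall i j, `|A i j - B i j| <= eta.

Lemma close_mx_le m n eta eta' (A B : 'M[R]_(m, n)) : eta <= eta' ->
  close_mx eta A B -> close_mx eta' A B.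
Proof. by move=> le AB i j; exact: le_trans (AB i j) le. Qed.

Section At.
Context (p : nat) (S0 : 'M[R]_p) (b0 : 'cV[R]_p).

Definition cont_at m n (F : 'M[R]_p -> 'cV[R]_p -> 'M[R]_(m, n)) :=
  forall eps, 0 < eps -> exists2 eta, 0 < eta &
    forall S b, close_mx eta S S0 -> close_mx eta b b0 -> close_mx eps (F S b) (F S0 b0).

Lemma cont_at_mul m n k (F : _ -> _ -> 'M[R]_(m, n)) (G : _ -> _ -> 'M[R]_(n, k)) :
  cont_at F -> cont_at G -> cont_at (fun S b => F S b *m G S b).
Proof.
move=> cF cG eps eps0; set A := F S0 b0; set B := G S0 b0.
(* M bounds all entries of both factors and e <= 1 <= M, so each of the three
   terms below is at most e M. *)
pose M := 1 + \sum_i \sum_j `|A i j| + \sum_i \sum_j `|B i j|.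
have sum0 u v (C : 'M[R]_(u, v)) : 0 <= \sum_i \sum_j `|C i j|.
  by apply: sumr_ge0 => i _; apply: sumr_ge0.
have le_sum u v (C : 'M[R]_(u, v)) i j : `|C i j| <= \sum_i \sum_j `|C i j|.
  rewrite (bigD1 i) //= (bigD1 j) //= -addrA lerDl addr_ge0 //.
    exact: sumr_ge0.
  by apply: sumr_ge0 => k' _; apply: sumr_ge0.
have M1 : 1 <= M by rewrite /M -addrA lerDl addr_ge0.
pose e := Num.min 1 (eps / (n.+1%:R * (3 * M))).
have e0 : 0 < e.
  rewrite /e lt_min ltr01 divr_gt0 // mulr_gt0 ?ltr0n // mulr_gt0 //.
  exact: lt_le_trans M1.
have [f f0 cFf] := cF _ e0; have [g g0 cGg] := cG _ e0.
exists (Num.min f g); first by rewrite lt_min f0.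
have fl : Num.min f g <= f by rewrite ge_min lexx.
have gl : Num.min f g <= g by rewrite ge_min lexx orbT.
move=> S b SS bb i j.
have fF := cFf _ _ (close_mx_le fl SS) (close_mx_le fl bb).
have gG := cGg _ _ (close_mx_le gl SS) (close_mx_le gl bb).
rewrite !mxE -sumrB.
apply: le_trans (ler_norm_sum _ _ _) _.
have term l : `|F S b i l * G S b l j - A i l * B l j| <= e * (3 * M).
  have -> : F S b i l * G S b l j - A i l * B l j =
    (F S b i l - A i l) * (G S b l j - B l j) +
    (F S b i l - A i l) * B l j + A i l * (G S b l j - B l j) by ring.
  have := fF i l; have := gG l j; rewrite -/A -/B => hg hf.
  have e1 : e <= 1 by rewrite ge_min lexx.
  have BM : `|B l j| <= M by apply: le_trans (le_sum _ _ B l j) _; rewrite /M; have := sum0 _ _ A; lra.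
  have AM : `|A i l| <= M by apply: le_trans (le_sum _ _ A i l) _; rewrite /M; have := sum0 _ _ B; lra.
  apply: le_trans (ler_normD _ _) _.
  apply: le_trans (lerD (ler_normD _ _) (lexx _)) _; rewrite !normrM.
  have h1 : `|F S b i l - A i l| * `|G S b l j - B l j| <= e * M.
    by apply: ler_pM => //; apply: le_trans hg _; apply: le_trans e1 M1.
  have h2 : `|F S b i l - A i l| * `|B l j| <= e * M by apply: ler_pM.
  have h3 : `|A i l| * `|G S b l j - B l j| <= M * e by apply: ler_pM.
  lra.
apply: (@le_trans _ _ (\sum_(l < n) e * (3 * M))); first exact: ler_sum.
rewrite sumr_const card_ord -[leLHS]mulr_natl.
have : e <= eps / (n.+1%:R * (3 * M)) by rewrite ge_min lexx orbT.
rewrite ler_pdivlMr; last first.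
  by rewrite mulr_gt0 ?ltr0n // mulr_gt0 //; exact: lt_le_trans M1.
move=> h; apply: le_trans h; rewrite mulrCA; apply: ler_wpM2l; first exact: ltW.
apply: ler_wpM2r; last by rewrite ler_nat.
by rewrite mulr_ge0 //; exact: le_trans M1.
Qed.

Lemma cont_at_tr m n (F : _ -> _ -> 'M[R]_(m, n)) :
  cont_at F -> cont_at (fun S b => (F S b)^T).
Proof.
move=> cF eps /cF[eta eta0 h]; exists eta => // S b SS bb i j.
by rewrite !mxE; exact: h.
Qed.

Lemma cont_at_fst : cont_at (fun S _ => S).
Proof. by move=> eps eps0; exists eps. Qed.

Lemma cont_at_pow j : cont_at (fun S b => S ^+ j *m b).
Proof.
elim: j => [|j IH].
  move=> eps eps0; exists eps => // S b _ bb; rewrite !expr0 !mul1mx; exact: bb.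
move=> eps eps0; have [eta eta0 h] := cont_at_mul cont_at_fst IH eps0.
by exists eta => // S b SS bb; rewrite !expSm; exact: h.
Qed.

Lemma cont_at_kry s : cont_at (kry s).
Proof.
move=> eps eps0.
have [eta eta0 h] : exists2 eta, 0 < eta & forall j, (j < s)%N ->
    forall S b, close_mx eta S S0 -> close_mx eta b b0 ->
    close_mx eps (S ^+ j *m b) (S0 ^+ j *m b0).
  elim: s => [|s [f f0 hf]]; first by exists 1.
  have [g g0 hg] := cont_at_pow s eps0.
  exists (Num.min f g); first by rewrite lt_min f0.
  move=> j; rewrite ltnS leq_eqVlt => /orP[/eqP ->|js] S b SS bb.
    by apply: hg; [apply: close_mx_le SS|apply: close_mx_le bb]; rewrite ge_min lexx orbT.
  by apply: (hf _ js); [apply: close_mx_le SS|apply: close_mx_le bb]; rewrite ge_min lexx.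
exists eta => // S b SS bb i j; rewrite ![kry _ _ _ _ _]mxE.
exact: (h j (ltn_ord j) S b SS bb i 0).
Qed.

End At.

Definition form n (G : 'M[R]_n) (c : 'cV[R]_n) := dot c (G *m c).

(** A positive definite form is at least a multiple of the squared norm, and
    this turns entrywise closeness into closeness in relative error. *)
Lemma form_close n (G0 : 'M[R]_n) eps : G0^T = G0 ->
  (forall c, c != 0 -> 0 < form G0 c) -> 0 < eps ->
  exists2 eta, 0 < eta & forall G, close_mx eta G G0 ->
    forall c, `|form G c - form G0 c| <= eps * form G0 c.
Proof.
move=> Gs G0p eps0.
have Gpsd : psd G0.
  split=> // v; have [->|v0] := eqVneq v 0; first by rewrite dot0l.
  exact/ltW/G0p.
(* If G0 = 0 then there is no nonzero c at all, and any mu does. *)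
have [mu mu0 muP] : exists2 mu, 0 < mu & forall c, mu * dot c c <= form G0 c.
  have [G00|G00] := eqVneq G0 0.
    exists 1 => // c; have [->|/G0p] := eqVneq c 0.
      by rewrite /form !dot0l mulr0.
    by rewrite /form G00 mul0mx dot0r ltxx.
  have [l0 _ lmin] := lastnz_spec Gpsd G00; exists (lastnz G0) => // c.
  apply: lmin; have GU : G0 \in unitmx.
    apply: unitmx_inj => d d0; apply/eqP; apply: contraTT isT => /G0p.
    by rewrite /form d0 dot0r ltxx.
  by exists (invmx G0 *m c); rewrite mulKVmx.
exists (eps * mu / (n * n).+1%:R); first by rewrite divr_gt0 ?mulr_gt0 ?ltr0n.
move=> G GG c; apply: (@le_trans _ _ (eps * (mu * dot c c))); last first.
  by rewrite ler_pM2l.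
rewrite /form -dotBr -mulmxBl /dot.
apply: le_trans (ler_norm_sum _ _ _) _.
have term i : `|c i 0 * ((G - G0) *m c) i 0| <=
    \sum_(j < n) eps * mu / (n * n).+1%:R * dot c c.
  rewrite mxE mulr_sumr; apply: le_trans (ler_norm_sum _ _ _) _.
  apply: ler_sum => j _; rewrite mulrCA normrM; apply: ler_pM => //.
    by rewrite !mxE; exact: GG.
  rewrite normrM; have hi := sqr_coord_le c i; have hj := sqr_coord_le c j.
  rewrite -(real_normK (num_real (c i 0))) in hi.
  rewrite -(real_normK (num_real (c j 0))) in hj.
  have := sqr_ge0 (`|c i 0| - `|c j 0|); rewrite sqrrB; lra.
apply: le_trans (ler_sum _ (fun i _ => term i)) _.
rewrite !sumr_const !card_ord -mulrnA -[leLHS]mulr_natl.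
rewrite (_ : (n * n)%:R * _ = (n * n)%:R / (n * n).+1%:R * (eps * (mu * dot c c))); last by ring.
rewrite ler_piMl ?mulr_ge0 ?(ltW eps0) ?(ltW mu0) ?dot_ge0 //.
by rewrite ler_pdivrMr ?ltr0n // mul1r ler_nat.
Qed.

(** When the Krylov matrix F has full column rank, F^T F and F^T S F are
    positive definite, and they depend continuously on (S, b). The relative
    error 1/10 is a convenient choice: the proof loses a factor 9/11 three
    times, and (9/11)^3 is more than 1/2. *)
Lemma krylov_forms_stable p (S0 : 'M[R]_p) (b0 : 'cV[R]_p) s : S0^T = S0 ->
  (forall c : 'cV_s, kry s S0 b0 *m c = 0 -> c = 0) ->
  posdef_on S0 (krylov s S0 b0) ->
  exists2 eta, 0 < eta & forall S b, close_mx eta S S0 -> close_mx eta b b0 ->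
    forall c : 'cV[R]_s, let v := kry s S b *m c in let v0 := kry s S0 b0 *m c in
    `|dot v v - dot v0 v0| <= 10^-1 * dot v0 v0 /\
    `|dot v (S *m v) - dot v0 (S0 *m v0)| <= 10^-1 * dot v0 (S0 *m v0).
Proof.
move=> Ss Finj Spos; have e0 : 0 < 10^-1 :> R by rewrite invr_gt0.
pose G (S : 'M[R]_p) (b : 'cV[R]_p) := (kry s S b)^T *m kry s S b.
pose H (S : 'M[R]_p) (b : 'cV[R]_p) := (kry s S b)^T *m (S *m kry s S b).
have GE S b (c : 'cV_s) : form (G S b) c = dot (kry s S b *m c) (kry s S b *m c).
  by rewrite /form /G [in RHS]dot_mull mulmxA.
have HE S b (c : 'cV_s) : form (H S b) c = dot (kry s S b *m c) (S *m (kry s S b *m c)).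
  by rewrite /form /H [in RHS]dot_mull !mulmxA.
have cK := cont_at_kry S0 b0 s.
have cG : cont_at S0 b0 G by apply: cont_at_mul => //; exact: cont_at_tr.
have cH : cont_at S0 b0 H.
  apply: cont_at_mul; first exact: cont_at_tr.
  by apply: cont_at_mul => //; exact: cont_at_fst.
have Fc0 (c : 'cV_s) : c != 0 -> kry s S0 b0 *m c != 0.
  by apply: contraNneq => /Finj ->.
have [g g0 hg] : exists2 eta, 0 < eta & forall G', close_mx eta G' (G S0 b0) ->
    forall c, `|form G' c - form (G S0 b0) c| <= 10^-1 * form (G S0 b0) c.
  apply: form_close => // [|c /Fc0]; last by rewrite GE dot_gt0.
  by rewrite trmx_mul trmxK.
have [h h0 hh] : exists2 eta, 0 < eta & forall G', close_mx eta G' (H S0 b0) ->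
    forall c, `|form G' c - form (H S0 b0) c| <= 10^-1 * form (H S0 b0) c.
  apply: form_close => // [|c /Fc0 c0].
    by rewrite /H !trmx_mul trmxK Ss -mulmxA.
  by rewrite HE; apply: Spos => //; apply/mem_krylov; exists c.
have [g' g'0 hg'] := cG _ g0; have [h' h'0 hh'] := cH _ h0.
exists (Num.min g' h'); first by rewrite lt_min g'0.
move=> S b SS bb c v v0.
rewrite /v /v0 -!GE -!HE; split.
  by apply/hg/hg'; [apply: close_mx_le SS|apply: close_mx_le bb]; rewrite ge_min lexx.
by apply/hh/hh'; [apply: close_mx_le SS|apply: close_mx_le bb];
  rewrite ge_min lexx orbT.
Qed.

End Perturbation.

(** * Stability of the stopping rule *)

Section Stopping.
Context (R : realType) (p : nat).
Implicit Types (S : 'M[R]_p) (b v w : 'cV[R]_p) (lo up : R).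

Lemma posdef_range S : psd S -> posdef_on S (range_mx S).
Proof.
move=> Sp v /range_mxP vS v0; have S0 : S != 0.
  by apply: contraNneq v0 => S0; have [u ->] := vS; rewrite S0 mul0mx.
have [l0 _ /(_ v vS)] := lastnz_spec Sp S0; apply: lt_le_trans.
by rewrite mulr_gt0 // dot_gt0.
Qed.

Lemma eigval_ge0 S k : psd S -> 0 <= eigval k S.
Proof.
move=> Sp; have [ks|ks] := ltnP k.-1 (size (eigvals S)).
  by apply: (psd_eigvals_ge0 Sp); exact: mem_nth.
by rewrite /eigval nth_default.
Qed.

(** Compares the vectors of the two Krylov spaces that have the same
    coordinates; 9/11 is (1 - 1/10) / (1 + 1/10). *)
Lemma krylov_bounds_stable (S0 : 'M[R]_p) (b0 : 'cV[R]_p) s : S0^T = S0 ->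
  (forall c : 'cV_s, kry s S0 b0 *m c = 0 -> c = 0) ->
  posdef_on S0 (krylov s S0 b0) ->
  exists2 eta, 0 < eta & forall S b, close_mx eta S S0 -> close_mx eta b b0 ->
  [/\ forall c : 'cV_s, kry s S b *m c = 0 -> c = 0,
      posdef_on S (krylov s S b),
      forall r lo, (r <= s)%N -> 0 <= lo ->
        (forall v, v \in krylov r S0 b0 -> lo * dot v v <= dot v (S0 *m v)) ->
        forall v, v \in krylov r S b -> 9 / 11 * lo * dot v v <= dot v (S *m v) &
      forall w up, w \in krylov s S0 b0 -> w != 0 ->
        dot w (S0 *m w) <= up * dot w w ->
        exists w', [/\ w' \in krylov s S b, w' != 0 &
          dot w' (S *m w') <= 11 / 9 * up * dot w' w']].
Proof.
move=> Ss Finj Spos; have [eta eta0 h] := krylov_forms_stable Ss Finj Spos.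
exists eta => // S b SS bb; have {}h := h S b SS bb.
have Fc0 (c : 'cV_s) : c != 0 -> kry s S0 b0 *m c != 0.
  by apply: contraNneq => /Finj ->.
have bnd (c : 'cV_s) : [/\ dot (kry s S b *m c) (kry s S b *m c) <=
      11 / 10 * dot (kry s S0 b0 *m c) (kry s S0 b0 *m c),
    9 / 10 * dot (kry s S0 b0 *m c) (kry s S0 b0 *m c) <=
      dot (kry s S b *m c) (kry s S b *m c),
    dot (kry s S b *m c) (S *m (kry s S b *m c)) <=
      11 / 10 * dot (kry s S0 b0 *m c) (S0 *m (kry s S0 b0 *m c)) &
    9 / 10 * dot (kry s S0 b0 *m c) (S0 *m (kry s S0 b0 *m c)) <=
      dot (kry s S b *m c) (S *m (kry s S b *m c))].
  have [] := h c; rewrite /= !ler_norml => /andP[? ?] /andP[? ?]; split; lra.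
have Finj' (c : 'cV_s) : kry s S b *m c = 0 -> c = 0.
  move=> c0; apply/eqP/negPn/negP => /Fc0; rewrite -dot_gt0.
  by have [_ + _ _] := bnd c; rewrite c0 dot0r; lra.
split => //.
- move=> _ /mem_krylov[c ->] v0; have [_ _ _] := bnd c; apply: lt_le_trans.
  rewrite mulr_gt0 //; apply: Spos; first by apply/mem_krylov; exists c.
  by apply: contraNneq v0 => /Finj ->; rewrite mulmx0.
- move=> r lo rs lo0 lob _ /mem_krylov_comb[c ->].
  (* A vector of the Krylov space of order r has coordinates of order s that
     vanish from r on. *)
  pose d : 'cV[R]_s := \col_j (if (j < r)%N then c j else 0).
  have dE A a : kry s A a *m d = \sum_(j < r) c j *: (A ^+ j *m a).
    rewrite mul_cols (big_ord_widen s (fun j => c j *: (A ^+ j *m a)) rs).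
    rewrite [RHS]big_mkcond; apply: eq_bigr => j _; rewrite mxE.
    by case: ifP => // _; rewrite scale0r.
  have [b1 b2 b3 b4] := bnd d; rewrite !dE in b1 b2 b3 b4.
  have := lob _ (proj2 (mem_krylov_comb r S0 b0 _) (ex_intro _ c erefl)).
  set X := dot _ _ in b1 b2 *; set X0 := dot _ _ in b1 b2 *.
  move=> lX; apply: le_trans b4.
  have h1 : 9 / 10 * (lo * X0) <= 9 / 10 * dot (\sum_(j < r) c j *: (S0 ^+ j *m b0)) (S0 *m \sum_(j < r) c j *: (S0 ^+ j *m b0)).
    by rewrite ler_pM2l // divr_gt0.
  apply: le_trans h1.
  have h2 : lo * X <= lo * (11 / 10 * X0) by rewrite ler_wpM2l.
  lra.
- move=> w up /mem_krylov[c ->] w0 wup; exists (kry s S b *m c).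
  have c0 : c != 0 by apply: contraNneq w0 => ->; rewrite mulmx0.
  split; first by apply/mem_krylov; exists c.
    by apply: contraNneq c0 => /Finj' ->.
  have [b1 b2 b3 b4] := bnd c.
  have up0 : 0 <= up.
    have := lt_le_trans (Spos _ (proj2 (mem_krylov s S0 b0 _) (ex_intro _ c erefl)) w0) wup.
    by rewrite pmulr_lgt0 ?dot_gt0 // => /ltW.
  have h2 := ler_wpM2l up0 b2.
  apply: le_trans b3 _; move: (dot (kry s S b *m c) _) h2 wup => X h2 wup.
  lra.
Qed.

Lemma early_stop_le S b r (tau : R) : (0 < r)%N -> (r < p)%N ->
  (2 * tau - 5) / 4 < krylov_cond S b r.+1 / krylov_cond S b r ->
  (early_stop tau S b <= (r%:R)%:E)%E.
Proof.
move=> r0 rp h; apply: ereal_inf_lbound; exists r => //; split => //.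
by rewrite r0 leq_subRL ?add1n // (leq_trans _ rp).
Qed.

(** The witness at order r + 1 and the lower bound at order r are moved to the
    Krylov spaces of the nearby pair (S, b), where they bound the ratio of
    condition numbers; each move costs a factor 9/11. *)
Lemma early_stop_stable (S0 : 'M[R]_p) (b0 : 'cV[R]_p) r : (0 < r)%N -> S0^T = S0 ->
  (forall c : 'cV_r.+1, kry r.+1 S0 b0 *m c = 0 -> c = 0) ->
  posdef_on S0 (krylov r.+1 S0 b0) ->
  exists2 eta, 0 < eta & forall S b, psd S -> close_mx eta S S0 -> close_mx eta b b0 ->
    forall w lo up tau, w \in krylov r.+1 S0 b0 -> w != 0 ->
    dot w (S0 *m w) <= up * dot w w -> 0 <= lo ->
    (forall v, v \in krylov r S0 b0 -> lo * dot v v <= dot v (S0 *m v)) ->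
    (2 * tau - 5) / 4 < 81 / 121 * (lo / up) ->
    (early_stop tau S b <= (r%:R)%:E)%E.
Proof.
move=> r0 Ss Finj Spos; have [eta eta0 h] := krylov_bounds_stable Ss Finj Spos.
exists eta => // S b Sp SS bb w lo up tau wK w0 wup lo0 vlo tauP.
have [inj pos /(_ r lo (leqnSn r) lo0 vlo) lob] := h S b SS bb.
move=> /(_ w up wK w0 wup)[w' [w'K w'0 w'up]].
apply: early_stop_le => //; first by rewrite -(inj_rank inj) rank_leq_row.
apply: lt_le_trans tauP _.
have -> : 81 / 121 * (lo / up) = (9 / 11 * lo) / (11 / 9 * up).
  rewrite -mulf_div; congr (_ * _).
  by field.
apply: (kappa_ratio_ge Sp pos (krylov_sub S b (leqnSn r)) _ w'K w'0 w'up _ lob).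
  have F1 : kry r.+1 S b *m delta_mx ord0 0 = b.
    rewrite mul_cols (bigD1 ord0) //= mxE !eqxx scale1r expr0 mul1mx big1 ?addr0 //.
    by move=> i /negbTE i0; rewrite mxE i0 scale0r.
  apply: vspace_neq0 (krylov_base S b r0) _.
  rewrite -F1; apply/eqP => /inj /matrixP/(_ ord0 0); rewrite !mxE !eqxx.
  by move/eqP; rewrite oner_eq0.
by rewrite mulr_ge0.
Qed.

(** When the Krylov space of order rank S0 is the range of S0, the quadratic
    form is bounded from below on it by the smallest nonzero eigenvalue, and
    this bound persists near (S0, b0). *)
Lemma range_lower_stable (S0 : 'M[R]_p) (b0 : 'cV[R]_p) : psd S0 ->
  range_mx S0 = krylov (\rank S0) S0 b0 ->
  exists2 eta, 0 < eta & forall S b, close_mx eta S S0 -> close_mx eta b b0 ->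
    forall v, v \in krylov (\rank S0) S b ->
    9 / 11 * eigval (\rank S0) S0 * dot v v <= dot v (S *m v).
Proof.
move=> Sp KS; have [Ss _] := Sp.
have Finj : forall c : 'cV_(\rank S0), kry (\rank S0) S0 b0 *m c = 0 -> c = 0.
  apply: rank_inj.
  have /choice[u uE] : forall j : 'I_p, exists u, col j S0 = kry (\rank S0) S0 b0 *m u.
    move=> j; apply/mem_krylov; rewrite -KS; apply/range_mxP.
    by exists (delta_mx j 0); rewrite colE.
  have {1}-> : S0 = kry (\rank S0) S0 b0 *m \matrix_(i, j) u j i 0.
    apply/matrixP => i j; have /matrixP/(_ i 0) := uE j; rewrite !mxE => ->.
    by apply: eq_bigr => k _; rewrite [in RHS]mxE.
  exact: mxrankM_maxl.
have pos : posdef_on S0 (krylov (\rank S0) S0 b0).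
  by rewrite -KS; exact: posdef_range.
have [eta eta0 h] := krylov_bounds_stable Ss Finj pos.
exists eta => // S b SS bb; have [_ _ + _] := h S b SS bb.
apply => //; first exact: eigval_ge0.
by move=> v; rewrite -KS => /range_mxP; exact: rayleigh_rank_ge.
Qed.

End Stopping.

(** * Expectations of real random variables *)

Section Esp.
Context d (T : measurableType d) (R : realType) (P : probability T R).
Implicit Types (X Y : T -> R).

Definition L1 X := P.-integrable [set: T] (EFin \o X).

Lemma espE X : esp P X = (\int[P]_w X w)%R.
Proof. by rewrite /esp unlock. Qed.

Lemma L1_measurable X : L1 X -> measurable_fun [set: T] X.
Proof. by move=> /measurable_int/measurable_EFinP. Qed.

Lemma EFin_esp X : L1 X -> (esp P X)%:E = (\int[P]_w (X w)%:E)%E.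
Proof. by move=> X1; rewrite espE fineK // integrable_fin_num. Qed.

Lemma L1_eq X Y : X =1 Y -> L1 X -> L1 Y.
Proof. by move=> XY; rewrite (_ : X = Y) //; apply/funext. Qed.

Lemma esp_eq X Y : X =1 Y -> esp P X = esp P Y.
Proof. by move=> XY; rewrite (_ : X = Y) //; apply/funext. Qed.

Lemma L1D X Y : L1 X -> L1 Y -> L1 (fun w => X w + Y w).
Proof. by move=> X1 Y1; exact: (integrableD _ X1 Y1). Qed.

Lemma L1Z a X : L1 X -> L1 (fun w => a * X w).
Proof. by move=> X1; exact: (integrableZl _ a X1). Qed.

Lemma L1B X Y : L1 X -> L1 Y -> L1 (fun w => X w - Y w).
Proof. by move=> X1 Y1; exact: (integrableB _ X1 Y1). Qed.

Lemma L1_cst a : L1 (fun=> a).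
Proof. exact: finite_measure_integrable_cst. Qed.

Lemma L1_sum I (s : seq I) (X : I -> T -> R) : (forall i, L1 (X i)) ->
  L1 (fun w => \sum_(i <- s) X i w).
Proof.
move=> X1; elim: s => [|i s IH].
  by apply: L1_eq (L1_cst 0) => w; rewrite big_nil.
by apply: L1_eq (L1D (X1 i) IH) => w; rewrite big_cons.
Qed.

Lemma L1_le X Y : measurable_fun [set: T] X -> (forall w, `|X w| <= Y w) ->
  L1 Y -> L1 X.
Proof.
move=> mX XY; apply: le_integrable => //; first exact/measurable_EFinP.
by move=> w _ /=; rewrite lee_fin (le_trans (XY w)) // ler_norm.
Qed.

Lemma L1_indic A : measurable A -> L1 (\1_A).
Proof. by move=> mA; exact: integrable_indic. Qed.

Lemma espD X Y : L1 X -> L1 Y -> esp P (fun w => X w + Y w) = esp P X + esp P Y.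
Proof. by move=> X1 Y1; rewrite !espE RintegralD. Qed.

Lemma espB X Y : L1 X -> L1 Y -> esp P (fun w => X w - Y w) = esp P X - esp P Y.
Proof. by move=> X1 Y1; rewrite !espE RintegralB. Qed.

Lemma espZ a X : L1 X -> esp P (fun w => a * X w) = a * esp P X.
Proof. by move=> X1; rewrite !espE RintegralZl. Qed.

Lemma esp_cst a : esp P (fun=> a) = a.
Proof. by rewrite /esp expectation_cst. Qed.

Lemma esp_sum I (s : seq I) (X : I -> T -> R) : (forall i, L1 (X i)) ->
  esp P (fun w => \sum_(i <- s) X i w) = \sum_(i <- s) esp P (X i).
Proof.
move=> X1; elim: s => [|i s IH].
  rewrite big_nil -[RHS](esp_cst 0); apply: esp_eq => w. by rewrite big_nil.
rewrite big_cons -IH -espD //; last exact: L1_sum.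
by apply: esp_eq => w; rewrite big_cons.
Qed.

Lemma esp_ge0 X : (forall w, 0 <= X w) -> 0 <= esp P X.
Proof. by move=> X0; rewrite espE Rintegral_ge0. Qed.

Lemma esp_le X Y : L1 X -> L1 Y -> (forall w, X w <= Y w) -> esp P X <= esp P Y.
Proof. by move=> X1 Y1 XY; rewrite !espE le_Rintegral. Qed.

Lemma L1_norm X : L1 X -> L1 (fun w => `|X w|).
Proof. by move=> X1; exact: integrable_norm. Qed.

Lemma esp_indic A : measurable A -> esp P (\1_A) = fine (P A).
Proof. by move=> mA; rewrite /esp expectation_indic. Qed.

Lemma esp_ae X Y : measurable_fun [set: T] X -> measurable_fun [set: T] Y ->
  {ae P, forall w, X w = Y w} -> esp P X = esp P Y.
Proof.
move=> mX mY XY; rewrite !espE; congr fine; apply: ae_eq_integral => //.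
- exact/measurable_EFinP.
- exact/measurable_EFinP.
- by apply: filterS XY => w /= ->.
Qed.

Lemma L1_ae X Y : measurable_fun [set: T] Y ->
  {ae P, forall w, X w = Y w} -> L1 X -> L1 Y.
Proof.
move=> mY XY X1; have mX := L1_measurable X1.
have /integrableP[_ Xoo] := X1.
apply/integrableP; split; first exact/measurable_EFinP.
rewrite (ae_eq_integral (fun w => `|(X w)%:E|%E)) //.
- by apply/measurableT_comp => //; exact/measurable_EFinP.
- by apply/measurableT_comp => //; exact/measurable_EFinP.
- by apply: filterS XY => w /= ->.
Qed.

Lemma esp_eq0_ae X : L1 X -> (forall w, 0 <= X w) -> esp P X = 0 ->
  {ae P, forall w, X w = 0}.
Proof.
move=> X1 X0 EX; have mX := L1_measurable X1.
have : (\int[P]_w `|(X w)%:E|)%E = 0%E.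
  rewrite (eq_integral (fun w => (X w)%:E)); first by rewrite -EFin_esp ?EX.
  by move=> w _; rewrite gee0_abs ?lee_fin.
have mX' : measurable_fun [set: T] (EFin \o X) by exact/measurable_EFinP.
move=> /(ae_eq_integral_abs P measurableT mX').
by apply: filterS => w /= /(_ Logic.I)[].
Qed.

Definition L2 X := measurable_fun [set: T] X /\ L1 (fun w => X w ^+ 2).

Lemma L2_mul X Y : L2 X -> L2 Y -> L1 (fun w => X w * Y w).
Proof.
move=> [mX X2] [mY Y2]; apply: (L1_le _ _ (L1D X2 Y2)).
  exact: measurable_funM.
move=> w /=; rewrite ler_norml; apply/andP.
have h1 := sqr_ge0 (X w - Y w); have h2 := sqr_ge0 (X w + Y w).
rewrite sqrrB in h1; rewrite sqrrD in h2.
have h3 := sqr_ge0 (X w); have h4 := sqr_ge0 (Y w); split; lra.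
Qed.

Lemma L2D X Y : L2 X -> L2 Y -> L2 (fun w => X w + Y w).
Proof.
move=> X2 Y2; split; first exact: (measurable_funD X2.1 Y2.1).
apply: L1_eq (L1D (L1D X2.2 (L1Z 2 (L2_mul X2 Y2))) Y2.2) => w /=.
by rewrite sqrrD mulr2n; ring.
Qed.

Lemma L2Z a X : L2 X -> L2 (fun w => a * X w).
Proof.
move=> [mX X2]; split; first exact: measurable_funM.
by apply: L1_eq (L1Z (a ^+ 2) X2) => w /=; rewrite exprMn.
Qed.

Lemma L2_cst a : L2 (fun=> a).
Proof. by split; [exact: measurable_cst|exact: L1_cst]. Qed.

Lemma L2_sum I (s : seq I) (X : I -> T -> R) : (forall i, L2 (X i)) ->
  L2 (fun w => \sum_(i <- s) X i w).
Proof.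
move=> X2; elim: s => [|i s IH].
  by rewrite (_ : (fun _ => _) = fun=> 0); [exact: L2_cst|apply/funext => w; rewrite big_nil].
rewrite (_ : (fun _ => _) = fun w => X i w + \sum_(j <- s) X j w); first exact: L2D.
by apply/funext => w; rewrite big_cons.
Qed.

(** The second moment of s X + t Y is nonnegative for all s and t. *)
Lemma esp_CS X Y : L2 X -> L2 Y ->
  esp P (fun w => X w * Y w) ^+ 2 <=
  esp P (fun w => X w ^+ 2) * esp P (fun w => Y w ^+ 2).
Proof.
move=> X2 Y2; have XY := L2_mul X2 Y2.
set a := esp P (fun w => X w ^+ 2); set b := esp P (fun w => Y w ^+ 2).
set c := esp P (fun w => X w * Y w).
have quad s t : 0 <= s ^+ 2 * a + 2 * s * t * c + t ^+ 2 * b.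
  have [_ Z1] := L2D (L2Z s X2) (L2Z t Y2).
  have /esp_ge0 : forall w, 0 <= (s * X w + t * Y w) ^+ 2 by move=> w; rewrite sqr_ge0.
  have A1 := L1Z (s ^+ 2) X2.2; have B1 := L1Z (t ^+ 2) Y2.2.
  have C1 := L1Z (2 * s * t) XY.
  rewrite /a /b /c -(espZ _ X2.2) -(espZ _ Y2.2) -(espZ _ XY).
  rewrite -(espD A1 C1) -(espD (L1D A1 C1) B1).
  by congr (_ <= _); apply: esp_eq => w /=; ring.
have a0 : 0 <= a by apply: esp_ge0 => w; rewrite sqr_ge0.
have b0 : 0 <= b by apply: esp_ge0 => w; rewrite sqr_ge0.
(* If E X^2 = 0, adding a suitable multiple of X to Y would give a negative
   second moment, unless E X Y = 0. *)
have [az|an] := eqVneq a 0.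
  have [cz|cn] := eqVneq c 0; first by rewrite cz expr0n mulr_ge0.
  have := quad (- (b + 1) / (2 * c)) 1.
  rewrite az mulr0 add0r mulr1 expr1n mul1r.
  have -> : 2 * (- (b + 1) / (2 * c)) * c = - (b + 1) by field.
  lra.
have a1 : 0 < a by rewrite lt_neqAle eq_sym an.
have := quad (- c) a; rewrite sqrrN => h.
have : 0 <= a * (a * b - c ^+ 2) by lra.
by rewrite pmulr_rge0 // subr_ge0.
Qed.

Lemma measurable_ge X t : measurable_fun [set: T] X -> measurable [set w | t <= X w].
Proof.
move=> mX; rewrite (_ : mkset _ = [set: T] `&` X @^-1` `[t, +oo[%classic).
  exact: mX.
by rewrite setTI; apply/seteqP; split => w /=; rewrite in_itv /= andbT.
Qed.

Lemma esp_markov X t : L1 X -> (forall w, 0 <= X w) -> 0 < t ->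
  fine (P [set w | t <= X w]) <= esp P X / t.
Proof.
move=> X1 X0 t0; have mA := measurable_ge t (L1_measurable X1).
rewrite ler_pdivlMr // mulrC -esp_indic // -espZ; last exact: L1_indic.
apply: esp_le => // [|w]; first exact/L1Z/L1_indic.
rewrite indicE; case: (boolP (w \in _)) => [/set_mem /=|_]; rewrite ?mulr1 //.
by rewrite mulr0.
Qed.

End Esp.

(** * Laws and independence *)

Section Law.
Context d (T : measurableType d) (R : realType) (P : probability T R).

Lemma ge0_integral_law d' (Z : measurableType d') (X Y : T -> Z) (f : Z -> \bar R) :
  measurable_fun [set: T] X -> measurable_fun [set: T] Y ->
  (forall B, measurable B -> P (X @^-1` B) = P (Y @^-1` B)) ->
  measurable_fun [set: Z] f -> (forall z, 0 <= f z)%E ->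
  (\int[P]_w f (X w) = \int[P]_w f (Y w))%E.
Proof.
move=> mX mY XY mf f0.
pose X' : {RV P >-> Z} := HB.pack X (isMeasurableFun.Build _ _ _ _ X mX).
pose Y' : {RV P >-> Z} := HB.pack Y (isMeasurableFun.Build _ _ _ _ Y mY).
have <- := ge0_integral_distribution X' mf f0.
have <- := ge0_integral_distribution Y' mf f0.
by apply: eq_measure_integral => B mB _; exact: XY.
Qed.

Lemma same_law_L1 (X Y : T -> R) : measurable_fun [set: T] X ->
  measurable_fun [set: T] Y ->
  (forall B, measurable B -> P (X @^-1` B) = P (Y @^-1` B)) ->
  L1 P X -> L1 P Y /\ esp P Y = esp P X.
Proof.
move=> mX mY XY X1.
have Y1 : L1 P Y.
  apply/integrableP; split; first exact/measurable_EFinP.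
  have /integrableP[_] := X1; apply: le_lt_trans.
  have E := ge0_integral_law (f := fun z : R => `|z%:E|%E) mX mY XY.
  by rewrite /= -E // ; apply: measurableT_comp => //; exact/measurable_EFinP.
split=> //.
pose X' : {RV P >-> R} := HB.pack X (isMeasurableFun.Build _ _ _ _ X mX).
pose Y' : {RV P >-> R} := HB.pack Y (isMeasurableFun.Build _ _ _ _ Y mY).
have mE : measurable_fun [set: R] (@EFin R) by exact/measurable_EFinP.
rewrite !espE; congr fine.
have <- := integral_distribution (P := P) (X := X') mE X1.
have <- := integral_distribution (P := P) (X := Y') mE Y1.
by apply: eq_measure_integral => B mB _; apply/esym; exact: XY.
Qed.

Lemma integral_law_L1 (X : {RV P >-> R}) : L1 P X ->
  (distribution P X).-integrable [set: R] (@EFin R) /\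
  (\int[distribution P X]_u u%:E = (esp P X)%:E)%E.
Proof.
move=> X1; have mE : measurable_fun [set: R] (@EFin R) by exact/measurable_EFinP.
split; first exact: integrable_pushforward.
by rewrite (integral_distribution mE X1) EFin_esp.
Qed.

(** The joint law agrees on rectangles with the product of the marginal laws,
    hence equals it, and Fubini's theorem factors the integral of u v. *)
Lemma indep_L1 (U V : T -> R) : L1 P U -> L1 P V ->
  (forall A B, measurable A -> measurable B ->
     P (U @^-1` A `&` V @^-1` B) = P (U @^-1` A) * P (V @^-1` B))%E ->
  L1 P (fun w => U w * V w) /\ esp P (fun w => U w * V w) = esp P U * esp P V.
Proof.
move=> U1 V1 UV; have mU := L1_measurable U1; have mV := L1_measurable V1.
pose U' : {RV P >-> R} := HB.pack U (isMeasurableFun.Build _ _ _ _ U mU).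
pose V' : {RV P >-> R} := HB.pack V (isMeasurableFun.Build _ _ _ _ V mV).
have mW : measurable_fun [set: T] (fun w => (U w, V w)) by exact/measurable_fun_pair.
pose W : {RV P >-> (R * R)%type} :=
  HB.pack (fun w => (U w, V w)) (isMeasurableFun.Build _ _ _ _ (fun w => (U w, V w)) mW).
pose m1 := distribution P U'; pose m2 := distribution P V'.
have prodE := @product_measure_unique _ _ _ _ _ m1 m2 (distribution P W) UV.
have mEM : measurable_fun [set: R * R] (fun z : R * R => (z.1 * z.2)%:E).
  by apply/measurable_EFinP; exact: measurable_funM.
have [i1 e1] := integral_law_L1 (X := U') U1.
have [i2 e2] := integral_law_L1 (X := V') V1.
have mA : measurable_fun [set: R * R] (fun z : R * R => `|(z.1 * z.2)%:E|%E).
  exact: measurableT_comp.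
have absoo : (\int[m1 \x m2]_z `|(z.1 * z.2)%:E| < +oo)%E.
  rewrite fubini_tonelli1 //= /fubini_F.
  have [n1 n2] := (integrable_abse i1, integrable_abse i2).
  set c := (\int[m2]_v `|v%:E|)%E.
  have cfin : c \is a fin_num by exact: integrable_fin_num n2.
  rewrite (eq_integral (fun u : R => (fine c)%:E * `|u%:E|)%E); last first.
    move=> u _; rewrite fineK // muleC -[`|u%:E|%E]/(`|u|%:E) -integralZl //.
    by apply: eq_integral => v _; rewrite -EFinM -normrM.
  rewrite integralZl // lte_mul_pinfty ?lee_fin ?fine_ge0 ?integral_ge0 //.
  exact: integrable_lty n1.
have W1 : L1 P (fun w => U w * V w).
  apply/integrableP; split; first exact/measurable_EFinP/measurable_funM.
  have <- := ge0_integral_distribution W mA; last by [].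
  by rewrite -(eq_measure_integral _ (fun A mA _ => prodE A mA)).
split=> //; apply: EFin_inj.
rewrite EFin_esp // EFinM -e1 -e2.
have <- := integral_distribution (P := P) (X := W) mEM W1.
rewrite -(eq_measure_integral _ (fun A mA _ => prodE A mA)).
rewrite -integral12_prod_meas1; last by apply/integrableP.
rewrite /fubini_F (eq_integral (fun u : R => (esp P V)%:E * u%:E)%E); last first.
  by move=> u _; rewrite muleC -e2 -integralZl.
by rewrite integralZl // e2 muleC.
Qed.

End Law.

(** * A weak law of large numbers under a bound on the maximum *)

Section Pr.
Context d (T : measurableType d) (R : realType) (P : probability T R).

Lemma pr_fin (A : set T) : measurable A -> P A \is a fin_num.
Proof. by move=> mA; exact: fin_num_measure. Qed.

Lemma pr_le (A B : set T) : measurable A -> measurable B -> A `<=` B ->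
  fine (P A) <= fine (P B).
Proof.
move=> mA mB AB; rewrite fine_le ?pr_fin //.
by apply: le_measure; rewrite ?inE.
Qed.

Lemma pr_setC (A : set T) : measurable A -> fine (P (~` A)) = 1 - fine (P A).
Proof. by move=> mA; rewrite probability_setC // fineB ?pr_fin. Qed.

Lemma pr_setU_le (A B : set T) : measurable A -> measurable B ->
  fine (P (A `|` B)) <= fine (P A) + fine (P B).
Proof.
move=> mA mB; have mU := measurableU _ _ mA mB.
rewrite -lee_fin EFinD !fineK ?pr_fin //; exact: measureU2.
Qed.

End Pr.

Lemma bernoulli_ge (R : realType) (p : R) n : 0 <= p -> 1 + n%:R * p <= (1 + p) ^+ n.
Proof.
move=> p0; elim: n => [|n IH]; first by rewrite mul0r addr0 expr0.
rewrite exprS; apply: le_trans (ler_wpM2l _ IH); last by lra.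
rewrite -natr1; have : 0 <= n%:R * p * p by rewrite !mulr_ge0.
lra.
Qed.

Section WeakLaw.
Context d (T : measurableType d) (R : realType) (P : probability T R).
Context d' (Z : measurableType d') (z0 : T -> Z) (z : nat -> T -> Z).
Context (mz0 : measurable_fun [set: T] z0).
Context (mz : forall i, measurable_fun [set: T] (z i)).
Context (z_law : forall i A, measurable A -> P (z i @^-1` A) = P (z0 @^-1` A)).
Context (z_indep : forall (J : seq nat) (A : nat -> set Z), uniq J ->
  (forall i, measurable (A i)) ->
  P (\bigcap_(i in [set` J]) z i @^-1` A i) = (\prod_(i <- J) P (z i @^-1` A i))%E).

Lemma measurable_pre (g : Z -> R) (B : set R) : measurable_fun [set: Z] g ->
  measurable B -> measurable (g @^-1` B).
Proof. by move=> mg mB; rewrite -(setTI (_ @^-1` _)); exact: mg. Qed.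

Lemma iid_L1 g i : measurable_fun [set: Z] g -> L1 P (g \o z0) ->
  L1 P (g \o z i) /\ esp P (g \o z i) = esp P (g \o z0).
Proof.
move=> mg g1; apply: same_law_L1 => //; try exact: measurableT_comp.
by move=> B mB; apply/esym; exact: z_law i _ (measurable_pre mg mB).
Qed.

Lemma iid_pair (g h : Z -> R) i j : i != j ->
  measurable_fun [set: Z] g -> measurable_fun [set: Z] h ->
  L1 P (g \o z0) -> L1 P (h \o z0) ->
  L1 P (fun w => g (z i w) * h (z j w)) /\
  esp P (fun w => g (z i w) * h (z j w)) = esp P (g \o z0) * esp P (h \o z0).
Proof.
move=> ij mg mh g1 h1.
have [gi eg] := iid_L1 i mg g1; have [hj eh] := iid_L1 j mh h1.
rewrite -eg -eh; apply: indep_L1 => // A B mA mB.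
have ji : (j == i) = false by rewrite eq_sym; exact: negbTE.
have := z_indep (J := [:: i; j]) (A := fun k => if k == i then g @^-1` A else h @^-1` B).
rewrite /= inE ij => /(_ isT); rewrite !big_cons big_nil mule1 eqxx ji => <-.
  congr (P _); apply/seteqP; split=> w /=.
    move=> [gw hw] k; rewrite /= !inE => /orP[/eqP ->|/eqP ->].
      by rewrite eqxx.
    by rewrite ji.
  move=> H; split; first by have := H i; rewrite /= inE eqxx; exact.
  by have := H j; rewrite /= !inE eqxx orbT ji; exact.
by move=> k; case: ifP => _; exact: measurable_pre.
Qed.

Lemma iid_all n A : measurable A ->
  fine (P (\bigcap_(i in [set` iota 0 n]) z i @^-1` A)) = fine (P (z0 @^-1` A)) ^+ n.
Proof.
move=> mA; rewrite (z_indep (A := fun=> A)) ?iota_uniq //.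
rewrite (eq_bigr (fun=> (fine (P (z0 @^-1` A)))%:E)); last first.
  move=> i _; rewrite z_law // fineK //; apply: fin_num_measure.
  by rewrite -(setTI (_ @^-1` _)); exact: mz0.
elim: n => [|n IH]; first by rewrite big_nil.
rewrite -[n.+1]addn1 iotaD big_cat /= big_cons big_nil mule1 fineM //; last first.
  by rewrite prode_fin_num.
by rewrite IH addn1 exprSr.
Qed.

Context (q : Z -> R) (mq : measurable_fun [set: Z] q).
Context (q0 : forall u, 0 <= q u).
Context (q1 : L1 P (q \o z0)).
Context (n : nat) (n0 : (0 < n)%N).

Let M w := \big[Num.max/0]_(i < n) q (z i w).
Let m := esp P M.

Lemma bigmax_ub (F : nat -> R) k i : (i < k)%N -> F i <= \big[Num.max/0]_(j < k) F j.
Proof.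
move=> ik; exact: (le_bigmax (0 : R) (fun j : 'I_k => F j) (Ordinal ik)).
Qed.

Lemma bigmax_ge0 (F : nat -> R) k : 0 <= \big[Num.max/0]_(j < k) F j.
Proof. exact: bigmax_ge_id. Qed.

Lemma measurable_bigmax k (F : nat -> T -> R) :
  (forall i, measurable_fun [set: T] (F i)) ->
  measurable_fun [set: T] (fun w => \big[Num.max/0]_(i < k) F i w).
Proof.
elim: k F => [|k IH] F mF.
  rewrite (_ : (fun _ => _) = fun=> 0); first exact: measurable_cst.
  by apply/funext => w; rewrite big_ord0.
rewrite (_ : (fun _ => _) = (fun w => Num.max (F 0%N w) (\big[Num.max/0]_(i < k) F i.+1 w))).
  by apply: measurable_maxr => //; apply: (IH (fun i => F i.+1)).
by apply/funext => w; rewrite big_ord_recl.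
Qed.

Lemma bigmax_le_sum k (F : nat -> R) : (forall i, 0 <= F i) ->
  \big[Num.max/0]_(i < k) F i <= \sum_(i < k) F i.
Proof.
move=> F0; apply: bigmax_le; first exact: sumr_ge0.
by move=> i _; rewrite (bigD1 i) //= lerDl; exact: sumr_ge0.
Qed.

Lemma L1_bigmax k (F : nat -> T -> R) : (forall i, L1 P (F i)) ->
  (forall i w, 0 <= F i w) -> L1 P (fun w => \big[Num.max/0]_(i < k) F i w).
Proof.
move=> F1 F0; apply: (L1_le (Y := fun w => \sum_(i < k) F i w)).
- by apply: measurable_bigmax => i; exact: L1_measurable (F1 i).
- move=> w; rewrite ger0_norm; last exact: (bigmax_ge0 (fun i => F i w)).
  exact: (@bigmax_le_sum k (fun i => F i w)).
- by apply: (@L1_sum _ _ _ P _ _ (fun i : 'I_k => F i)) => i.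
Qed.

Lemma L1_M : L1 P M.
Proof.
by apply: (@L1_bigmax n (fun i => q \o z i)) => [i|i w] //=; have [] := iid_L1 i mq q1.
Qed.

Context (t : R) (t0 : 0 < t).

Let ind u : R := ((t < q u)%R)%:R.

Lemma measurable_ind : measurable_fun [set: Z] ind.
Proof.
have mqt : measurable [set u | t < q u].
  rewrite (_ : mkset _ = [set: Z] `&` q @^-1` `]t, +oo[%classic); first exact: mq.
  by rewrite setTI; apply/seteqP; split => w /=; rewrite in_itv /= andbT.
rewrite (_ : ind = \1_[set u | t < q u]); first exact: measurable_indic.
by apply/funext => u; rewrite /ind indicE mem_setE.
Qed.

Lemma ind_bounds u : 0 <= ind u <= 1.
Proof. by rewrite /ind; case: (t < q u); rewrite lexx ler01. Qed.

Lemma L1_ind_mul (g : Z -> R) : measurable_fun [set: Z] g -> L1 P (g \o z0) ->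
  L1 P ((fun u => g u * ind u) \o z0).
Proof.
move=> mg g1; apply: (L1_le (Y := fun w => `|g (z0 w)|)); last exact: L1_norm.
  apply: (measurableT_comp (f := fun u => g u * ind u)) => //.
  by apply: measurable_funM => //; exact: measurable_ind.
move=> w /=; rewrite normrM ler_piMr // /ind; case: (_ < _).
  by rewrite normr1.
by rewrite normr0.
Qed.

Lemma L1_ind : L1 P (ind \o z0).
Proof.
apply: L1_eq (L1_ind_mul (g := fun=> 1) _ _) => [w /=||]; first by rewrite mul1r.
- exact: measurable_cst.
- exact: L1_cst.
Qed.

Let p := esp P (ind \o z0).

Let mall (A : set Z) : measurable A ->
  measurable (\bigcap_(i in [set` iota 0 n]) z i @^-1` A).
Proof.
move=> mA; apply: fin_bigcap_measurable; first exact: finite_seq.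
by move=> i _; rewrite -(setTI (_ @^-1` _)); exact: mz.
Qed.

Let msmall : measurable [set u | q u <= t].
Proof.
rewrite (_ : mkset _ = [set: Z] `&` q @^-1` `]-oo, t]%classic); first exact: mq.
by rewrite setTI; apply/seteqP; split => w /=; rewrite in_itv.
Qed.

(** Markov's inequality for the maximum. *)
Lemma all_small_ge : 1 - m / t <=
  fine (P (\bigcap_(i in [set` iota 0 n]) z i @^-1` [set u | q u <= t])).
Proof.
set G := \bigcap_(i in _) _; have mG : measurable G by exact: mall msmall.
rewrite lerBlDr -lerBlDl -pr_setC //.
apply: le_trans (esp_markov L1_M _ t0); last by move=> w; exact: (bigmax_ge0 (fun i => q (z i w))).
apply: pr_le; first exact: measurableC.
  exact: measurable_ge (L1_measurable L1_M).
move=> w /=; apply: contra_notP => /negP; rewrite -ltNge => Mt i /=.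
rewrite mem_iota /= add0n => ni; apply/ltW/le_lt_trans/Mt.
exact: (bigmax_ub (fun i => q (z i w)) ni).
Qed.

Lemma small_prob : fine (P (z0 @^-1` [set u | q u <= t])) = 1 - p.
Proof.
have mz0s : measurable (z0 @^-1` [set u | q u <= t]).
  by rewrite -(setTI (_ @^-1` _)); exact: mz0.
rewrite -esp_indic // /p -{1}(esp_cst P 1) -espB; last 2 first.
- exact: L1_cst.
- exact: L1_ind.
apply: esp_eq => w; rewrite indicE /ind /=; case: (boolP (w \in _)).
  by move=> /set_mem /=; rewrite leNgt => /negbTE ->; rewrite subr0.
move=> /negP h; case: ltP; rewrite ?subrr ?subr0 // => h'.
by exfalso; apply: h; exact/mem_set.
Qed.

Lemma p_bounds : 0 <= p <= 1.
Proof.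
rewrite esp_ge0; last by move=> w; have /andP[] := ind_bounds (z0 w).
rewrite /= -[leRHS](esp_cst P); apply: esp_le => [||w]; first exact: L1_ind.
  exact: L1_cst.
by have /andP[] := ind_bounds (z0 w).
Qed.

(** By independence no observation exceeds t with probability (1 - p)^n, which
    is at most 1 / (1 + n p) by Bernoulli's inequality and at least 2/3 by
    Markov's. *)
Lemma tail_prob_le : m / t <= 3^-1 -> n%:R * p <= 2^-1.
Proof.
move=> mt; have := all_small_ge; rewrite iid_all // small_prob => h.
have /andP[p0' p1] := p_bounds; have b := bernoulli_ge n p0'.
have np0 : 0 <= n%:R * p by rewrite mulr_ge0.
have h1 : (1 - p) ^+ n * (1 + p) ^+ n <= 1.
  rewrite -exprMn exprn_ile1 //; first by rewrite mulr_ge0; lra.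
  by have := sqr_ge0 p; lra.
have h2 : (1 - p) ^+ n * (1 + n%:R * p) <= 1.
  apply: le_trans h1; apply: ler_wpM2l => //; apply: exprn_ge0; lra.
have h3 : 2 / 3 * (1 + n%:R * p) <= (1 - p) ^+ n * (1 + n%:R * p).
  by apply: ler_wpM2r; lra.
lra.
Qed.

Let tailmean := esp P ((fun u => q u * ind u) \o z0).

(** Let N be the number of indices with q_i > t. The left-hand side is (2 - N)
    times the sum of the q_i over these indices, a sum which is at most N times
    the maximum; and (2 - N) N <= 1. *)
Lemma max_ge_tail w : \sum_(i < n) (q (z i w) * ind (z i w) -
    \sum_(j < n) (if j == i then 0 else q (z i w) * ind (z i w) * ind (z j w))) <= M w.
Proof.
pose N := \sum_(j < n) ind (z j w); pose g i := q (z i w) * ind (z i w).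
have ind2 i : ind (z i w) * ind (z i w) = ind (z i w).
  by rewrite /ind; case: (_ < _); rewrite ?mulr1 ?mulr0.
have M0 : 0 <= M w by exact: (bigmax_ge0 (fun i => q (z i w))).
have E (i : 'I_n) : g i - \sum_(j < n) (if j == i then 0 else g i * ind (z j w)) =
    (2 - N) * g i.
  have -> : \sum_(j < n) (if j == i then 0 else g i * ind (z j w)) =
      g i * N - g i * ind (z i w).
    rewrite /N mulr_sumr [X in _ = X - _](bigD1 i) //= addrAC subrr add0r.
    by rewrite big_mkcond [RHS]big_mkcond; apply: eq_bigr => j _; case: eqP.
  have -> : g i * ind (z i w) = g i by rewrite /g -mulrA ind2.
  by ring.
rewrite (eq_bigr _ (fun i _ => E i)) -mulr_sumr.
have sg : \sum_(i < n) g i <= M w * N.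
  rewrite /N mulr_sumr; apply: ler_sum => i _; apply: ler_wpM2r.
    by have /andP[] := ind_bounds (z i w).
  exact: (bigmax_ub (fun i => q (z i w)) (ltn_ord i)).
have sg0 : 0 <= \sum_(i < n) g i.
  by apply: sumr_ge0 => i _; rewrite mulr_ge0 //; have /andP[] := ind_bounds (z i w).
have [N2|N2] := leP 2 N.
  by apply: le_trans M0; rewrite mulr_le0_ge0 // subr_le0.
apply: (@le_trans _ _ ((2 - N) * (M w * N))); first by rewrite ler_wpM2l // subr_ge0 ltW.
have -> : (2 - N) * (M w * N) = M w - M w * (N - 1) ^+ 2 by ring.
by rewrite gerBl mulr_ge0 // sqr_ge0.
Qed.

(** By pairwise independence the left-hand side of max_ge_tail has mean n (1 -
    (n - 1) p) times the tail mean, and n p <= 1/2. *)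
Lemma tail_mean_le : m / t <= 3^-1 -> tailmean <= 2 * m / n%:R.
Proof.
move=> mt; have np := tail_prob_le mt.
have G1 := L1_ind_mul mq q1; have mG : measurable_fun [set: Z] (fun u => q u * ind u).
  by apply: measurable_funM => //; exact: measurable_ind.
have nR : 0 < n%:R :> R by rewrite ltr0n.
have tm0 : 0 <= tailmean.
  by apply: esp_ge0 => w /=; rewrite mulr_ge0 //; have /andP[] := ind_bounds (z0 w).
have Gi (i : 'I_n) := iid_L1 i mG G1.
pose h (i j : 'I_n) w := if j == i then 0 else q (z i w) * ind (z i w) * ind (z j w).
have hE (i j : 'I_n) : L1 P (h i j) /\ esp P (h i j) <= tailmean * p.
  rewrite /h; have [_|ji] := eqVneq j i.
    split; first exact: L1_cst.
    by rewrite esp_cst mulr_ge0 //; have /andP[] := p_bounds.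
  have ij : (i : nat) != j by rewrite eq_sym.
  by have [h1 ->] := iid_pair ij mG measurable_ind G1 L1_ind.
have hsum (i : 'I_n) : L1 P (fun w => \sum_(j < n) h i j w).
  by apply: L1_sum => j; have [] := hE i j.
have H1 (i : 'I_n) : L1 P (fun w => q (z i w) * ind (z i w) - \sum_(j < n) h i j w).
  by apply: L1B => //; have [] := Gi i.
have := esp_le (L1_sum _ H1) L1_M max_ge_tail; rewrite esp_sum // -/m => le_m.
have lo (i : 'I_n) : tailmean / 2 <=
    esp P (fun w => q (z i w) * ind (z i w) - \sum_(j < n) h i j w).
  have [G1i EG] := Gi i; rewrite espB // [X in X - _]EG.
  rewrite esp_sum; last by move=> j; have [] := hE i j.
  have : \sum_(j < n) esp P (h i j) <= \sum_(j < n) tailmean * p.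
    by apply: ler_sum => j _; have [] := hE i j.
  rewrite sumr_const card_ord -[X in _ <= X]mulr_natl mulrCA => le1.
  have := ler_wpM2l tm0 np; rewrite -/tailmean; lra.
have := le_trans (ler_sum _ (fun i _ => lo i)) le_m.
rewrite sumr_const card_ord -[X in X <= _]mulr_natl => h1.
rewrite ler_pdivlMr //; lra.
Qed.

(** Where no observation is truncated, the average is that of the truncated
    products, which concentrates by Chebyshev's inequality since their second
    moment is at most t D; the bias of the truncation is bounded through the
    tail mean by the Cauchy-Schwarz inequality. The set B depends on a and b,
    the event that nothing is truncated does not. *)
Lemma weak_law (a b : Z -> R) (D eta : R) : measurable_fun [set: Z] a ->
  measurable_fun [set: Z] b -> (forall u, a u ^+ 2 <= q u) ->
  L1 P (fun w => b (z0 w) ^+ 2) -> esp P (fun w => b (z0 w) ^+ 2) <= D ->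
  0 < eta -> m / t <= 3^-1 -> 2 * m / n%:R * D <= (eta / 2) ^+ 2 ->
  exists B, [/\ measurable B, fine (P B) <= 4 * t * D / (n%:R * eta ^+ 2) &
    forall w, (forall i, (i < n)%N -> q (z i w) <= t) -> ~ B w ->
    `|n%:R^-1 * (\sum_(i < n) a (z i w) * b (z i w)) -
      esp P (fun w => a (z0 w) * b (z0 w))| <= eta].
Proof.
move=> ma mb aq b2 bD eta0 mt biasle.
have nR : 0 < n%:R :> R by rewrite ltr0n.
pose f u := a u * b u; pose Y u := f u * (1 - ind u).
have mf : measurable_fun [set: Z] f by exact: measurable_funM.
have mY : measurable_fun [set: Z] Y.
  apply: measurable_funM => //; apply: measurable_funB; first exact: measurable_cst.
  exact: measurable_ind.
have a2 : L2 P (a \o z0).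
  split; first exact: measurableT_comp.
  apply: (L1_le _ _ q1).
    by apply: measurable_funX; exact: measurableT_comp.
  by move=> w /=; rewrite ger0_norm ?sqr_ge0 // aq.
have b2' : L2 P (b \o z0) by split => //; exact: measurableT_comp.
have f1 : L1 P (f \o z0) by exact: (L2_mul a2 b2').
have fi1 : L1 P ((fun u => f u * ind u) \o z0) by exact: L1_ind_mul.
have Y1 : L1 P (Y \o z0).
  by apply: L1_eq (L1B f1 fi1) => w; rewrite /Y /=; ring.
set mu := esp P (Y \o z0).
have Ysq u : Y u ^+ 2 <= t * b u ^+ 2.
  rewrite /Y /f /ind; case: ltP => [_|qt].
    by rewrite subrr mulr0 expr0n mulr_ge0 ?sqr_ge0 // ltW.
  rewrite subr0 mulr1 exprMn; apply: ler_wpM2r; first exact: sqr_ge0.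
  exact: le_trans (aq u) qt.
have Y2 : L2 P (Y \o z0).
  split; first exact: measurableT_comp.
  apply: (L1_le _ _ (L1Z t b2)).
    by apply: measurable_funX; exact: measurableT_comp.
  by move=> w /=; rewrite ger0_norm ?sqr_ge0.
pose C u := Y u - mu.
have mC : measurable_fun [set: Z] C by apply: measurable_funB => //; exact: measurable_cst.
have C1 : L1 P (C \o z0) by apply: L1B => //; exact: L1_cst.
have EC : esp P (C \o z0) = 0.
  by rewrite /C [LHS]espB ?esp_cst ?subrr //; exact: L1_cst.
have C2 : L1 P (fun w => C (z0 w) ^+ 2).
  apply: L1_eq (L1D (L1B Y2.2 (L1Z (2 * mu) Y1)) (L1_cst P (mu ^+ 2))) => w.
  by rewrite /C /=; ring.
have mC2 : measurable_fun [set: Z] (fun u => C u ^+ 2) by exact: measurable_funX.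
have EC2 : esp P (fun w => C (z0 w) ^+ 2) <= t * D.
  have -> : esp P (fun w => C (z0 w) ^+ 2) = esp P (fun w => Y (z0 w) ^+ 2) - mu ^+ 2.
    transitivity (esp P (fun w => Y (z0 w) ^+ 2 - 2 * mu * Y (z0 w) + mu ^+ 2)).
      by apply: esp_eq => w; rewrite /C; ring.
    rewrite espD; [|by apply: L1B; [exact: Y2.2|exact: L1Z]|exact: L1_cst].
    rewrite espB; [|exact: Y2.2|exact: L1Z].
    by rewrite espZ // esp_cst -/mu; ring.
  apply: (@le_trans _ _ (esp P (fun w => Y (z0 w) ^+ 2))); first by rewrite gerBl sqr_ge0.
  apply: (@le_trans _ _ (esp P (fun w => t * b (z0 w) ^+ 2))).
    by apply: esp_le; [exact: Y2.2|exact: L1Z|move=> w].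
  by rewrite espZ // ler_wpM2l // ltW.
pose V w := (n%:R^-1 * \sum_(i < n) C (z i w)) ^+ 2.
have VE w : V w = n%:R^-1 ^+ 2 * \sum_(i < n) \sum_(j < n) C (z i w) * C (z j w).
  rewrite /V exprMn [(\sum_(i < n) _) ^+ 2]expr2; congr (_ * _).
  by rewrite big_distrlr.
have CC (i j : 'I_n) : L1 P (fun w => C (z i w) * C (z j w)) /\
    esp P (fun w => C (z i w) * C (z j w)) <= if i == j then t * D else 0.
  have [<-|ij] := eqVneq i j.
    have [h1 h2] := iid_L1 i mC2 C2; split.
      by apply: L1_eq h1 => w /=; rewrite expr2.
    apply: le_trans EC2; rewrite -[X in _ <= X]h2 le_eqVlt; apply/orP; left.
    by apply/eqP/esp_eq => w /=; rewrite expr2.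
  by have [h1 ->] := iid_pair (i := i) (j := j) ij mC mC C1 C1; rewrite EC mulr0.
have CCs (i : 'I_n) : L1 P (fun w => \sum_(j < n) C (z i w) * C (z j w)).
  by apply: L1_sum => j; have [] := CC i j.
have V1 : L1 P V.
  apply: L1_eq (L1Z (n%:R^-1 ^+ 2) (L1_sum _ CCs)) => w; exact/esym/VE.
have EV : esp P V <= t * D / n%:R.
  rewrite (esp_eq _ VE) espZ; last exact: L1_sum.
  rewrite esp_sum //.
  apply: (@le_trans _ _ (n%:R^-1 ^+ 2 * \sum_(i < n) t * D)).
    apply: ler_wpM2l; first exact: sqr_ge0.
    apply: ler_sum => i _; rewrite esp_sum; last by move=> j; have [] := CC i j.
    apply: (@le_trans _ _ (\sum_(j < n) if i == j then t * D else 0)).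
      by apply: ler_sum => j _; have [] := CC i j.
    rewrite (bigD1 i) //= eqxx big1 ?addr0 // => j /negbTE.
    by rewrite eq_sym => ->.
  rewrite sumr_const card_ord -[X in _ * X]mulr_natl.
  by rewrite le_eqVlt; apply/orP; left; apply/eqP; field; rewrite gt_eqF.
have V0 w : 0 <= V w by exact: sqr_ge0.
have e20 : 0 < (eta / 2) ^+ 2 by rewrite exprn_gt0 // divr_gt0.
exists [set w | (eta / 2) ^+ 2 <= V w]; split.
- exact: measurable_ge (L1_measurable V1).
- apply: le_trans (esp_markov V1 V0 e20) _.
  apply: (@le_trans _ _ (t * D / n%:R / (eta / 2) ^+ 2)).
    by rewrite ler_pM2r // invr_gt0.
  by rewrite le_eqVlt; apply/orP; left; apply/eqP; field; rewrite !gt_eqF.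
move=> w small /= /negP; rewrite -ltNge => Vlt.
have bias : `|mu - esp P (f \o z0)| <= eta / 2.
  have -> : mu - esp P (f \o z0) = - esp P ((fun u => f u * ind u) \o z0).
    rewrite /mu (_ : esp P (Y \o z0) = esp P (f \o z0) - esp P ((fun u => f u * ind u) \o z0)).
      by ring.
    by rewrite -espB //; apply: esp_eq => w'; rewrite /Y /=; ring.
  rewrite normrN.
  have ai2 : L2 P ((fun u => a u * ind u) \o z0).
    split.
      apply: (measurableT_comp (f := fun u => a u * ind u)) => //.
      by apply: measurable_funM => //; exact: measurable_ind.
    apply: (L1_le _ _ a2.2).
      apply: measurable_funX; apply: (measurableT_comp (f := fun u => a u * ind u)) => //.
      by apply: measurable_funM => //; exact: measurable_ind.
    move=> w' /=; rewrite ger0_norm ?sqr_ge0 // /ind; case: (_ < _).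
      by rewrite mulr1.
    by rewrite mulr0 expr0n sqr_ge0.
  have CS := esp_CS ai2 b2'.
  have le1 : esp P (fun w' => (a (z0 w') * ind (z0 w')) ^+ 2) <= tailmean.
    apply: esp_le; [exact: ai2.2|exact: L1_ind_mul|move=> w' /=].
    rewrite exprMn /ind; case: (_ < _); rewrite ?expr1n ?expr0n ?mulr0 ?mulr1 //.
  have bpos : 0 <= esp P (fun w' => b (z0 w') ^+ 2) by apply: esp_ge0 => w'; exact: sqr_ge0.
  have tm := tail_mean_le mt.
  rewrite -(ler_pXn2r (n := 2)) ?nnegrE ?normr_ge0 ?divr_ge0 ?(ltW eta0) //.
  rewrite real_normK ?num_real //; apply: le_trans biasle.
  rewrite (_ : esp P _ = esp P (fun w' => ((fun u => a u * ind u) \o z0) w' * (b \o z0) w')).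
    apply: le_trans CS _.
    apply: ler_pM => //; first by apply: esp_ge0 => w'; exact: sqr_ge0.
    exact: le_trans le1 tm.
  by apply: esp_eq => w'; rewrite /f /=; ring.
have avg : n%:R^-1 * (\sum_(i < n) a (z i w) * b (z i w)) =
    n%:R^-1 * (\sum_(i < n) C (z i w)) + mu.
  have -> : \sum_(i < n) a (z i w) * b (z i w) = \sum_(i < n) (C (z i w) + mu).
    apply: eq_bigr => i _; rewrite /C subrK /Y /f /ind ltNge small //=.
    by rewrite subr0 mulr1.
  rewrite big_split /= sumr_const card_ord -[X in _ + X]mulr_natl; field.
  by rewrite gt_eqF.
have : `|n%:R^-1 * (\sum_(i < n) C (z i w))| < eta / 2.
  rewrite -(ltr_pXn2r (n := 2)) ?nnegrE ?normr_ge0 ?divr_ge0 ?(ltW eta0) //.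
  by rewrite real_normK ?num_real.
rewrite avg -addrA => h; apply: le_trans (ler_normD _ _) _.
move: bias; rewrite -/(f \o z0) /f /=; lra.
Qed.

End WeakLaw.

(** * Second moments of random vectors *)

Section Moments.
Context d (T : measurableType d) (R : realType) (P : probability T R).

Definition L2vec k (u : T -> 'cV[R]_k) := forall i, L2 P (fun w => u w i 0).

Lemma L2vec_mul k l (A : 'M[R]_(l, k)) (u : T -> 'cV[R]_k) :
  L2vec u -> L2vec (fun w => A *m u w).
Proof.
move=> u2 i; rewrite (_ : (fun w => _) = fun w => \sum_j A i j * u w j 0).
  by apply: L2_sum => j; exact: L2Z.
by apply/funext => w; rewrite mxE.
Qed.

Lemma L2vecD k (u v : T -> 'cV[R]_k) :
  L2vec u -> L2vec v -> L2vec (fun w => u w + v w).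
Proof.
move=> u2 v2 i; rewrite (_ : (fun w => _) = fun w => u w i 0 + v w i 0).
  exact: L2D.
by apply/funext => w; rewrite mxE.
Qed.

Lemma L2vecZ k a (u : T -> 'cV[R]_k) : L2vec u -> L2vec (fun w => a *: u w).
Proof.
move=> u2 i; rewrite (_ : (fun w => _) = fun w => a * u w i 0).
  exact: L2Z.
by apply/funext => w; rewrite mxE.
Qed.

Lemma L2_dot k (c : 'cV[R]_k) (u : T -> 'cV[R]_k) : L2vec u ->
  L2 P (fun w => dot c (u w)).
Proof. by move=> u2; apply: L2_sum => j; exact: L2Z. Qed.

Lemma random_vectorP k (u : T -> 'cV[R]_k) : random_vector u ->
  square_integrable_vec P u -> L2vec u.
Proof. by move=> mu u2 i; split; [exact: mu|exact: u2]. Qed.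

Lemma cross_mx_mul k l k' l' (A : 'M[R]_(k', k)) (B : 'M[R]_(l', l))
    (u : T -> 'cV[R]_k) (v : T -> 'cV[R]_l) : L2vec u -> L2vec v ->
  cross_mx P (fun w => A *m u w) (fun w => B *m v w) =
  A *m cross_mx P u v *m B^T.
Proof.
move=> u2 v2; apply/matrixP => i j; rewrite !mxE.
transitivity (esp P (fun w => \sum_l0 \sum_k0 A i k0 * B j l0 * (u w k0 0 * v w l0 0))).
  apply: esp_eq => w; rewrite !mxE mulr_sumr; apply: eq_bigr => l0 _.
  by rewrite mulr_suml; apply: eq_bigr => k0 _; ring.
have uv k0 l0 : L1 P (fun w => u w k0 0 * v w l0 0) by exact: L2_mul.
have uv' k0 l0 : L1 P (fun w => A i k0 * B j l0 * (u w k0 0 * v w l0 0)) by exact: L1Z.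
rewrite esp_sum; last by move=> l0; apply: L1_sum.
apply: eq_bigr => l0 _; rewrite esp_sum // !mxE mulr_suml.
by apply: eq_bigr => k0 _; rewrite espZ // !mxE; ring.
Qed.

Lemma cov_vec_mul k k' (A : 'M[R]_(k', k)) (u : T -> 'cV[R]_k) (y : T -> R) :
  L2vec u -> L2 P y -> cov_vec P (fun w => A *m u w) y = A *m cov_vec P u y.
Proof.
move=> u2 y2; apply/matrixP => i j; rewrite !mxE.
transitivity (esp P (fun w => \sum_k0 A i k0 * (u w k0 0 * y w))).
  apply: esp_eq => w; rewrite !mxE mulr_suml; apply: eq_bigr => k0 _.
  by rewrite mulrA.
have uy k0 : L1 P (fun w => u w k0 0 * y w) by exact: L2_mul.
rewrite esp_sum; last by move=> k0; exact: L1Z.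
by apply: eq_bigr => k0 _; rewrite espZ // mxE.
Qed.

Lemma esp_dot k (u : T -> 'cV[R]_k) c c' : L2vec u ->
  esp P (fun w => dot c (u w) * dot c' (u w)) = dot c (cov_mx P u *m c').
Proof.
move=> u2; have := cross_mx_mul c^T c'^T u2 u2.
move=> /matrixP/(_ 0 0); rewrite mxE trmxK -mulmxA -dotE => <-.
by apply: esp_eq => w; rewrite !dotE.
Qed.

Lemma cov_mx_psd k (u : T -> 'cV[R]_k) : L2vec u -> psd (cov_mx P u).
Proof.
move=> u2; split.
  by apply/matrixP => i j; rewrite !mxE; apply: esp_eq => w; rewrite mulrC.
by move=> v; rewrite -esp_dot //; apply: esp_ge0 => w; rewrite -expr2 sqr_ge0.
Qed.

Lemma cross_mx_ae k l (u u' : T -> 'cV[R]_k) (v v' : T -> 'cV[R]_l) :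
  L2vec u -> L2vec u' -> L2vec v -> L2vec v' ->
  {ae P, forall w, u w = u' w} -> {ae P, forall w, v w = v' w} ->
  cross_mx P u v = cross_mx P u' v'.
Proof.
move=> u2 u2' v2 v2' uu vv; apply/matrixP => i j; rewrite !mxE; apply: esp_ae.
- exact: L1_measurable (L2_mul (u2 i) (v2 j)).
- exact: L1_measurable (L2_mul (u2' i) (v2' j)).
- by apply: filterS2 uu vv => w -> ->.
Qed.

Lemma cov_vec_ae k (u u' : T -> 'cV[R]_k) (y y' : T -> R) :
  L2vec u -> L2vec u' -> L2 P y -> L2 P y' ->
  {ae P, forall w, u w = u' w} -> {ae P, forall w, y w = y' w} ->
  cov_vec P u y = cov_vec P u' y'.
Proof.
move=> u2 u2' v2 v2' uu vv; apply/matrixP => i j; rewrite !mxE; apply: esp_ae.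
- exact: L1_measurable (L2_mul (u2 i) v2).
- exact: L1_measurable (L2_mul (u2' i) v2').
- by apply: filterS2 uu vv => w -> ->.
Qed.

(** The component of u along a vector of the kernel of its covariance has zero
    second moment. *)
Lemma ae_range k (u : T -> 'cV[R]_k) : L2vec u ->
  {ae P, forall w, orthoproj (range_mx (cov_mx P u)) *m u w = u w}.
Proof.
move=> u2; set S := cov_mx P u; set Q := orthoproj _.
have [Ss _] := cov_mx_psd u2; rewrite -/S in Ss.
have coord (j : 'I_k) : {ae P, forall w, (u w - Q *m u w) j 0 = 0}.
  pose c : 'cV[R]_k := delta_mx j 0 - Q *m delta_mx j 0.
  have cE w : dot c (u w) = (u w - Q *m u w) j 0.
    by rewrite /c dotBl dot_delta dot_mull orthoproj_sym dot_delta !mxE.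
  have Sc : S *m c = 0.
    apply/eqP; rewrite -dot_eq0; apply/eqP; rewrite dot_mulr Ss.
    have mS : S *m (S *m c) \in range_mx S by apply/range_mxP; exists (S *m c).
    by rewrite /c dotBr orthoproj_orth // subrr.
  have c2 := L2_dot c u2.
  have : esp P (fun w => dot c (u w) ^+ 2) = 0.
    have := esp_dot c c u2; rewrite -/S Sc dot0r => <-.
    by apply: esp_eq => w; rewrite expr2.
  move=> /(esp_eq0_ae c2.2 (fun w => sqr_ge0 _)); apply: filterS => w /eqP.
  by rewrite sqrf_eq0 cE => /eqP.
apply: filterS (filter_forall _ coord) => w h.
by apply/matrixP => i j; have := h i; rewrite ord1 !mxE => /eqP; rewrite subr_eq0 => /eqP ->.
Qed.

End Moments.

(** * Concentration of the sample moments *)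

Section Borel.
Context (R : realType) (k : nat).

Definition coord_sets : set (set 'cV[R]_k) :=
  \big[setU/set0]_(i < k) preimage_set_system setT (fun v : 'cV[R]_k => v i 0) measurable.

(** The sigma-algebra generated by the coordinates makes the columns a
    measurable type, so that the weak law applies to them. *)
Definition borelType := g_sigma_algebraType coord_sets.

Lemma measurable_coord (i : 'I_k) :
  measurable_fun [set: borelType] (fun v : borelType => (v : 'cV[R]_k) i 0).
Proof.
move=> _ B mB; rewrite setTI; apply: sub_sigma_algebra.
by rewrite /coord_sets (bigD1 i) //=; left; exists B => //; rewrite setTI.
Qed.

Lemma measurable_mulmx l (A : 'M[R]_(l, k)) (i : 'I_l) :
  measurable_fun [set: borelType] (fun v : borelType => (A *m (v : 'cV[R]_k)) i 0).
Proof.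
rewrite (_ : (fun _ => _) = fun v : borelType => \sum_j A i j * (v : 'cV[R]_k) j 0).
  by apply: measurable_sum => j; apply: measurable_funM => //; exact: measurable_coord.
by apply/funext => v; rewrite mxE.
Qed.

Lemma random_vector_measurable d (T : measurableType d) (u : T -> 'cV[R]_k) :
  random_vector u -> measurable_fun [set: T] (u : T -> borelType).
Proof.
move=> mu; apply: (@measurability _ _ T borelType setT u coord_sets) => //.
move=> _ [B + <-].
have : forall s : seq 'I_k, (\big[setU/set0]_(i <- s)
    preimage_set_system setT (fun v : 'cV[R]_k => v i 0) measurable) B ->
    exists i, preimage_set_system setT (fun v : 'cV[R]_k => v i 0) measurable B.
  elim=> [|i s IH]; first by rewrite big_nil.
  by rewrite big_cons => -[Bi|/IH//]; exists i.
move=> /[apply] -[i [C mC <-]]; rewrite !setTI.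
by have := mu i measurableT C mC; rewrite setTI; exact.
Qed.

End Borel.

Section Concentration.
Context d (T : measurableType d) (R : realType) (P : probability T R) (p : nat).
Context (x : T -> 'cV[R]_p) (y : T -> R).
Context (xs : nat -> T -> 'cV[R]_p) (ys : nat -> T -> R).
Context (x2 : L2vec P x).
Context (y2 : L2 P y).
Context (iid : iid_sample P x y xs ys).

Let Z := borelType R (p + 1).
Let z0 : T -> Z := pair_vec x y.
Let z (i : nat) : T -> Z := pair_vec (xs i) (ys i).

Lemma pair_vec_l (u : T -> 'cV[R]_p) (v : T -> R) w j :
  pair_vec u v w (lshift 1 j) 0 = u w j 0.
Proof. by rewrite /pair_vec col_mxEu. Qed.

Lemma pair_vec_r (u : T -> 'cV[R]_p) (v : T -> R) w :
  pair_vec u v w (rshift p 0) 0 = v w.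
Proof. by rewrite /pair_vec col_mxEd mxE eqxx mulr1n. Qed.

Lemma random_pair_vec (u : T -> 'cV[R]_p) (v : T -> R) : random_vector u ->
  measurable_fun [set: T] v -> random_vector (pair_vec u v).
Proof.
move=> mu mv i; case: (split_ordP i) => j ->.
  rewrite (_ : (fun w => _) = fun w => u w j 0); first exact: mu.
  by apply/funext => w; rewrite pair_vec_l.
rewrite (_ : (fun w => _) = v) //.
by apply/funext => w; rewrite ord1 pair_vec_r.
Qed.

Let mz0 : measurable_fun [set: T] z0.
Proof.
apply: random_vector_measurable; apply: random_pair_vec; last exact: y2.1.
by move=> i; exact: (x2 i).1.
Qed.

Let mz i : measurable_fun [set: T] (z i).
Proof.
have [m _ _] := iid; have [mx my] := m i.
by apply: random_vector_measurable; exact: random_pair_vec.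
Qed.

Let z_law i A : measurable A -> P (z i @^-1` A) = P (z0 @^-1` A).
Proof. by have [_ _ l] := iid => mA; exact: l. Qed.

Let z_indep (J : seq nat) (A : nat -> set Z) : uniq J ->
  (forall i, measurable (A i)) ->
  P (\bigcap_(i in [set` J]) z i @^-1` A i) = (\prod_(i <- J) P (z i @^-1` A i))%E.
Proof. by have [_ l _] := iid => uJ mA; exact: l. Qed.

Lemma sample_L2vec i : L2vec P (xs i).
Proof.
move=> j; have [m _ _] := iid; have [mx my] := m i; split; first exact: mx.
have mg : measurable_fun [set: Z] (fun v : Z => (v : 'cV[R]_(p + 1)) (lshift 1 j) 0 ^+ 2).
  by apply: measurable_funX; exact: measurable_coord.
have g1 : L1 P ((fun v : Z => (v : 'cV[R]_(p + 1)) (lshift 1 j) 0 ^+ 2) \o z0).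
  by apply: L1_eq (x2 j).2 => w /=; rewrite pair_vec_l.
have [h _] := iid_L1 mz0 mz z_law i mg g1.
by apply: L1_eq h => w /=; rewrite pair_vec_l.
Qed.

Lemma sample_cov_mx i : cov_mx P (xs i) = cov_mx P x.
Proof.
apply/matrixP => j k; rewrite !mxE.
pose g (v : Z) := (v : 'cV[R]_(p + 1)) (lshift 1 j) 0 * (v : 'cV[R]_(p + 1)) (lshift 1 k) 0.
have mg : measurable_fun [set: Z] g by apply: measurable_funM; exact: measurable_coord.
have g1 : L1 P (g \o z0).
  by apply: L1_eq (L2_mul (x2 j) (x2 k)) => w; rewrite /g /= !pair_vec_l.
have [_ h] := iid_L1 mz0 mz z_law i mg g1.
transitivity (esp P (g \o z i)); first by apply: esp_eq => w; rewrite /g /= !pair_vec_l.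
by rewrite h; apply: esp_eq => w; rewrite /g /= !pair_vec_l.
Qed.

Let S := cov_mx P x.
Let b0 := cov_vec P x y.
Let Q := orthoproj (range_mx S).

Lemma sample_ae_range i : {ae P, forall w, Q *m xs i w = xs i w}.
Proof. by rewrite /Q /S -(sample_cov_mx i); exact: ae_range (sample_L2vec i). Qed.

(** The projections onto the range of S are almost surely the observations
    themselves. Using them makes the envelope qn the exact sum of the squared
    norms along orthogonal subspaces of this range. *)
Let proj (v : Z) : 'cV[R]_p := Q *m usubmx (v : 'cV[R]_(p + 1)).
Let qn (v : Z) := dot (proj v) (proj v).

Lemma usubmx_pair u v w : usubmx (@pair_vec _ T R p u v w) = u w.
Proof. exact: col_mxKu. Qed.

Let measurable_proj j : measurable_fun [set: Z] (fun v : Z => proj v j 0).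
Proof.
rewrite (_ : (fun _ => _) = fun v : Z => (Q *m row_mx 1%:M 0 *m (v : 'cV[R]_(p + 1))) j 0).
  exact: measurable_mulmx.
apply/funext => v; rewrite /proj -mulmxA -{2}(vsubmxK (v : 'cV[R]_(p + 1))).
by rewrite mul_row_col mul1mx mul0mx addr0.
Qed.

Let measurable_qn : measurable_fun [set: Z] qn.
Proof.
by apply: measurable_sum => j; apply: measurable_funM; exact: measurable_proj.
Qed.

Definition sample_max n w :=
  \big[Num.max/0]_(i < n) dot (Q *m xs i w) (Q *m xs i w).

Definition moments_close n eta w :=
  close_mx eta (sample_cov xs n w) S /\ close_mx eta (sample_cov_vec xs ys n w) b0.

Lemma pr_bigU_le (I : Type) (s : seq I) (B : I -> set T) (c : R) :
  (forall i, measurable (B i)) -> (forall i, fine (P (B i)) <= c) ->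
  fine (P (\big[setU/set0]_(i <- s) B i)) <= (size s)%:R * c.
Proof.
move=> mB Bc; elim: s => [|i s IH]; first by rewrite big_nil measure0 mul0r.
rewrite big_cons; apply: le_trans (pr_setU_le P (mB i) (bigsetU_measurable _ (fun i _ => mB i))) _.
by rewrite /= -natr1 mulrDl mul1r addrC lerD.
Qed.

Lemma sample_covE n w j k :
  sample_cov xs n w j k = n%:R^-1 * \sum_(i < n) xs i w j 0 * xs i w k 0.
Proof. by rewrite !mxE; congr (_ * _); apply: eq_bigr => i _; rewrite !mxE. Qed.

Lemma sample_cov_vecE n w j :
  sample_cov_vec xs ys n w j 0 = n%:R^-1 * \sum_(i < n) xs i w j 0 * ys i w.
Proof. by rewrite !mxE; congr (_ * _); apply: eq_bigr => i _; rewrite !mxE. Qed.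

(** The weak law for the products x_j x_k and x_j y, with the squared norm of x
    as envelope: there are p (p + 1) exceptional sets and one common event that
    no observation is truncated. *)
Lemma moments_concentrate n (t D eta : R) : (0 < n)%N -> 0 < t -> 0 < eta ->
  (forall j, S j j <= D) -> esp P (fun w => y w ^+ 2) <= D ->
  esp P (sample_max n) / t <= 3^-1 ->
  2 * esp P (sample_max n) / n%:R * D <= (eta / 2) ^+ 2 ->
  with_prob_ge P (1 - (esp P (sample_max n) / t +
      (p * p.+1)%:R * (4 * t * D / (n%:R * eta ^+ 2))))
    (moments_close n eta).
Proof.
move=> n0 t0 eta0 SD yD mt bias.
have Sxs : cov_mx P (fun w => Q *m x w) = S.
  by apply: cross_mx_ae => //; do ?exact: L2vec_mul; exact: ae_range.
have bxs : cov_vec P (fun w => Q *m x w) y = b0.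
  apply: cov_vec_ae => //; do ?exact: L2vec_mul; first exact: ae_range.
  by apply: aeW.
have Qx2 := L2vec_mul Q x2.
have mE : esp P (sample_max n) = esp P (fun w => \big[Num.max/0]_(i < n) qn (z i w)).
  apply: esp_eq => w; apply: eq_bigr => i _.
  by rewrite /qn /proj /z usubmx_pair.
rewrite mE in mt bias *; set m := esp P _ in mt bias *.
have qn0 v : 0 <= qn v by exact: dot_ge0.
have qn1 : L1 P (qn \o z0).
  apply: L1_eq (@L1_sum _ _ _ P _ _ (fun (j : 'I_p) w => (Q *m x w) j 0 * (Q *m x w) j 0) _).
    by move=> w; rewrite /qn /proj /z0 /= usubmx_pair.
  by move=> j; exact: L2_mul.
pose b (o : option 'I_p) (v : Z) :=
  if o is Some k then proj v k 0 else (v : 'cV[R]_(p + 1)) (rshift p 0) 0.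
have mb o : measurable_fun [set: Z] (b o).
  case: o => [k|]; [exact: measurable_proj|exact: measurable_coord].
have b2 o : L2 P (b o \o z0).
  case: o => [k|]; rewrite /b /=.
    rewrite (_ : _ \o _ = fun w => (Q *m x w) k 0); first exact: Qx2.
    by apply/funext => w; rewrite /proj /z0 /= usubmx_pair.
  rewrite (_ : _ \o _ = y) //.
  by apply/funext => w; rewrite /z0 /= pair_vec_r.
have bD o : esp P (fun w => b o (z0 w) ^+ 2) <= D.
  case: o => [k|]; rewrite /b /=.
    apply: le_trans (SD k); rewrite -Sxs mxE le_eqVlt; apply/orP; left; apply/eqP.
    by apply: esp_eq => w; rewrite /proj /z0 usubmx_pair expr2.
  apply: le_trans yD; rewrite le_eqVlt; apply/orP; left; apply/eqP.
  by apply: esp_eq => w; rewrite /z0 pair_vec_r.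
have aq j (v : Z) : proj v j 0 ^+ 2 <= qn v by exact: sqr_coord_le.
pose c := 4 * t * D / (n%:R * eta ^+ 2).
have /choice[B BP] : forall jo : 'I_p * option 'I_p, exists B, [/\ measurable B,
    fine (P B) <= c & forall w, (forall i, (i < n)%N -> qn (z i w) <= t) -> ~ B w ->
    `|n%:R^-1 * (\sum_(i < n) proj (z i w) jo.1 0 * b jo.2 (z i w)) -
      esp P (fun w => proj (z0 w) jo.1 0 * b jo.2 (z0 w))| <= eta].
  move=> [j o]; apply: (weak_law mz0 mz z_law z_indep measurable_qn qn0 qn1 n0 t0
    (measurable_proj j) (mb o) (aq j) (b2 o).2 (bD o) eta0 mt bias).
have mB i : measurable (B i) by have [] := BP i.
have Bc i : fine (P (B i)) <= c by have [] := BP i.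
have [N [mN PN NQ]] : {ae P, forall w, forall i, Q *m xs i w = xs i w}.
  exact: ae_foralln sample_ae_range.
pose G := \bigcap_(i in [set` iota 0 n]) z i @^-1` [set u | qn u <= t].
have mG : measurable G.
  apply: fin_bigcap_measurable; first exact: finite_seq.
  move=> i _; rewrite -(setTI (_ @^-1` _)); apply: mz => //.
  rewrite (_ : mkset _ = [set: Z] `&` qn @^-1` `]-oo, t]%classic); first exact: measurable_qn.
  by rewrite setTI; apply/seteqP; split => v /=; rewrite in_itv.
pose U := \big[setU/set0]_(i <- enum {: 'I_p * option 'I_p}) B i.
have mU : measurable U by exact: bigsetU_measurable.
have PG := all_small_ge mz0 mz z_law measurable_qn qn0 qn1 n t0.
have PU : fine (P U) <= (p * p.+1)%:R * c.
  apply: le_trans (pr_bigU_le _ mB Bc) _.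
  by rewrite -cardE card_prod card_option !card_ord.
pose bad := (~` G `|` U) `|` N.
have mbad : measurable bad by do 2 apply: measurableU => //; exact: measurableC.
exists (~` bad); split; first exact: measurableC.
- move=> w /= /not_orP[/not_orP[/contrapT Gw Uw] Nw].
  have small i : (i < n)%N -> qn (z i w) <= t.
    by move=> ni; apply: (Gw i); rewrite /= mem_iota.
  have Qw i : Q *m xs i w = xs i w.
    by move: i; apply: contrapT => h; apply: Nw; exact: NQ.
  have nB i : ~ B i w.
    move=> Bi; apply: Uw; rewrite /U (bigD1_seq i) ?enum_uniq ?mem_enum //=; by left.
  have projz i j : proj (z i w) j 0 = xs i w j 0.
    by rewrite /proj /z usubmx_pair Qw.
  split=> j k.
    have [_ _ /(_ w small (nB _))] := BP (j, Some k); rewrite /=.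
    have -> : esp P (fun w0 => proj (z0 w0) j 0 * proj (z0 w0) k 0) = S j k.
      rewrite -Sxs mxE; apply: esp_eq => w0.
      by rewrite /proj /z0 usubmx_pair.
    rewrite sample_covE; congr (`|_ * _ - _| <= _); apply: eq_bigr => i _.
    by rewrite !projz.
  rewrite ord1; have [_ _ /(_ w small (nB _))] := BP (j, None); rewrite /=.
  have -> : esp P (fun w0 => proj (z0 w0) j 0 * (z0 w0 : 'cV[R]_(p + 1)) (rshift p 0) 0) = b0 j 0.
    rewrite -bxs mxE; apply: esp_eq => w0.
    by rewrite /proj /z0 usubmx_pair pair_vec_r.
  rewrite sample_cov_vecE; congr (`|_ * _ - _| <= _); apply: eq_bigr => i _.
  by rewrite projz /z pair_vec_r.
rewrite -[leRHS]fineK ?pr_fin //; last exact: measurableC.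
rewrite lee_fin pr_setC //.
rewrite lerD2l lerN2.
have mGU : measurable (~` G `|` U) by apply: measurableU => //; exact: measurableC.
apply: le_trans (pr_setU_le P mGU mN) _.
apply: le_trans (lerD (pr_setU_le P (measurableC mG) mU) (lexx _)) _.
rewrite PN addr0 pr_setC //.
by apply: lerD PU; rewrite lerBlDr addrC -lerBlDr.
Qed.

End Concentration.

(** * Moment ratios and complexities *)

Section Opnorm.
Context (R : realType) (p : nat) (A : 'M[R]_p).

Let im := [set enorm (A *m u) | u in [set u : 'cV[R]_p | enorm u <= 1]].

Let im_ub : has_ubound im.
Proof.
exists (Num.sqrt (\sum_i dot (row i A)^T (row i A)^T)) => _ [u u1 <-].
rewrite /enorm ler_wsqrtr // {1}/dot; apply: ler_sum => i _.
have -> : (A *m u) i 0 = dot (row i A)^T u.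
  by rewrite mxE /dot; apply: eq_bigr => j _; rewrite !mxE.
rewrite -expr2; apply: le_trans (dot_CS _ _) _.
rewrite ler_piMr ?dot_ge0 // -enorm_sqr.
by rewrite -(expr1n _ 2) ler_pXn2r ?nnegrE ?enorm_ge0.
Qed.

Lemma enorm_le_opnorm u : enorm u <= 1 -> enorm (A *m u) <= opnorm A.
Proof. by move=> u1; apply: ub_le_sup im_ub _ _; exists u. Qed.

Lemma opnorm_ge0 : 0 <= opnorm A.
Proof.
apply: le_trans (enorm_le_opnorm (u := 0) _); first exact: enorm_ge0.
by rewrite /enorm dot0r sqrtr0.
Qed.

Lemma opnorm_eq0 : opnorm A = 0 -> A = 0.
Proof.
move=> A0; apply/matrixP => i j; rewrite mxE.
have e1 : enorm (delta_mx j 0 : 'cV[R]_p) <= 1.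
  by rewrite /enorm dot_delta mxE !eqxx sqrtr1.
have := enorm_le_opnorm e1; rewrite A0 => h.
have /eqP : enorm (A *m delta_mx j 0) = 0 by apply/eqP; rewrite eq_le h enorm_ge0.
rewrite /enorm sqrtr_eq0 => h'.
have /eqP : dot (A *m delta_mx j 0) (A *m delta_mx j 0) == 0.
  by rewrite eq_le h' dot_ge0.
by move/eqP; rewrite dot_eq0 -colE => /eqP/matrixP/(_ i 0); rewrite !mxE.
Qed.

End Opnorm.

Section Ratio.
Context d (T : measurableType d) (R : realType) (P : probability T R).

(** E Z^4 >= (E Z^2)^2, because Z^2 has nonnegative variance. *)
Lemma moment_ratio_ge1 (Z : T -> R) : L1 P (fun w => Z w ^+ 2) ->
  (moment_ratio P Z < +oo)%E -> 1 <= fine (moment_ratio P Z).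
Proof.
move=> Z2; rewrite /moment_ratio.
have E2 : ('E_P[fun w => (Z w ^+ 2)%R] = (esp P (fun w => Z w ^+ 2))%:E)%E.
  by rewrite EFin_esp // unlock.
rewrite E2 eqe; set a := esp P _; case: ifP => [//|/negbT a0].
have a1 : 0 < a by rewrite lt_neqAle eq_sym a0 esp_ge0 // => w; rewrite sqr_ge0.
have s1 : 0 < Num.sqrt a by rewrite sqrtr_gt0.
have mZ4 : measurable_fun [set: T] (fun w => Z w ^+ 4).
  rewrite (_ : (fun _ => _) = fun w => (Z w ^+ 2) ^+ 2).
    by apply: measurable_funX; exact: L1_measurable Z2.
  by apply/funext => w; rewrite -exprM.
have [Z4|Z4] := pselect (L1 P (fun w => Z w ^+ 4)); last first.
  have -> : ('E_P[fun w => (Z w ^+ 4)%R] = +oo)%E.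
    rewrite unlock; apply/eqP; rewrite -leye_eq leNgt; apply/negP => h; apply: Z4.
    apply/integrableP; split; first exact/measurable_EFinP.
    apply: le_lt_trans h; rewrite le_eqVlt; apply/orP; left; apply/eqP.
    apply: eq_integral => w _ /=; rewrite ger0_norm //.
    by rewrite -[4%N]/(2 * 2)%N exprM sqr_ge0.
  by rewrite poweRyr ?invr_neq0 // gt0_mulye ?ltxx // lte_fin invr_gt0.
have -> : ('E_P[fun w => (Z w ^+ 4)%R] = (esp P (fun w => Z w ^+ 4))%:E)%E.
  by rewrite EFin_esp // unlock.
move=> _; rewrite poweR_EFin -EFinM /= ler_pdivlMr // mul1r.
set b := esp P _.
have ab : a ^+ 2 <= b.
  have : 0 <= esp P (fun w => (Z w ^+ 2 - a) ^+ 2).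
    by apply: esp_ge0 => w; rewrite sqr_ge0.
  have L := L1_cst P (a ^+ 2); have L' := L1Z (2 * a) Z2.
  rewrite (_ : esp P _ = b - 2 * a * a + a ^+ 2); first by lra.
  rewrite -[X in _ + X](esp_cst P) -[X in _ - X](espZ _ Z2) -(espB Z4 L').
  rewrite -(espD (L1B Z4 L') L); apply: esp_eq => w; ring.
have -> : Num.sqrt a = (a ^+ 2) `^ 4^-1.
  rewrite -powR_mulrn ?ltW // -powRrM -powR12_sqrt ?ltW //; congr (_ `^ _).
  by field.
by rewrite ge0_ler_powR ?nnegrE ?invr_ge0 ?sqr_ge0 // (le_trans _ ab) ?sqr_ge0.
Qed.

End Ratio.

Section Complexity.
Context d (T : measurableType d) (R : realType) (P : probability T R) (p : nat).
Context (x : T -> 'cV[R]_p) (y : T -> R).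
Context (xs : nat -> T -> 'cV[R]_p) (ys : nat -> T -> R).
Context (x2 : L2vec P x).
Context (y2 : L2 P y).
Context (iid : iid_sample P x y xs ys).
Context (Ly : (moment_ratio P y < +oo)%E).
Context (Lx : forall B : {vspace 'cV[R]_p}, (B <= range_mx (cov_mx P x))%VS ->
  (norm_ratio P x B < +oo)%E).

Lemma L1_enorm_sqr (u : T -> 'cV[R]_p) : L2vec P u -> L1 P (fun w => enorm (u w) ^+ 2).
Proof.
move=> u2; apply: L1_eq (@L1_sum _ _ _ P _ _ (fun i w => u w i 0 * u w i 0) _).
  by move=> w; rewrite enorm_sqr.
by move=> i; exact: L2_mul.
Qed.

Lemma norm_ratio_ge1 B : (B <= range_mx (cov_mx P x))%VS -> 1 <= fine (norm_ratio P x B).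
Proof.
move=> BS; apply: moment_ratio_ge1; last exact: Lx.
by apply: L1_enorm_sqr; exact: L2vec_mul.
Qed.

Definition max_norm (B : {vspace 'cV[R]_p}) n w :=
  \big[Num.max/0]_(i < n) enorm (project B (xs i) w) ^+ 2.

Lemma L1_max_norm B n : L1 P (max_norm B n).
Proof.
apply: (@L1_bigmax _ _ _ P n (fun i w => enorm (project B (xs i) w) ^+ 2)).
  by move=> i; apply/L1_enorm_sqr/L2vec_mul; exact: sample_L2vec x2 y2 iid i.
by move=> i w; rewrite sqr_ge0.
Qed.

Lemma max_norm_ge0 B n : 0 <= esp P (max_norm B n).
Proof.
apply: esp_ge0 => w.
exact: (bigmax_ge0 (fun i => enorm (project B (xs i) w) ^+ 2)).
Qed.

Lemma max_norm_eq0 B n : opnorm (cov_mx P (project B x)) = 0 ->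
  esp P (max_norm B n) = 0.
Proof.
move=> /opnorm_eq0 c0; apply/eqP; rewrite eq_le max_norm_ge0 andbT.
have xs2 i := sample_L2vec x2 y2 iid i.
have L (i : 'I_n) : L1 P (fun w => enorm (project B (xs i) w) ^+ 2).
  by apply/L1_enorm_sqr/L2vec_mul.
have E (i : 'I_n) : esp P (fun w => enorm (project B (xs i) w) ^+ 2) = 0.
  have ci : cov_mx P (project B (xs i)) = 0.
    rewrite -c0 /cov_mx /project !cross_mx_mul //.
    by rewrite -!/(cov_mx P _) (sample_cov_mx x2 y2 iid).
  rewrite (esp_eq _ (fun w => enorm_sqr _)) /dot esp_sum.
    rewrite big1 // => j _; have /matrixP/(_ j j) := ci.
    by rewrite !mxE.
  by move=> j; apply: L2_mul; exact: L2vec_mul.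
apply: (@le_trans _ _ (esp P (fun w => \sum_(i < n) enorm (project B (xs i) w) ^+ 2))).
  apply: esp_le; [exact: L1_max_norm|exact: L1_sum|move=> w].
  by apply: (@bigmax_le_sum _ n (fun i => enorm (project B (xs i) w) ^+ 2)) => i; rewrite sqr_ge0.
by rewrite esp_sum // big1.
Qed.

(** The operator norm cancels the denominator of rho; if it vanishes, so does
    the projected vector almost surely. *)
Lemma complexityE B n : opnorm (cov_mx P (project B x)) * rho P x xs B n =
  esp P (max_norm B n).
Proof.
rewrite /rho -/(max_norm B n).
have [z0|z0] := eqVneq (opnorm (cov_mx P (project B x))) 0.
  by rewrite max_norm_eq0 // z0 mul0r.
by rewrite mulrCA divff ?mulr1.
Qed.

Lemma max_norm_le_complexity B n : (B <= range_mx (cov_mx P x))%VS ->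
  esp P (max_norm B n) <= complexity P x xs n B.
Proof.
move=> BS; rewrite /complexity -mulrA complexityE.
by rewrite ler_peMl ?max_norm_ge0 ?norm_ratio_ge1.
Qed.

(** The square root of the operator norm in the constant and the denominator of
    rho in the deviation leave the expected maximum of the squared norms. A
    moment ratio, being at least 1, is at least its square root, which completes
    this maximum to the complexity of B. *)
Lemma Kconst_delta_ge B n : (B <= range_mx (cov_mx P x))%VS ->
  (1 < \rank (cov_mx P x))%N ->
  Num.sqrt (esp P (fun w => y w ^+ 2)) / enorm (cov_vec P x y) *
    Num.sqrt (complexity P x xs n B * ln 2 / n%:R) <=
  Kconst P x y 1 B * delta P x xs B n.
Proof.
move=> BS r2.
have Lb := norm_ratio_ge1 BS.
have Ly1 := moment_ratio_ge1 y2.2 Ly.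
have o0 := opnorm_ge0 (cov_mx P (project B x)).
have m0 := max_norm_ge0 B n; have cE := complexityE B n.
have compE : complexity P x xs n B = fine (norm_ratio P x B) * esp P (max_norm B n).
  by rewrite /complexity -mulrA cE.
set L := fine (norm_ratio P x B) in Lb; set l := fine (moment_ratio P y) in Ly1.
set o := opnorm _ in o0 cE; set r := rho P x xs B n in cE.
set s := Num.sqrt (esp P _); set b := enorm _.
set lnr := ln (\rank (cov_mx P x))%:R : R.
have ln20 : 0 < ln (2 : R) by rewrite ln_gt0 // ltr1n.
have ln2 : ln (2 : R) <= lnr by rewrite ler_ln ?posrE ?ltr0n ?ler_nat // (ltn_trans _ r2).
have sb0 : 0 <= s / b by rewrite divr_ge0 ?sqrtr_ge0.
rewrite /delta -/r -/lnr /Kconst -/l -/L -/o -/s -/b compE -/L.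
clearbody L l o r s b lnr; move: (esp P (max_norm B n)) m0 cE => m m0 cE.
clear compE.
apply: (@le_trans _ _ (L * (s * Num.sqrt o / b) * Num.sqrt (r * lnr / n%:R))).
  have -> : L * (s * Num.sqrt o / b) * Num.sqrt (r * lnr / n%:R) =
      s / b * (L * (Num.sqrt o * Num.sqrt (r * lnr / n%:R))) by ring.
  apply: ler_wpM2l => //; rewrite -sqrtrM // !mulrA cE.
  have L0 : 0 <= L by lra.
  apply: (@le_trans _ _ (Num.sqrt L * Num.sqrt (m * lnr / n%:R))).
    rewrite -sqrtrM // ler_wsqrtr // -!mulrA; apply: ler_wpM2l => //.
    apply: ler_wpM2l => //; apply: ler_wpM2r; rewrite ?invr_ge0 ?ler0n //.
  apply: ler_wpM2r; first exact: sqrtr_ge0.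
  rewrite -[leRHS](sqr_sqrtr L0) expr2 ler_peMl ?sqrtr_ge0 //.
  by rewrite -sqrtr1 ler_wsqrtr.
apply: ler_wpM2r; first exact: sqrtr_ge0.
set mx := Num.max _ _.
have mx1 : s * Num.sqrt o / b <= mx by rewrite le_max lexx.
have X0 : 0 <= s * Num.sqrt o / b by rewrite mulrAC mulr_ge0 ?sqrtr_ge0.
apply: (@le_trans _ _ (L * mx)); first by rewrite ler_wpM2l //; lra.
rewrite ler_wpM2r //; first exact: le_trans mx1.
rewrite ler_peMl //; lra.
Qed.

End Complexity.

(** * The population side of the latent factor model *)

Section Independence.
Context d (T : measurableType d) (R : realType) (P : probability T R).

Lemma borel_coord k (i : 'I_k) (A : set R) : measurable A ->
  borel_cv [set v : 'cV[R]_k | A (v i 0)].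
Proof.
by move=> mA; have := @measurable_coord R k i measurableT A mA; rewrite setTI.
Qed.

Lemma indep_coord k l (u : T -> 'cV[R]_k) (v : T -> 'cV[R]_l) i j :
  independent_vec P u v ->
  L1 P (fun w => u w i 0) -> L1 P (fun w => v w j 0) ->
  L1 P (fun w => u w i 0 * v w j 0) /\
  esp P (fun w => u w i 0 * v w j 0) =
    esp P (fun w => u w i 0) * esp P (fun w => v w j 0).
Proof.
move=> uv u1 v1; apply: indep_L1 => // A B mA mB.
exact: uv (borel_coord i mA) (borel_coord j mB).
Qed.

Lemma centered_esp (X : T -> R) : centered P X -> L1 P X /\ esp P X = 0.
Proof. by move=> [X1 X0]; split => //; rewrite /esp X0. Qed.

End Independence.

Section Population.
Context d (T : measurableType d) (R : realType) (P : probability T R) (p : nat).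
Context (x : T -> 'cV[R]_p) (y : T -> R) (By : {vspace 'cV[R]_p}).
Context (q : T -> 'cV[R]_p) (alpha : 'cV[R]_p) (eps : T -> R) (sigma : R).
Context (e : T -> 'cV[R]_p).
Context (reg : regular_pair P x y) (rel : relevant_subspace P x y By).
Context (lfm : latent_factor_model P x y By q alpha eps sigma e).

Let Sx := cov_mx P x.
Let sxy := cov_vec P x y.
Let Sq := cov_mx P q.
Let sqy := cov_vec P q y.
Let S1 := Sq + sigma ^+ 2 *: cov_mx P e.

Lemma regular_L2vec : L2vec P x.
Proof. by have [[mx _ x2 _] _ _ _ _] := reg; exact: random_vectorP. Qed.

Lemma regular_L2 : L2 P y.
Proof. by have [[_ my _ y2] _ _ _ _] := reg. Qed.

Let x2 := regular_L2vec.
Let y2 := regular_L2.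

Lemma latent_L2vec : L2vec P q.
Proof. by have [mq q2 _] := lfm_q lfm; exact: random_vectorP. Qed.

Lemma noise_L2vec : L2vec P e.
Proof. by have [me e2 _] := lfm_e lfm; exact: random_vectorP. Qed.

Let q2 := latent_L2vec.
Let e2 := noise_L2vec.

Lemma relevant_sub : (By <= range_mx Sx)%VS.
Proof. by have [[]] := rel. Qed.

Let pB := orthoproj By.
Let pC := orthoproj (complement P x By).

Let pBC : orthoproj (range_mx Sx) = pB + pC.
Proof. exact: orthoproj_orthoc relevant_sub. Qed.

(** Almost surely x lies in the range of its covariance, where it is the sum of
    its relevant and irrelevant parts; the latter cancels from the latent factor
    model. *)
Lemma project_relevant_ae : {ae P, forall w, pB *m x w = q w + sigma *: e w}.
Proof.
apply: filterS2 (ae_range x2) (lfm_x lfm) => w.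
rewrite pBC mulmxDl => xE xE'.
by apply: (@addIr _ (pC *m x w)); rewrite xE; exact: xE'.
Qed.

Lemma relevant_cov : cov_mx P (project By x) = S1.
Proof.
have [qe _] := lfm_indep lfm.
have [_ _ qc] := lfm_q lfm; have [_ _ ec] := lfm_e lfm.
have qe2 : L2vec P (fun w => q w + sigma *: e w) by apply: L2vecD => //; exact: L2vecZ.
rewrite /cov_mx (cross_mx_ae _ qe2 _ qe2 project_relevant_ae project_relevant_ae);
  do ?exact: L2vec_mul.
apply/matrixP => i j; rewrite !mxE.
have qq : L1 P (fun w => q w i 0 * q w j 0) by exact: L2_mul.
have ee : L1 P (fun w => e w i 0 * e w j 0) by exact: L2_mul.
have [qi qi0] := centered_esp (qc i); have [qj qj0] := centered_esp (qc j).
have [ei ei0] := centered_esp (ec i); have [ej ej0] := centered_esp (ec j).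
have [qe1 qe0] := indep_coord qe qi ej; rewrite qi0 mul0r in qe0.
have [eq1 eq0] := indep_coord qe qj ei; rewrite qj0 mul0r in eq0.
have A1 := L1Z sigma qe1; have B1 := L1Z sigma eq1; have C1 := L1Z (sigma ^+ 2) ee.
transitivity (esp P (fun w => q w i 0 * q w j 0 + sigma * (q w i 0 * e w j 0) +
    sigma * (q w j 0 * e w i 0) + sigma ^+ 2 * (e w i 0 * e w j 0))).
  by apply: esp_eq => w; rewrite !mxE; ring.
rewrite (espD (L1D (L1D qq A1) B1) C1) (espD (L1D qq A1) B1) (espD qq A1).
by rewrite !espZ // qe0 eq0 !mulr0 !addr0.
Qed.

(** The response is a linear function of q plus eps, and both q and eps are
    independent of the centered vector e. *)
Lemma noise_uncorrelated : cov_vec P e y = 0.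
Proof.
have [qe epsI] := lfm_indep lfm.
have [_ _ qc] := lfm_q lfm; have [_ _ ec] := lfm_e lfm.
have [meps epsc] := lfm_eps lfm; have [eps1 eps0] := centered_esp epsc.
pose y' w := dot (q w) alpha + eps w.
have dq2 : L2 P (fun w => dot (q w) alpha).
  rewrite (_ : (fun _ => _) = fun w => dot alpha (q w)); first exact: L2_dot.
  by apply/funext => w; rewrite dotC.
have my' : measurable_fun [set: T] y' by apply: measurable_funD => //; exact: dq2.1.
have y2' : L2 P y'.
  split=> //; apply: L1_ae y2.2; first exact: measurable_funX.
  by apply: filterS (lfm_y lfm) => w ->.
rewrite (cov_vec_ae e2 e2 y2 y2' _ (lfm_y lfm)); last exact: aeW.
apply/matrixP => j k; rewrite !mxE.
have [ej ej0] := centered_esp (ec j).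
have eps1' : L1 P (fun w => ((eps w)%:M : 'cV[R]_1) 0 0).
  by apply: L1_eq eps1 => w; rewrite mxE eqxx mulr1n.
have ej' : L1 P (fun w => col_mx (q w) (e w) (rshift p j) 0).
  by apply: L1_eq ej => w; rewrite col_mxEd.
have [h1 h2] := indep_coord epsI eps1' ej'.
have ejE : esp P (fun w => col_mx (q w) (e w) (rshift p j) 0) = 0.
  by rewrite -ej0; apply: esp_eq => w; rewrite col_mxEd.
rewrite ejE mulr0 in h2.
have eeps : L1 P (fun w => e w j 0 * eps w).
  by apply: L1_eq h1 => w; rewrite col_mxEd mxE eqxx mulr1n mulrC.
have eeps0 : esp P (fun w => e w j 0 * eps w) = 0.
  by rewrite -h2; apply: esp_eq => w; rewrite col_mxEd mxE eqxx mulr1n mulrC.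
transitivity (esp P (fun w => e w j 0 * dot (q w) alpha + e w j 0 * eps w)).
  by apply: esp_eq => w; rewrite /y' mulrDr.
rewrite (espD (L2_mul (e2 j) dq2) eeps) eeps0 addr0.
have qke (k0 : 'I_p) : L1 P (fun w => alpha k0 0 * (q w k0 0 * e w j 0)).
  by apply: L1Z; exact: L2_mul.
transitivity (esp P (fun w => \sum_k0 alpha k0 0 * (q w k0 0 * e w j 0))).
  apply: esp_eq => w; rewrite /dot mulr_sumr; apply: eq_bigr => k0 _; ring.
rewrite esp_sum // big1 // => k0 _.
have [qk qk0] := centered_esp (qc k0).
have [qe1 qe0] := indep_coord qe qk ej.
by rewrite espZ // qe0 qk0 mul0r mulr0.
Qed.

Lemma response_cov_in_range : orthoproj (range_mx Sx) *m sxy = sxy.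
Proof.
rewrite -cov_vec_mul //; apply: cov_vec_ae => //; first exact: L2vec_mul.
- exact: ae_range.
- exact: aeW.
Qed.

Lemma relevant_cov_vec : cov_vec P (project By x) y = sxy.
Proof.
have [[_ c0 _] _] := rel.
rewrite -[RHS]response_cov_in_range pBC mulmxDl -!cov_vec_mul //.
by rewrite -[X in _ = _ + X]/(cov_vec P (project (complement P x By) x) y) c0 addr0.
Qed.

Lemma response_cov : sxy = sqy.
Proof.
rewrite -relevant_cov_vec.
have qe2 : L2vec P (fun w => q w + sigma *: e w) by apply: L2vecD => //; exact: L2vecZ.
rewrite (cov_vec_ae _ qe2 y2 y2 project_relevant_ae); [|exact: L2vec_mul|exact: aeW].
have ey0 := noise_uncorrelated.
apply/matrixP => i j; rewrite !mxE.
have qy : L1 P (fun w => q w i 0 * y w) by exact: L2_mul.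
have ey : L1 P (fun w => e w i 0 * y w) by exact: L2_mul.
transitivity (esp P (fun w => q w i 0 * y w + sigma * (e w i 0 * y w))).
  by apply: esp_eq => w; rewrite !mxE; ring.
rewrite (espD qy (L1Z sigma ey)) (espZ _ ey).
by move/matrixP: ey0 => /(_ i 0); rewrite !mxE => ->; rewrite mulr0 addr0.
Qed.

(** The relevant and irrelevant parts of x are uncorrelated, so Sx preserves By
    and acts on it as the covariance of the relevant part. *)
Lemma cov_on_relevant v : v \in By -> Sx *m v = S1 *m v.
Proof.
move=> vB; have [[_ _ cr] _] := rel.
have Sv : orthoproj (range_mx Sx) *m (Sx *m v) = Sx *m v.
  by apply: orthoproj_id; apply/range_mxP; exists v.
have pv : pB *m v = v by exact: orthoproj_id.
rewrite -Sv pBC mulmxDl -relevant_cov /cov_mx cross_mx_mul // -/(cov_mx P x) -/Sx.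
rewrite orthoproj_sym -/pB -!mulmxA pv.
have : pC *m Sx *m pB = 0.
  by rewrite -cr cross_mx_mul // -/(cov_mx P x) orthoproj_sym.
by move=> /(congr1 (mulmx^~ v)); rewrite mul0mx -!mulmxA pv => ->; rewrite addr0.
Qed.

Lemma S1_stable v : v \in By -> S1 *m v \in By.
Proof.
by move=> vB; rewrite -relevant_cov /cov_mx cross_mx_mul // -!mulmxA orthoproj_in.
Qed.

Lemma response_cov_relevant : sxy \in By.
Proof.
rewrite response_cov; apply: subvP (lfm_q_range lfm) _ _.
have /andP[r1 _] := lfm_q_rank lfm.
by rewrite (lfm_q_krylov lfm) krylov_base.
Qed.

Lemma krylov_relevant s : (krylov s Sx sxy <= By)%VS.
Proof.
apply: krylov_stable; first exact: response_cov_relevant.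
by move=> v vB; rewrite cov_on_relevant // S1_stable.
Qed.

Lemma krylov_S1 s : krylov s Sx sxy = krylov s S1 sqy.
Proof.
rewrite -response_cov; apply: krylov_eq_on; first exact: response_cov_relevant.
  exact: S1_stable.
exact: cov_on_relevant.
Qed.

(** The parsimonious reductions are thus determined by (Sx, sxy), and so is
    every quantity built from them. *)
Lemma reductionE s : reduction P x y By s = krylov s Sx sxy.
Proof. by rewrite /reduction relevant_cov relevant_cov_vec krylov_S1 response_cov. Qed.

Lemma cov_posdef s : posdef_on Sx (krylov s Sx sxy).
Proof.
move=> v vK; apply: posdef_range (cov_mx_psd x2) _ _.
exact: subvP relevant_sub _ (subvP (krylov_relevant s) _ vK).
Qed.

Lemma reduced_cov s : cov_mx P (reduced_features P x y By s) =
  compress Sx (krylov s Sx sxy).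
Proof.
have xB2 : L2vec P (project By x) by exact: L2vec_mul.
transitivity (orthoproj (reduction P x y By s) *m cov_mx P (project By x) *m
    (orthoproj (reduction P x y By s))^T); first exact: cross_mx_mul.
have -> : cov_mx P (project By x) = pB *m Sx *m pB^T by exact: cross_mx_mul.
rewrite reductionE !orthoproj_sym /compress !mulmxA.
rewrite (orthoproj_mulr (krylov_relevant s)) -!mulmxA.
by rewrite (orthoproj_mull (krylov_relevant s)).
Qed.

Lemma reduced_cov_vec s : (0 < s)%N ->
  cov_vec P (reduced_features P x y By s) y = sxy.
Proof.
move=> s0; have xB2 : L2vec P (project By x) by exact: L2vec_mul.
transitivity (orthoproj (reduction P x y By s) *m cov_vec P (project By x) y).
  exact: cov_vec_mul.
rewrite relevant_cov_vec reductionE; apply: orthoproj_id.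
exact: krylov_base.
Qed.

(** The condition number is at least 1, and the second ratio in the maximum is 1
    because sxy lies in every Krylov space of positive order. *)
Lemma Mtilde_ge (Cs : R) s : (0 < s)%N -> 0 <= Cs ->
  8 * Cs <= Mtilde P x y By Cs s.
Proof.
move=> s0 Cs0; have [_ _ [b0 _] _ _] := reg; rewrite -/sxy in b0.
rewrite /Mtilde reduced_cov reduced_cov_vec // -/Sx -/sxy.
have bK : sxy \in krylov s Sx sxy by exact: krylov_base.
have k1 : 1 <= kappa2 (compress Sx (krylov s Sx sxy)).
  apply: kappa_compress_ge1; [exact: cov_mx_psd|exact: cov_posdef|].
  exact: vspace_neq0 bK b0.
rewrite divff; last by rewrite gt_eqF // enorm_gt0.
set mx := Num.max _ _; have mx1 : 1 <= mx by rewrite le_max lexx orbT.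
apply: (@le_trans _ _ (2 * 1 * (4 * Cs + 1) * 1)); first by lra.
apply: ler_pM => //; first by lra.
by rewrite ler_pM2r ?ler_pM2l //; lra.
Qed.

End Population.

(** * Choice of the constants and conclusion *)

Section Radii.
Context (R : realType) (p : nat).

(** The conclusion of early_stop_stable as a property of the radius, which
    depends on the moments and the order alone. *)
Definition stop_radius (S0 : 'M[R]_p) (b0 : 'cV[R]_p) r (eta : R) :=
  0 < eta /\ forall S b, psd S -> close_mx eta S S0 -> close_mx eta b b0 ->
    forall w lo up tau, w \in krylov r.+1 S0 b0 -> w != 0 ->
    dot w (S0 *m w) <= up * dot w w -> 0 <= lo ->
    (forall v, v \in krylov r S0 b0 -> lo * dot v v <= dot v (S0 *m v)) ->
    (2 * tau - 5) / 4 < 81 / 121 * (lo / up) ->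
    (early_stop tau S b <= (r%:R)%:E)%E.

(** By the Cauchy-Schwarz inequality |sxy|^2 <= tr Sx * E y^2, and therefore
    every E x_j^2, as well as E y^2, is at most tail_factor Sx sxy * E y^2. *)
Definition tail_factor (S : 'M[R]_p) (b : 'cV[R]_p) :=
  1 + \tr S ^+ 2 / enorm b ^+ 2.

(** The deviations of the sample moments are measured by the square root of 3 k
    D / n, where k is the complexity and D = tail_factor * E y^2; this factor
    bounds their quotient by K delta. *)
Definition deviation_factor (S : 'M[R]_p) (b : 'cV[R]_p) :=
  enorm b * Num.sqrt (3 * tail_factor S b / ln 2).

(** How large the constant C~_s has to be at the moments (S, b). *)
Definition stop_constant (S : 'M[R]_p) (b : 'cV[R]_p) s (c : R) :=
  1 <= c /\ forall r, s = r.+1 -> (0 < r)%N -> S^T = S ->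
    (forall a : 'cV_r.+1, kry r.+1 S b *m a = 0 -> a = 0) ->
    posdef_on S (krylov r.+1 S b) ->
    exists2 eta, stop_radius S b r eta &
      (p * p.+1).+1%:R * deviation_factor S b / eta <= c.

Lemma stop_constant_exists S b s : exists c, stop_constant S b s c.
Proof.
case: s => [|r]; first by exists 1; split.
have [H|H] := pselect ((0 < r)%N /\ S^T = S /\
    (forall a : 'cV_r.+1, kry r.+1 S b *m a = 0 -> a = 0) /\
    posdef_on S (krylov r.+1 S b)); last first.
  exists 1; split => // _ [<-] r0 Ss inj pos; exfalso; exact: H.
have [r0 [Ss [inj pos]]] := H.
have [eta eta0 h] := early_stop_stable r0 Ss inj pos.
exists (Num.max 1 ((p * p.+1).+1%:R * deviation_factor S b / eta)).
split; first by rewrite le_max lexx.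
move=> _ [<-] _ _ _ _; exists eta; first by split.
by rewrite le_max lexx orbT.
Qed.

(** How large the constant of the noise condition has to be at the moments (S0,
    b0) of the latent features and the response. *)
Definition range_constant (S0 : 'M[R]_p) (b0 : 'cV[R]_p) (c : R) :=
  1 <= c /\ (psd S0 -> range_mx S0 = krylov (\rank S0) S0 b0 ->
  exists eta, [/\ 0 < eta, eigval (\rank S0) S0 / eta <= c &
    forall S b, close_mx eta S S0 -> close_mx eta b b0 ->
    forall v, v \in krylov (\rank S0) S b ->
    9 / 11 * eigval (\rank S0) S0 * dot v v <= dot v (S *m v)]).

Lemma range_constant_exists S b : exists c, range_constant S b c.
Proof.
have [H|H] := pselect (psd S /\ range_mx S = krylov (\rank S) S b); last first.
  by exists 1; split => // Sp Sr; exfalso; exact: H.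
have [Sp Sr] := H; have [eta eta0 h] := range_lower_stable Sp Sr.
exists (Num.max 1 (eigval (\rank S) S / eta)).
split; first by rewrite le_max lexx.
by move=> _ _; exists eta; split => //; rewrite le_max lexx orbT.
Qed.

Lemma psd_entry_le1 (S : 'M[R]_p) i j : psd S -> eigval 1 S = 1 -> `|S i j| <= 1.
Proof.
move=> Sp S1; have [Ss Sn] := Sp.
have diag k : S k k <= 1.
  have := rayleigh_le (delta_mx k 0) Ss.
  by rewrite S1 mul1r !dot_delta -colE !mxE !eqxx.
have quad (a : R) : a ^+ 2 = 1 -> 0 <= S i i + S j j + 2 * a * S i j.
  move=> a2; have := Sn (delta_mx i 0 + a *: delta_mx j 0).
  rewrite mulmxDr -scalemxAr !dotDl !dotDr !dotZl !dotZr !dot_delta -!colE !mxE.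
  rewrite -[S j i](_ : S i j = _); last by rewrite -{1}Ss mxE.
  rewrite mulrA -expr2 a2; lra.
have := quad 1 (expr1n _ _); have := quad (-1) _; rewrite sqrrN expr1n => /(_ erefl).
have := diag i; have := diag j; rewrite ler_norml => *; apply/andP; split; lra.
Qed.

Lemma trace_bound (S : 'M[R]_p) k : psd S -> S k k <= \tr S.
Proof.
move=> [_ Sn]; rewrite /mxtrace (bigD1 k) //= lerDl; apply: sumr_ge0 => i _.
by have := Sn (delta_mx i 0); rewrite dot_delta -colE mxE.
Qed.

End Radii.

(** The level t shares the probability nu between the event that some
    observation exceeds t and the exceptional sets of the weak law, each getting
    at most nu / 2. Here m is the expected maximum, k the complexity, X stands
    for K delta and M for M~_s. *)
Lemma tail_budget (R : realType) (n N N' m k th sy bn l eta nu c X M : R) :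
  0 <= m <= 3 * k -> 1 <= th -> 0 < sy -> 0 < bn -> 0 < l -> 0 < n -> 0 <= N -> N <= N' -> 1 <= N' ->
  0 < eta -> sy / bn * Num.sqrt (k * l / n) <= X -> 1 <= c -> 8 * c <= M ->
  N' * (bn * Num.sqrt (3 * th / l)) / eta <= c -> M * X < nu -> nu < 2^-1 ->
  let D := th * sy ^+ 2 in let t := n * eta ^+ 2 * nu / (8 * N' * D) in
  [/\ 0 < t, m / t <= 3^-1, 2 * m / n * D <= (eta / 2) ^+ 2 &
      m / t + N * (4 * t * D / (n * eta ^+ 2)) <= 2 * nu].
Proof.
move=> /andP[m0 mk] th1 sy0 bn0 l0 n0 Nge NN NR eta0 XL c1 cM dc MX nu2 D t.
have k0 : 0 <= k by lra.
have N0 : 0 < N' by lra.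
have X0 : 0 <= X by apply: le_trans XL; rewrite mulr_ge0 ?divr_ge0 ?sqrtr_ge0 ?ltW.
have cX : 8 * c * X <= nu.
  by apply: le_trans (ltW MX); exact: ler_wpM2r.
have nu0 : 0 < nu.
  by apply: le_lt_trans MX; rewrite mulr_ge0 //; apply: le_trans cM; lra.
have D0 : 0 < D by rewrite mulr_gt0 ?exprn_gt0 //; lra.
have key : m * D / n <= eta ^+ 2 * nu ^+ 2 / (64 * N' ^+ 2).
  set a := Num.sqrt (3 * th / l) in dc; set s := Num.sqrt (k * l / n) in XL.
  have a2 : a ^+ 2 = 3 * th / l by rewrite sqr_sqrtr // divr_ge0 ?ltW //; lra.
  have s2 : s ^+ 2 = k * l / n by rewrite sqr_sqrtr // !mulr_ge0 ?invr_ge0 // ltW.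
  have a0 : 0 <= a by exact: sqrtr_ge0.
  have s0 : 0 <= s by exact: sqrtr_ge0.
  have dc' : N' * (bn * a) <= c * eta by rewrite -ler_pdivrMr.
  have XL' : sy * s <= X * bn by rewrite -ler_pdivrMr // mulrAC.
  have h1 : (N' * (bn * a)) * (sy * s) <= (c * eta) * (X * bn).
    by apply: ler_pM => //; rewrite !mulr_ge0 //; lra.
  have h2 : N' * (a * (sy * s)) <= eta * nu / 8.
    rewrite -(ler_pM2l bn0); apply: le_trans (_ : c * eta * (X * bn) <= _).
      by apply: le_trans h1; rewrite le_eqVlt; apply/orP; left; apply/eqP; ring.
    have := ler_wpM2l (ltW (mulr_gt0 eta0 bn0)) cX; lra.
  have h3 : (N' * (a * (sy * s))) ^+ 2 <= (eta * nu / 8) ^+ 2.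
    have P1 : 0 <= N' * (a * (sy * s)) by rewrite !mulr_ge0 // ltW.
    have P2 : 0 <= eta * nu / 8 by rewrite divr_ge0 // mulr_ge0 // ltW.
    by rewrite ler_pXn2r // nnegrE.
  have e1 : (N' * (a * (sy * s))) ^+ 2 = N' ^+ 2 * (3 * k * D / n).
    rewrite !exprMn a2 s2 /D; field; rewrite !gt_eqF //.
  rewrite e1 in h3.
  rewrite ler_pdivlMr; last by rewrite mulr_gt0 // exprn_gt0; lra.
  have h4 : m * D / n <= 3 * k * D / n.
    by rewrite ler_pM2r ?invr_gt0 // ler_pM2r.
  have N20 : 0 < N' ^+ 2 by rewrite exprn_gt0; lra.
  have := ler_wpM2l (ltW N20) h4; move: h3.
  rewrite (_ : (eta * nu / 8) ^+ 2 = eta ^+ 2 * nu ^+ 2 / 64); last by field.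
  lra.
have t0 : 0 < t.
  apply: divr_gt0; last by apply: mulr_gt0 => //; exact: mulr_gt0.
  by apply: mulr_gt0 => //; apply: mulr_gt0 => //; exact: exprn_gt0.

have mt : m / t <= nu / 8.
  rewrite (_ : m / t = 8 * N' / (eta ^+ 2 * nu) * (m * D / n)); last first.
    by rewrite /t; field; rewrite !gt_eqF.
  apply: le_trans (_ : 8 * N' / (eta ^+ 2 * nu) * (eta ^+ 2 * nu ^+ 2 / (64 * N' ^+ 2)) <= _).
    by apply: ler_wpM2l => //; rewrite divr_ge0 ?mulr_ge0 ?exprn_ge0 ?ltW.
  rewrite (_ : _ * _ = nu / 8 / N'); last by field; rewrite !gt_eqF.
  by rewrite ler_pdivrMr // ler_peMr //; lra.
split=> //; first by lra.
  rewrite (_ : 2 * m / n * D = 2 * (m * D / n)); last by ring.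
  have h : eta ^+ 2 * nu ^+ 2 / (64 * N' ^+ 2) <= eta ^+ 2 / 8.
    rewrite ler_pdivrMr ?mulr_gt0 ?exprn_gt0 //.
    rewrite (_ : eta ^+ 2 / 8 * _ = eta ^+ 2 * (8 * N' ^+ 2)); last by field.
    apply: ler_wpM2l; first exact: sqr_ge0.
    have : nu ^+ 2 <= 1 by rewrite exprn_ile1 //; lra.
    have : 1 <= N' ^+ 2 by rewrite exprn_ege1.
    lra.
  rewrite expr_div_n; lra.
have -> : N * (4 * t * D / (n * eta ^+ 2)) = N / N' * (nu / 2).
  by rewrite /t; field; rewrite !gt_eqF.
have : N / N' * (nu / 2) <= 1 * (nu / 2).
  apply: ler_wpM2r; first by lra.
  by rewrite ler_pdivrMr // mul1r.
lra.
Qed.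

Lemma le_3sum (R : realDomainType) (a b c d k : R) :
  a <= b + c + d -> b <= k -> c <= k -> d <= k -> a <= 3 * k.
Proof. lra. Qed.

Section Sampling.
Context d (T : measurableType d) (R : realType) (P : probability T R) (p : nat).
Context (x : T -> 'cV[R]_p) (y : T -> R).
Context (xs : nat -> T -> 'cV[R]_p) (ys : nat -> T -> R).

Lemma with_prob_ge_le (c c' : R) (A A' : set T) : with_prob_ge P c A ->
  c' <= c -> A `<=` A' -> with_prob_ge P c' A'.
Proof.
move=> [E [mE EA PE]] cc AA; exists E; split=> //; first exact: subset_trans AA.
by apply: le_trans PE; rewrite lee_fin.
Qed.

Lemma sample_cov_psd n w : psd (sample_cov xs n w).
Proof.
split.
  by rewrite /sample_cov linearZ /= trmx_mul trmxK.
move=> v; rewrite /sample_cov -scalemxAl dotZr mulr_ge0 ?invr_ge0 ?ler0n //.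
by rewrite -mulmxA -dot_mull dot_ge0.
Qed.

Context (x2 : L2vec P x).
Context (y2 : L2 P y).
Context (iid : iid_sample P x y xs ys).

(** Pythagoras' theorem for the three mutually orthogonal subspaces. *)
Lemma sample_max_le (V W : {vspace 'cV[R]_p}) n :
  (W <= range_mx (cov_mx P x))%VS -> (V <= W)%VS ->
  esp P (sample_max P x xs n) <=
    esp P (max_norm xs V n) + esp P (max_norm xs (orthoc W V) n) +
    esp P (max_norm xs (complement P x W) n).
Proof.
move=> WS VW; have L B := L1_max_norm x2 y2 iid B n.
rewrite -(espD (L _) (L _)) -(espD (L1D (L _) (L _)) (L _)).
have sq (U : {vspace 'cV[R]_p}) u : dot (orthoproj U *m u) (orthoproj U *m u) =
    dot u (orthoproj U *m u).
  by rewrite dot_mull orthoproj_sym mulmxA orthoproj_idem.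
have decomp u : dot (orthoproj (range_mx (cov_mx P x)) *m u)
    (orthoproj (range_mx (cov_mx P x)) *m u) =
    dot (orthoproj V *m u) (orthoproj V *m u) +
    dot (orthoproj (orthoc W V) *m u) (orthoproj (orthoc W V) *m u) +
    dot (orthoproj (complement P x W) *m u) (orthoproj (complement P x W) *m u).
  rewrite (sq V) (sq (orthoc W V)) (sq (complement P x W)) (sq (range_mx _)).
  rewrite -dotDr -mulmxDl -(orthoproj_orthoc VW) -dotDr -mulmxDl.
  by rewrite -(orthoproj_orthoc WS).
have L' : L1 P (fun w => max_norm xs V n w + max_norm xs (orthoc W V) n w +
    max_norm xs (complement P x W) n w) by apply: L1D => //; exact: L1D.
have ptw w : sample_max P x xs n w <= max_norm xs V n w +
    max_norm xs (orthoc W V) n w + max_norm xs (complement P x W) n w.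
  have ge0 B : 0 <= max_norm xs B n w.
    exact: (bigmax_ge0 (fun i => enorm (project B (xs i) w) ^+ 2)).
  apply: bigmax_le => [|i _]; first by rewrite !addr_ge0.
  rewrite /project decomp -!enorm_sqr.
  have ub B : enorm (orthoproj B *m xs i w) ^+ 2 <= max_norm xs B n w.
    exact: (bigmax_ub (fun i => enorm (project B (xs i) w) ^+ 2) (ltn_ord i)).
  by apply: lerD; [apply: lerD|]; exact: ub.
apply: esp_le => //; apply: L1_eq (L (range_mx (cov_mx P x))) => w.
by apply: eq_bigr => i _; exact: enorm_sqr.
Qed.

End Sampling.
Theorem theorem3p9 (R : realType) :
  exists C : R, 1 <= C /\
  exists Ct : forall p : nat, 'M[R]_p -> 'cV[R]_p -> nat -> R,
    (forall p Sx sxy s, 1 <= Ct p Sx sxy s) /\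
  exists Cq : forall p : nat, 'M[R]_p -> 'cV[R]_p -> R,
    (forall p Sq sqy, 1 <= Cq p Sq sqy) /\
  forall (d : measure_display) (T : measurableType d) (P : probability T R)
    (p : nat) (x : T -> 'cV[R]_p) (y : T -> R)
    (By : {vspace 'cV[R]_p}) (q : T -> 'cV[R]_p) (alpha : 'cV[R]_p)
    (eps : T -> R) (sigma : R) (e : T -> 'cV[R]_p)
    (xs : nat -> T -> 'cV[R]_p) (ys : nat -> T -> R)
    (Bt : nat -> nat -> {vspace 'cV[R]_p}) (tau : R) (n : nat),
  let Sx := cov_mx P x in
  let sxy := cov_vec P x y in
  let Sq := cov_mx P q in
  let sqy := cov_vec P q y in
  let rq := \rank Sq in
  let K s k := Kconst P x y C (Bt s k) in
  let dl s k := delta P x xs (Bt s k) k in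
  let nuB s := Mtilde P x y By (Ct p Sx sxy s) s * K s n * dl s n in
  regular_pair P x y ->
  relevant_subspace P x y By ->
  latent_factor_model P x y By q alpha eps sigma e ->
  (rq + 1 <= relevant_dim P x y By)%N ->
  8 <= tau ->
  sigma ^+ 2 < eigval rq Sq / (tau * (Cq p Sq sqy + 1)) ->
  iid_sample P x y xs ys ->
  (0 < n)%N ->
  (forall s k, (1 <= s <= rq + 1)%N -> (0 < k)%N ->
     maximizer P x y xs By s k (Bt s k)) ->
  {ae P, forall w,
     (\dim (krylov p Sx sxy) <=
      \dim (krylov p (sample_cov xs n w) (sample_cov_vec xs ys n w)))%N} ->
  (forall s, (1 <= s <= rq + 1)%N ->
     (dl s k @[k --> \oo] --> (0 : R)) /\ nuB s < 2^-1) ->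
  forall nu : R, nuB (rq + 1)%N < nu -> nu < 2^-1 ->
  K (rq + 1)%N n * nu^-1 * dl (rq + 1)%N n <
    eigval rq Sq / (6 * tau * Num.max (opnorm Sx) (enorm sxy)) ->
  with_prob_ge P (1 - 2 * nu)
    [set w | (early_stop tau (sample_cov xs n w) (sample_cov_vec xs ys n w)
              <= (rq%:R)%:E)%E].

Proof.
exists 1; split => //.
pose Ct p Sx sxy s : R := sval (cid (@stop_constant_exists R p Sx sxy s)).
have CtP p Sx sxy s : stop_constant Sx sxy s (Ct p Sx sxy s).
  exact: svalP (cid (@stop_constant_exists R p Sx sxy s)).
exists Ct; split; first by move=> p Sx sxy s; have [] := CtP p Sx sxy s.
pose Cq p Sq sqy : R := sval (cid (@range_constant_exists R p Sq sqy)).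
have CqP p Sq sqy : range_constant Sq sqy (Cq p Sq sqy).
  exact: svalP (cid (@range_constant_exists R p Sq sqy)).
exists Cq; split; first by move=> p Sq sqy; have [] := CqP p Sq sqy.
move=> d T P p x y By q alpha eps sigma e xs ys Bt tau n Sx sxy Sq sqy rq K dl nuB.
move=> reg rel lfm rqm tau8 sig iid n0 Btmax _ dnu nu nuBnu nu2 _.
have x2 := regular_L2vec reg; have y2 := regular_L2 reg.
have [_ _ [b0 sy0] _ [Ly Lx]] := reg; rewrite -/sxy in b0.
have q2 := latent_L2vec lfm; have Sqp := cov_mx_psd q2; rewrite -/Sq in Sqp.
have /andP[r1 _] := lfm_q_rank lfm; rewrite -/Sq -/rq in r1.
have Sxp := cov_mx_psd x2; rewrite -/Sx in Sxp; have [Sxs _] := Sxp.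
have By_sub := relevant_sub rel; rewrite -/Sx in By_sub.
have KBy s : (krylov s Sx sxy <= By)%VS by exact: krylov_relevant reg rel lfm s.
have redE s : reduction P x y By s = krylov s Sx sxy by exact: reductionE reg rel lfm s.
rewrite !addn1 in rqm nuBnu dnu Btmax *.
have dimK : \dim (krylov rq.+1 Sx sxy) = rq.+1.
  by apply: dim_krylov_full; rewrite -redE; exact: rqm.
have inj := free_cols dimK; rewrite -/(kry rq.+1 Sx sxy) in inj.
have pos : posdef_on Sx (krylov rq.+1 Sx sxy) by exact: cov_posdef reg rel lfm rq.+1.
have rank2 : (1 < \rank Sx)%N.
  have [M FM] : exists M, kry rq.+1 Sx sxy = Sx *m M.
    apply: range_factor => c; apply: (subvP By_sub); apply: (subvP (KBy rq.+1)).
    by apply/mem_krylov; exists c.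
  apply: leq_trans (_ : rq.+1 <= _)%N; first by rewrite ltnS.
  by rewrite -(inj_rank inj) FM mxrankM_maxl.
have [eq1 [etaq [etaq0 etaqC lowq]]] : 1 <= Cq p Sq sqy /\ exists eta, [/\ 0 < eta,
    eigval rq Sq / eta <= Cq p Sq sqy &
    forall S b, close_mx eta S Sq -> close_mx eta b sqy ->
    forall v, v \in krylov rq S b -> 9 / 11 * eigval rq Sq * dot v v <= dot v (S *m v)].
  have [h1 h2] := CqP p Sq sqy; split => //; apply: h2 => //.
  exact: lfm_q_krylov lfm.
have lam0 : 0 <= eigval rq Sq by exact: eigval_ge0.
have sigma2 : sigma ^+ 2 * (tau * (Cq p Sq sqy + 1)) < eigval rq Sq.
  by rewrite -ltr_pdivlMr // mulr_gt0; lra.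
have sigma20 := sqr_ge0 sigma.
have ctau : 8 * (Cq p Sq sqy + 1) <= tau * (Cq p Sq sqy + 1) by rewrite ler_wpM2r //; lra.
have sig8 := ler_wpM2l sigma20 ctau.
(* C_(r_q) was chosen so that the noise level lies within the stability radius
   of (Sq, sqy). *)
have sigq : sigma ^+ 2 <= etaq.
  rewrite ler_pdivrMr // in etaqC; rewrite -(ler_pM2l (_ : 0 < Cq p Sq sqy)); last by lra.
  have : 0 <= sigma ^+ 2 * Cq p Sq sqy by rewrite mulr_ge0 //; lra.
  lra.
pose S1 := Sq + sigma ^+ 2 *: cov_mx P e.
have low v : v \in krylov rq Sx sxy -> 9 / 11 * eigval rq Sq * dot v v <= dot v (Sx *m v).
  move=> vK; have vB := subvP (KBy rq) _ vK.
  rewrite (cov_on_relevant reg rel lfm vB) -/S1.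
  apply: (lowq S1 sqy); last by rewrite -(krylov_S1 reg rel lfm).
    move=> i j; rewrite /S1 !mxE addrAC subrr add0r normrM.
    apply: le_trans sigq; rewrite (ger0_norm sigma20) ler_piMr //.
    have := psd_entry_le1 i j (cov_mx_psd (noise_L2vec lfm)) (lfm_e_norm lfm).
    by rewrite mxE.
  by move=> i j; rewrite subrr normr0 ltW.
(* The product of Sq with the Krylov matrix has rank at most rq but rq + 1
   columns, so Sq kills a vector of the Krylov space, along which only the noise
   contributes. *)
have [w [wK w0 wup]] : exists w, [/\ w \in krylov rq.+1 Sx sxy, w != 0 &
    dot w (Sx *m w) <= sigma ^+ 2 * dot w w].
  have [c [c0 Sc]] : exists c : 'cV_rq.+1, c != 0 /\ Sq *m (kry rq.+1 Sx sxy *m c) = 0.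
    apply: contrapT => none.
    have : \rank (Sq *m kry rq.+1 Sx sxy) = rq.+1.
      apply: inj_rank => c; rewrite -mulmxA => c0; apply/eqP/negPn/negP => c1.
      by apply: none; exists c.
    by have := mxrankM_maxl Sq (kry rq.+1 Sx sxy); rewrite -/rq => + E; rewrite E ltnn.
  have wK : kry rq.+1 Sx sxy *m c \in krylov rq.+1 Sx sxy by apply/mem_krylov; exists c.
  exists (kry rq.+1 Sx sxy *m c); split => //.
    by apply: contraNneq c0 => /inj ->.
  rewrite (cov_on_relevant reg rel lfm (subvP (KBy _) _ wK)) -/Sq mulmxDl Sc add0r.
  rewrite -scalemxAl dotZr; apply: ler_wpM2l => //.
  have [es _] := cov_mx_psd (noise_L2vec lfm).
  by have := rayleigh_le (kry rq.+1 Sx sxy *m c) es; rewrite (lfm_e_norm lfm) mul1r.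
have sigma_gt0 : 0 < sigma ^+ 2.
  by have := lt_le_trans (pos w wK w0) wup; rewrite pmulr_lgt0 // dot_gt0.
(* Here 81/121 * 9/11 > 1/2 and C_(r_q) + 1 >= 2 make the right-hand side larger
   than tau. *)
have stop_ratio : (2 * tau - 5) / 4 < 81 / 121 * (9 / 11 * eigval rq Sq / sigma ^+ 2).
  have h : tau * 2 <= eigval rq Sq / sigma ^+ 2.
    rewrite ler_pdivlMr // mulrC; apply: le_trans (ltW sigma2).
    by rewrite ler_pM2l // ler_pM2l; lra.
  by rewrite -(mulrA (9 / 11)); lra.
have [Ct1 CtE] := CtP p Sx sxy rq.+1.
have [eta [eta0 stop] etaC] := CtE rq erefl r1 Sxs inj pos.
set c := Ct p Sx sxy rq.+1 in Ct1 etaC nuBnu.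
set B := Bt rq.+1 n in nuBnu.
have [Bmem Bmax] := Btmax rq.+1 n (leqnn _) n0; rewrite -/B in Bmem Bmax.
set comp := complexity P x xs n in Bmax.
have cand (B' : {vspace 'cV[R]_p}) : B' \in [:: reduction P x y By rq.+1;
    orthoc By (reduction P x y By rq.+1); complement P x By] ->
    (B' <= range_mx Sx)%VS.
  rewrite !inE => /or3P[] /eqP ->.
  - by rewrite redE; apply: subv_trans (KBy _) By_sub.
  - by apply: subv_trans By_sub; exact: capvSl.
  - exact: capvSl.
have BS : (B <= range_mx Sx)%VS by exact: cand.
have max_le B' : B' \in [:: reduction P x y By rq.+1;
    orthoc By (reduction P x y By rq.+1); complement P x By] ->
    esp P (max_norm xs B' n) <= comp B.
  move=> B'm; apply: le_trans (Bmax B' B'm).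
  have h := max_norm_le_complexity x2 y2 iid Lx n (cand B' B'm).
  exact: h.
have mk : 0 <= esp P (sample_max P x xs n) <= 3 * comp B.
  rewrite esp_ge0 /=; last first.
    by move=> w'; exact: (bigmax_ge0 (fun i => dot (orthoproj (range_mx Sx) *m xs i w')
      (orthoproj (range_mx Sx) *m xs i w'))).
  have VW : (reduction P x y By rq.+1 <= By)%VS by rewrite redE.
  have h := sample_max_le x2 y2 iid n By_sub VW.
  have h1 := max_le (reduction P x y By rq.+1) (mem_head _ _).
  have h2 := max_le (orthoc By (reduction P x y By rq.+1)).
  rewrite !inE eqxx orbT in h2; have {}h2 := h2 isT.
  have h3 := max_le (complement P x By); rewrite !inE eqxx !orbT in h3.
  exact: le_3sum h h1 h2 (h3 isT).
pose vy := esp P (fun w => y w ^+ 2).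
pose sy := Num.sqrt vy; have sy_gt0 : 0 < sy by rewrite sqrtr_gt0.
have sy2 : sy ^+ 2 = vy by rewrite sqr_sqrtr // ltW.
have bn0 : 0 < enorm sxy by rewrite enorm_gt0.
have bn2 : 0 < enorm sxy ^+ 2 by rewrite exprn_gt0.
have ln20 : 0 < ln (2 : R) by rewrite ln_gt0 // ltr1n.
have th1 : 1 <= tail_factor Sx sxy by rewrite lerDl divr_ge0 ?sqr_ge0.
have XL := Kconst_delta_ge x2 y2 iid Ly Lx n BS rank2.
have cM := Mtilde_ge reg rel lfm (ltn0Sn rq) (le_trans ler01 Ct1).
have nR : 0 < n%:R :> R by rewrite ltr0n.
have NN : (p * p.+1)%:R <= (p * p.+1).+1%:R :> R by rewrite ler_nat.
have N1 : 1 <= (p * p.+1).+1%:R :> R by rewrite ler1n.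
have MX : Mtilde P x y By c rq.+1 * (Kconst P x y 1 B * delta P x xs B n) < nu.
  by rewrite mulrA.
have [t0 mt bias total] := tail_budget mk th1 sy_gt0 bn0 ln20 nR (ler0n _ _) NN N1 eta0 XL Ct1 cM
  etaC MX nu2.
set t := n%:R * eta ^+ 2 * nu / _ in t0 mt bias total.
set D := tail_factor Sx sxy * sy ^+ 2 in t t0 mt bias total.
have vyD : vy <= D by rewrite /D sy2 ler_peMl // ltW.
have SD j : Sx j j <= D.
  apply: le_trans (trace_bound j Sxp) _.
  have tr0 : 0 <= \tr Sx by apply: sumr_ge0 => i _; have := Sxp.2 (delta_mx i 0); rewrite dot_delta -colE mxE.
  (* Cauchy-Schwarz in each coordinate. *)
have btr : enorm sxy ^+ 2 <= \tr Sx * vy.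
    rewrite enorm_sqr /dot /mxtrace mulr_suml; apply: ler_sum => i _.
    have := esp_CS (x2 i) y2; rewrite -expr2 !mxE => h; apply: le_trans h _.
    by rewrite le_eqVlt; apply/orP; left; apply/eqP; congr (_ * _);
      apply: esp_eq => w'; rewrite expr2.
  rewrite /D /tail_factor sy2 mulrDl mul1r.
  have h : \tr Sx <= \tr Sx ^+ 2 / enorm sxy ^+ 2 * vy.
    rewrite mulrAC ler_pdivlMr // expr2 -mulrA; exact: ler_wpM2l.
  by apply: le_trans h _; rewrite lerDr ltW.
apply: with_prob_ge_le (moments_concentrate x2 y2 iid n0 t0 eta0 SD vyD mt bias) _ _.
  by rewrite lerD2l lerN2.
move=> w' [SS bb] /=.
apply: (stop _ _ (sample_cov_psd xs n w') SS bb _ _ _ _ wK w0 wup _ low stop_ratio).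
by rewrite mulr_ge0.
Qed.
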